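(* In the signal-plus-noise model and with the notation described in the context: (1) Almost surely, $\lim_{n\to\infty} \mathrm{SE}_n^*[\mathbf{x}] = \mathrm{ASE}^*[\mathbf{x}]$. (2) Let $\theta\in(\underline{\Theta}(\mathbf{x}),\overline{\Theta}(\mathbf{x}))$, and let $\theta_n$ be any sequence of thresholds (possibly random, possibly depending on $Y_n$) such that $\theta_n\to\theta$ almost surely. Then $\mathrm{SE}_n[\mathbf{x}|\theta_n]\to \mathrm{ASE}^*[\mathbf{x}]$ almost surely as $n\to\infty$.
   Context: Model. Fix $\gamma\in(0,1]$ and $p=p_n=\lceil\gamma n\rceil$. All random objects are on a common probability space. One observes the $n\times p$ matrix $Y_n=X_n+Z_n$, where: (i) $X_n=\sum_{i=1}^r x_i\mathbf{a}_{i,n}\mathbf{b}_{i,n}^\top$, with $r\ge1$ and $x_1>\dots>x_r>0$ fixed (independent of $n$); $\mathbf{x}=(x_1,\dots,x_r)$ is called the signal. (ii) $(\mathbf{a}_{i,n})_{i\le r}$ and $(\mathbf{b}_{i,n})_{i\le r}$ are uniformly distributed random orthonormal $r$-frames in $\mathbb{R}^n$ and $\mathbb{R}^p$ respectively, independent of each other. (iii) The noise $Z_n$ is independent of $X_n$. Let $z_{1,n}\ge\dots\ge z_{p,n}$ be its singular values and $F_{Z_n}(z)=p^{-1}\#\{i:z_{i,n}\le z\}$. There is a compactly supported (non-random) CDF $F_Z$ with $F_{Z_n}\to F_Z$ almost surely at continuity points of $F_Z$; its upper edge $z_+=\sup\{z:F_Z(z)<1\}$ satisfies $z_+>0$. (iv)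 $z_{1,n}=\|Z_n\|\to z_+$ almost surely. (v) $\lim_{y\downarrow z_+}\int (y-z)^{-2}dF_Z(z)=\infty$. Estimators and loss. Write an SVD $Y_n=\sum_{i=1}^p y_{i,n}\mathbf{u}_{i,n}\mathbf{v}_{i,n}^\top$ with $y_{1,n}\ge\dots\ge y_{p,n}\ge 0$ (for degenerate singular values, the right singular vectors form a Haar-random orthonormal basis of the corresponding singular subspace, with the corresponding left singular vectors). Put $\hat X_\theta=\sum_{i=1}^p y_{i,n}\mathbf{1}\{y_{i,n}>\theta\}\mathbf{u}_{i,n}\mathbf{v}_{i,n}^\top$, $\mathrm{SE}_n[\mathbf{x}|\theta]=\|X_n-\hat X_\theta\|_F^2$, and $\mathrm{SE}_n^*[\mathbf{x}]=\min_{\theta\ge0}\mathrm{SE}_n[\mathbf{x}|\theta]$ (oracle loss). Limiting functionals. For $y>z_+$ let $\varphi(y)=\int\frac{y}{y^2-z^2}dF_Z(z)$, $\tilde\varphi_\gamma(y)=\gamma\varphi(y)+\frac{1-\gamma}{y}$, $\mathcal{D}_\gamma(y)=\varphi(y)\tilde\varphi_\gamma(y)$ (positive, strictly decreasing, tending to $0$ at $\infty$), with derivative $\mathcal{D}_\gamma'$. Let $x_+=\lim_{y\downarrow z_+}\mathcal{D}_\gamma(y)^{-1/2}\ge 0$. For $x>x_+$ let $\mathcal{Y}(x)=\mathcal{D}_\gamma^{-1}(1/x^2)\in(z_+,\infty)$ and $\mathcal{C}(x)=-\frac{2}{x^3}\cdot\frac{1}{\mathcal{D}_\gamma'(\mathcal{Y}(x))}$.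 Put $y_{i,\infty}=\mathcal{Y}(x_i)$ if $i\le r$ and $x_i>x_+$, and $y_{i,\infty}=z_+$ if $i\le r$ and $x_i\le x_+$, or if $i>r$. Asymptotic loss. $R_0(x)=x^2$; $R_1(x)=x^2+\mathcal{Y}(x)^2-2x\mathcal{Y}(x)\mathcal{C}(x)$ if $x>x_+$ and $R_1(x)=x^2+z_+^2$ if $x\le x_+$; $\mathrm{ASE}^*[\mathbf{x}]=\sum_{i=1}^r\min\{R_0(x_i),R_1(x_i)\}$. Optimal threshold. $\Psi_\gamma(y)=y\,\mathcal{D}_\gamma'(y)/\mathcal{D}_\gamma(y)$ for $y>z_+$, and $T_\gamma(F_Z)=\inf\{y>z_+:\Psi_\gamma(y)\ge-4\}$ (which is $>z_+$). Asymptotic optimal interval. $\underline{\Theta}(\mathbf{x})=\max\{y_{i,\infty}:1\le i\le r+1,\ y_{i,\infty}<T_\gamma(F_Z)\}$ (so $\underline\Theta(\mathbf{x})\ge z_+$) and $\overline{\Theta}(\mathbf{x})=\min\{y_{i,\infty}:y_{i,\infty}>T_\gamma(F_Z)\}$, with $\overline{\Theta}(\mathbf{x})=\infty$ if $y_{1,\infty}\le T_\gamma(F_Z)$. *)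

(* Defs.v *)
From HB Require Import structures.
From mathcomp Require Import all_boot all_order all_algebra.
From mathcomp Require Import all_classical all_reals all_analysis.
Set Implicit Arguments.
Unset Strict Implicit.
Unset Printing Implicit Defensive.
Import Order.TTheory GRing.Theory Num.Theory.
Import numFieldNormedType.Exports.
Local Open Scope classical_set_scope.
Local Open Scope ring_scope.

(** Indices are 0-based: the i-th item of an informal list x_1, ..., x_r (or
    y_1, ..., y_p) is the item of index i - 1 of a sequence. *)

Section RandomMatrices.
Context {R : realType}.

(* The Borel sigma-algebra of 'M[R]_(m, n), generated by the coordinates. *)
Definition mx_coord_events (m n : nat) : set (set 'M[R]_(m, n)) :=
  \bigcup_(ij in [set: 'I_m * 'I_n])
    preimage_set_system [set: 'M[R]_(m, n)]
      (fun M : 'M[R]_(m, n) => M ij.1 ij.2 : measurableTypeR R) measurable.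

Definition mxBorel (m n : nat) := g_sigma_algebraType (@mx_coord_events m n).

Context {d : measure_display} {T : measurableType d}.

Definition random_mx (m n : nat) (A : T -> 'M[R]_(m, n)) : Prop :=
  measurable_fun [set: T] (A : T -> mxBorel m n).

Definition independent_mx (P : probability T R) (m n m' n' : nat)
    (A : T -> 'M[R]_(m, n)) (B : T -> 'M[R]_(m', n')) : Prop :=
  forall (E : set (mxBorel m n)) (F : set (mxBorel m' n')),
    measurable E -> measurable F ->
    P (A @^-1` E `&` B @^-1` F) = (P (A @^-1` E) * P (B @^-1` F))%E.

Definition same_law_mx (P : probability T R) (m n : nat)
    (A B : T -> 'M[R]_(m, n)) : Prop :=
  forall E : set (mxBorel m n), measurable E -> P (A @^-1` E) = P (B @^-1` E).

(* The columns of [A] form a random orthonormal r-frame of R^n whose law is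
   the uniform distribution, i.e. the unique probability on the Stiefel
   manifold which is invariant under the action of the orthogonal group. *)
Definition uniform_frame (P : probability T R) (n r : nat)
    (A : T -> 'M[R]_(n, r)) : Prop :=
  [/\ random_mx A,
      {ae P, forall w, (A w)^T *m A w = 1%:M}
    & forall O : 'M[R]_n, O^T *m O = 1%:M ->
        same_law_mx P (fun w => O *m A w) A].

End RandomMatrices.

Section Svd.
Context {R : realType}.

(* Thin singular value decomposition of a matrix with at least as many rows as
   columns. The singular values form a sequence of length [p], listed with
   multiplicity in non-increasing order. *)
Definition is_svd (n p : nat) (Y : 'M[R]_(n, p))
    (U : 'M[R]_(n, p)) (s : seq R) (V : 'M[R]_p) : Prop :=
  [/\ U^T *m U = 1%:M, V^T *m V = 1%:M,
      [/\ size s = p, sorted (fun x y : R => y <= x) s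
        & all (fun x : R => 0 <= x) s]
    & Y = \sum_(i < p) s`_i *: (col i U *m (col i V)^T)].

Definition singular_values (n p : nat) (Y : 'M[R]_(n, p)) (s : seq R) : Prop :=
  exists U V, is_svd Y U s V.

Definition frobenius_sq (n p : nat) (M : 'M[R]_(n, p)) : R :=
  \sum_(i < n) \sum_(j < p) M i j ^+ 2.

Definition empirical_cdf (s : seq R) (t : R) : R :=
  (count (fun x : R => x <= t) s)%:R / (size s)%:R.

(* For theta >= 0 this depends on the matrix only, and not on the SVD chosen
   when singular values are repeated or null. *)
Definition hard_threshold (n p : nat) (U : 'M[R]_(n, p)) (s : seq R)
    (V : 'M[R]_p) (theta : R) : 'M[R]_(n, p) :=
  \sum_(i < p) (s`_i * (theta < s`_i)%R%:R) *: (col i U *m (col i V)^T).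

Definition SE (n p : nat) (X U : 'M[R]_(n, p)) (s : seq R) (V : 'M[R]_p)
    (theta : R) : R :=
  frobenius_sq (X - hard_threshold U s V theta).

(* [SE] takes finitely many values as [theta] varies, so the infimum is
   attained. *)
Definition oracle_SE (n p : nat) (X U : 'M[R]_(n, p)) (s : seq R)
    (V : 'M[R]_p) : R :=
  inf [set SE X U s V theta | theta in [set theta : R | 0 <= theta]].

End Svd.

Section Model.
Context {R : realType}.

(* gamma * n is nonnegative, so the absolute value only changes the type. *)
Definition ncols (gamma : R) (n : nat) : nat := `|Num.ceil (gamma * n%:R)|%N.

Definition signal_mx (r : nat) (x : r.-tuple R) (n p : nat)
    (a : 'M[R]_(n, r)) (b : 'M[R]_(p, r)) : 'M[R]_(n, p) :=
  \sum_(i < r) x`_i *: (col i a *m (col i b)^T).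

Definition is_signal (r : nat) (x : r.-tuple R) : Prop :=
  [/\ (0 < r)%N, sorted (fun s t : R => t < s) x & all (fun s : R => 0 < s) x].

Definition compactly_supported_cdf (F : R -> R) : Prop :=
  exists K : R, F (- K) = 0 /\ F K = 1.

Definition upper_edge (F : R -> R) : R := sup [set z | F z < 1].

(* Orthonormal r-frames of R^p exist only when r <= p, so the random objects
   are constrained only for those n such that r <= ncols gamma n, that is for
   all large n. *)
Definition signal_plus_noise (gamma : R) (d : measure_display)
    (T : measurableType d) (P : probability T R) (r : nat) (x : r.-tuple R)
    (a : forall n : nat, T -> 'M[R]_(n, r))
    (b : forall n : nat, T -> 'M[R]_(ncols gamma n, r))
    (Z : forall n : nat, T -> 'M[R]_(n, ncols gamma n)) : Prop :=
  forall n : nat, (r <= ncols gamma n)%N ->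
    [/\ uniform_frame P (a n), uniform_frame P (b n),
        independent_mx P (a n) (b n),
        random_mx (Z n)
      & independent_mx P (Z n) (fun w => signal_mx x (a n w) (b n w))].

Definition noise_limits (d : measure_display) (T : measurableType d)
    (P : probability T R) (F : cumulativeBounded (0 : R) (1 : R))
    (z : forall n : nat, T -> seq R) : Prop :=
  [/\ compactly_supported_cdf F,
      0 < upper_edge F,
      {ae P, forall w, forall t : R, {for t, continuous F} ->
        empirical_cdf (z n w) t @[n --> \oo] --> F t},
      {ae P, forall w, (z n w)`_0 @[n --> \oo] --> upper_edge F}
    & (\int[lebesgue_stieltjes_measure F]_t ((y - t) ^- 2)%:E)%E
        @[y --> (upper_edge F)^'+] --> +oo%E].

End Model.

Section Functionals.
Context {R : realType} (gamma : R) (F : cumulativeBounded (0 : R) (1 : R)).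

Local Notation zp := (upper_edge F).

(* [phi], [phit], [Dfun] and [Psi] are meaningful at y > upper_edge F only. *)
Definition phi (y : R) : R :=
  (\int[lebesgue_stieltjes_measure F]_t (y / (y ^+ 2 - t ^+ 2)))%R.

Definition phit (y : R) : R := gamma * phi y + (1 - gamma) / y.

Definition Dfun (y : R) : R := phi y * phit y.

Definition x_plus : R := lim ((Num.sqrt (Dfun y))^-1 @[y --> zp^'+]).

(* The inverse of [Dfun] on ]upper_edge F, +oo[ evaluated at 1 / x ^+ 2;
   meaningful for x > x_plus only, as is [Cfun]. *)
Definition Yfun (x : R) : R := get [set y | zp < y /\ Dfun y = 1 / x ^+ 2].

Definition Cfun (x : R) : R := - (2 / x ^+ 3) * (1 / derive1 Dfun (Yfun x)).

Definition y_infty (r : nat) (x : r.-tuple R) (i : nat) : R :=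
  if (i < r)%N && (x_plus < x`_i) then Yfun x`_i else zp.

Definition R0 (x : R) : R := x ^+ 2.

Definition R1 (x : R) : R :=
  if x_plus < x then x ^+ 2 + Yfun x ^+ 2 - 2 * x * Yfun x * Cfun x
  else x ^+ 2 + zp ^+ 2.

Definition ASE (r : nat) (x : r.-tuple R) : R :=
  \sum_(i < r) Num.min (R0 x`_i) (R1 x`_i).

Definition Psi (y : R) : R := y * derive1 Dfun y / Dfun y.

Definition Tgamma : R := inf [set y | zp < y /\ -4 <= Psi y].

Definition Theta_lower (r : nat) (x : r.-tuple R) : \bar R :=
  \big[Order.max/-oo%E]_(i < r.+1 | y_infty x i < Tgamma) (y_infty x i)%:E.

(* The empty minimum is +oo. *)
Definition Theta_upper (r : nat) (x : r.-tuple R) : \bar R :=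
  \big[Order.min/+oo%E]_(i < r.+1 | Tgamma < y_infty x i) (y_infty x i)%:E.

End Functionals.

(* Main.v *)
Require Import Defs.
From HB Require Import structures.
From mathcomp Require Import all_boot all_order all_algebra.
From mathcomp Require Import all_classical all_reals all_analysis.
From mathcomp Require Import ring lra.
From mathcomp Require Import measurable_realfun.
Set Implicit Arguments.
Unset Strict Implicit.
Unset Printing Implicit Defensive.
Import Order.TTheory GRing.Theory Num.Theory.
Import numFieldNormedType.Exports.
Local Open Scope classical_set_scope.
Local Open Scope ring_scope.

(** Why the theorem holds. Write [X] for the signal, [Z] for the noise and [Y] for
    their sum. Expanding the Frobenius norm ([SE_gain]) gives
      [SE theta = sum x_i ^+ 2 + sum over y_k > theta of
                    (y_k ^+ 2 - 2 * y_k * <u_k, X v_k>)],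
    so everything depends on the limits of the singular values [y_k] and of the
    overlaps [<u_k, X v_k>] for fixed [k] ([sample_sv], [sample_signal]).

    Randomness only enters through three facts, valid along almost every sample and
    packaged in the record [spiked]: for every polynomial [P], the quadratic form
    of [P (Z Z^T)] in the left spikes converges to a multiple of the identity, the
    same holds for [P (Z^T Z)] and the right spikes, and left and right spikes are
    asymptotically decoupled. The multiples are limiting spectral means, because the
    normalised traces of the powers converge ([noise_trace_left],
    [noise_trace_right]). The quadratic forms concentrate around the traces because
    the spikes are uniform on spheres: rotation invariance yields an integration by
    parts formula ([stein_quad]), hence a fourth moment bound of order [n ^- 2]
    ([quad_moment]), which is summable for Borel-Cantelli. The noise is independent of
    [X], which determines the spikes up to signs only; the squares and products of entries that matter are functions of [X], since the
    spikes are separated by a polynomial in [X X^T] ([lag_spike]).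

    The rest is deterministic. A pair of approximate singular vectors at a level
    [l] above the edge satisfies a linear equation in the noise
    ([resolvent_equation]); replacing the resolvent by truncated Neumann series,
    the limiting overlaps with the spikes solve a linear system which has a nonzero
    solution only when [x_j ^+ 2 * D l = 1] for some [j] ([secular]). Conversely each
    solution produces quasimodes, hence a singular value ([outlier_exists]), and two
    indices cannot share one ([outlier_simple]). This identifies the outliers, and
    their normalisation gives the overlap. Below the outliers, Weyl's inequality and
    the convergence of the spectrum stick the singular values to the edge, where the
    divergence of the integral of [(y - z) ^- 2] forces the overlaps to vanish
    ([edge_bound], [edge_signal]). Limits are taken along ultrafilters, which
    spares extracting subsequences and allows the limits to be named before they are
    identified.

    In the limit, keeping an outlier at the level [l] changes the loss by an amount
    with the sign of [kap (l ^+ 2) - 3], where [Psi y = 2 * (1 - kap (y ^+ 2))]. A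
    correlation inequality shows that [kap] is nonincreasing ([kappa_decr]), so that
    [Tgamma], where [kap] equals 3, separates the levels worth keeping from the
    others. Hence a threshold whose limit separates them in the same way is
    asymptotically optimal ([threshold_lim]), and so is the oracle, which cannot gain
    from retaining many components since each costs a fixed amount while the sum of
    all overlaps is bounded ([oracle_lim]). *)

(** * Vectors, operator bounds and polynomials of matrices *)

Section Vectors.
Context {R : realType}.
Implicit Types (m n : nat).

Definition dot n (u v : 'cV[R]_n) : R := \sum_i u i 0 * v i 0.
Definition nrm n (u : 'cV[R]_n) : R := Num.sqrt (dot u u).

Lemma dotC n (u v : 'cV[R]_n) : dot u v = dot v u.
Proof. by apply: eq_bigr => i _; rewrite mulrC. Qed.

Lemma dotDl n (u v w : 'cV[R]_n) : dot (u + v) w = dot u w + dot v w.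
Proof. by rewrite -big_split; apply: eq_bigr => i _; rewrite mxE mulrDl. Qed.

Lemma dotZl n c (u v : 'cV[R]_n) : dot (c *: u) v = c * dot u v.
Proof. by rewrite /dot mulr_sumr; apply: eq_bigr => i _; rewrite mxE mulrA. Qed.

Lemma dotDr n (u v w : 'cV[R]_n) : dot w (u + v) = dot w u + dot w v.
Proof. by rewrite dotC dotDl !(dotC w). Qed.

Lemma dotZr n c (u v : 'cV[R]_n) : dot u (c *: v) = c * dot u v.
Proof. by rewrite dotC dotZl dotC. Qed.

Lemma dotNl n (u v : 'cV[R]_n) : dot (- u) v = - dot u v.
Proof. by rewrite -scaleN1r dotZl mulN1r. Qed.

Lemma dotNr n (u v : 'cV[R]_n) : dot u (- v) = - dot u v.
Proof. by rewrite dotC dotNl dotC. Qed.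

Lemma dotBl n (u v w : 'cV[R]_n) : dot (u - v) w = dot u w - dot v w.
Proof. by rewrite dotDl dotNl. Qed.

Lemma dotBr n (u v w : 'cV[R]_n) : dot w (u - v) = dot w u - dot w v.
Proof. by rewrite dotDr dotNr. Qed.

Lemma dot0l n (u : 'cV[R]_n) : dot 0 u = 0.
Proof. by rewrite -(scale0r 0) dotZl mul0r. Qed.

Lemma dot0r n (u : 'cV[R]_n) : dot u 0 = 0.
Proof. by rewrite dotC dot0l. Qed.

Lemma dot_suml n (I : Type) (s : seq I) (Q : pred I) (f : I -> 'cV[R]_n) v :
  dot (\sum_(i <- s | Q i) f i) v = \sum_(i <- s | Q i) dot (f i) v.
Proof. apply: (big_morph (fun u => dot u v)) => [? ?|]; by rewrite ?dotDl ?dot0l. Qed.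

Lemma dot_sumr n (I : Type) (s : seq I) (Q : pred I) (f : I -> 'cV[R]_n) v :
  dot v (\sum_(i <- s | Q i) f i) = \sum_(i <- s | Q i) dot v (f i).
Proof. by rewrite dotC dot_suml; apply: eq_bigr => i _; rewrite dotC. Qed.

Lemma dotE n (u v : 'cV[R]_n) : dot u v = (u^T *m v) 0 0.
Proof. by rewrite mxE; apply: eq_bigr => i _; rewrite mxE. Qed.

Lemma dot_mx n (u v : 'cV[R]_n) : u^T *m v = (dot u v)%:M.
Proof. by rewrite [LHS]mx11_scalar dotE. Qed.

Lemma dot_mull m n (M : 'M[R]_(m, n)) u v : dot (M *m u) v = dot u (M^T *m v).
Proof. by rewrite !dotE trmx_mul mulmxA. Qed.

Lemma dot_mulr m n (M : 'M[R]_(m, n)) u v : dot u (M *m v) = dot (M^T *m u) v.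
Proof. by rewrite dot_mull trmxK. Qed.

Lemma dot_ge0 n (u : 'cV[R]_n) : 0 <= dot u u.
Proof. by apply: sumr_ge0 => i _; rewrite -expr2 sqr_ge0. Qed.

Lemma nrm_ge0 n (u : 'cV[R]_n) : 0 <= nrm u.
Proof. exact: sqrtr_ge0. Qed.

Lemma nrm_sqr n (u : 'cV[R]_n) : nrm u ^+ 2 = dot u u.
Proof. by rewrite sqr_sqrtr // dot_ge0. Qed.

Lemma dot_eq0 n (u : 'cV[R]_n) : dot u u = 0 -> u = 0.
Proof.
move=> /eqP; rewrite psumr_eq0 => [/allP h|i _]; last by rewrite -expr2 sqr_ge0.
apply/colP => i; rewrite mxE; have := h i (mem_index_enum i).
by rewrite /= mulf_eq0 orbb => /eqP.
Qed.

Lemma nrm0 n : nrm (0 : 'cV[R]_n) = 0.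
Proof. by rewrite /nrm dot0l sqrtr0. Qed.

Lemma nrmZ n c (u : 'cV[R]_n) : nrm (c *: u) = `|c| * nrm u.
Proof.
by rewrite /nrm dotZl dotZr mulrA -expr2 sqrtrM ?sqr_ge0 // sqrtr_sqr.
Qed.

Lemma nrmN n (u : 'cV[R]_n) : nrm (- u) = nrm u.
Proof. by rewrite /nrm dotNl dotNr opprK. Qed.

Lemma dot_sqr_le n (u v : 'cV[R]_n) : dot u v ^+ 2 <= dot u u * dot v v.
Proof.
have [v0|v0] := eqVneq (dot v v) 0.
  by rewrite (dot_eq0 v0) dot0r dot0l expr0n mulr0.
have vp : 0 < dot v v by rewrite lt_neqAle eq_sym v0 dot_ge0.
have := dot_ge0 (dot v v *: u - dot u v *: v).
rewrite !(dotBl, dotBr, dotZl, dotZr) (dotC v u).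
set a := dot u u; set b := dot u v; set c := dot v v in vp * => h.
rewrite -subr_ge0 -(pmulr_rge0 _ vp); apply: le_trans h _.
by rewrite le_eqVlt; apply/orP; left; apply/eqP; ring.
Qed.

Lemma cauchy_schwarz n (u v : 'cV[R]_n) : `|dot u v| <= nrm u * nrm v.
Proof.
rewrite -sqrtr_sqr -sqrtrM ?dot_ge0 // ler_sqrt ?dot_sqr_le //.
by rewrite mulr_ge0 ?dot_ge0.
Qed.

Lemma nrmD n (u v : 'cV[R]_n) : nrm (u + v) <= nrm u + nrm v.
Proof.
rewrite -(ler_pXn2r (ltn0Sn 1)) ?nnegrE ?addr_ge0 ?nrm_ge0 //.
rewrite sqrrD !nrm_sqr dotDl !dotDr (dotC v u).
have := le_trans (ler_norm _) (cauchy_schwarz u v); rewrite mulr2n; lra.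
Qed.

Lemma nrmB n (u v : 'cV[R]_n) : nrm (u - v) <= nrm u + nrm v.
Proof. by rewrite -(nrmN v) nrmD. Qed.

Lemma nrm_sum n (I : Type) (s : seq I) (Q : pred I) (f : I -> 'cV[R]_n) :
  nrm (\sum_(i <- s | Q i) f i) <= \sum_(i <- s | Q i) nrm (f i).
Proof.
elim/big_ind2 : _ => [|u a v b ua vb|//]; first by rewrite nrm0.
exact: le_trans (nrmD _ _) (lerD ua vb).
Qed.

Lemma nrm_dist n (u v : 'cV[R]_n) : `|nrm u - nrm v| <= nrm (u - v).
Proof.
rewrite ler_norml; apply/andP; split.
  by have := nrmD u (v - u); rewrite addrC subrK -opprB nrmN; lra.
by have := nrmD v (u - v); rewrite addrC subrK; lra.
Qed.

(** A bound on the operator norm, kept as a relation so that no supremum has to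
    be taken. *)
Definition opb m n (M : 'M[R]_(m, n)) (c : R) :=
  forall u : 'cV_n, nrm (M *m u) <= c * nrm u.

Lemma opb_tr m n (M : 'M[R]_(m, n)) c : 0 <= c -> opb M c -> opb M^T c.
Proof.
move=> c0 h u; have [->|u0] := eqVneq (nrm (M^T *m u)) 0.
  by rewrite mulr_ge0 ?nrm_ge0.
have up : 0 < nrm (M^T *m u) by rewrite lt_neqAle eq_sym u0 nrm_ge0.
rewrite -(ler_pM2r up) -expr2 nrm_sqr dot_mull trmxK.
apply: le_trans (ler_norm _) _; apply: le_trans (cauchy_schwarz _ _) _.
by rewrite mulrAC mulrC ler_wpM2r ?nrm_ge0.
Qed.

Lemma opbM m n p (M : 'M[R]_(m, n)) (N : 'M[R]_(n, p)) c c' :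
  0 <= c -> opb M c -> opb N c' -> opb (M *m N) (c * c').
Proof.
move=> c0 hM hN u; rewrite -mulmxA; apply: le_trans (hM _) _.
by rewrite -mulrA ler_wpM2l.
Qed.

Lemma opbX n (W : 'M[R]_n) c k : 0 <= c -> opb W c -> opb (W ^+ k) (c ^+ k).
Proof.
move=> c0 h; elim: k => [|k IH]; first by move=> u; rewrite !expr0 mul1mx mul1r.
by rewrite !exprS; apply: opbM.
Qed.

Lemma opb_isom m n (M : 'M[R]_(m, n)) : M^T *m M = 1%:M -> opb M 1.
Proof. by move=> h u; rewrite mul1r /nrm dot_mull mulmxA h mul1mx. Qed.

Lemma nrm_isom m n (M : 'M[R]_(m, n)) u : M^T *m M = 1%:M -> nrm (M *m u) = nrm u.
Proof. by move=> h; rewrite /nrm dot_mull mulmxA h mul1mx. Qed.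

Lemma opb_coisom m n (M : 'M[R]_(m, n)) : M^T *m M = 1%:M -> opb M^T 1.
Proof. by move=> h; apply: opb_tr ler01 _; apply: opb_isom. Qed.

Lemma abs_coord_nrm n (u : 'cV[R]_n) i : `|u i 0| <= nrm u.
Proof.
rewrite -sqrtr_sqr ler_sqrt ?dot_ge0 // /dot (bigD1 i) //= -expr2.
by rewrite lerDl sumr_ge0 // => j _; rewrite -expr2 sqr_ge0.
Qed.

Lemma nrm_le_sum n (u : 'cV[R]_n) : nrm u <= \sum_i `|u i 0|.
Proof.
have -> : u = \sum_i u i 0 *: delta_mx i 0.
  apply/colP => j; rewrite summxE (bigD1 j) //= big1 => [|i ij]; rewrite !mxE.
    by rewrite !eqxx mulr1 addr0.
  by rewrite eq_sym (negbTE ij) mulr0.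
apply: le_trans (nrm_sum _ _ _) _; rewrite le_eqVlt; apply/orP; left; apply/eqP.
apply: eq_bigr => i _; rewrite nrmZ summxE (bigD1 i) //= big1 => [|j ij]; last first.
  by rewrite !mxE eq_sym (negbTE ij) mulr0.
rewrite !mxE !eqxx mulr1 addr0 -[RHS]mulr1; congr (_ * _).
rewrite /nrm /dot (bigD1 i) //= big1 => [|j ij]; last by rewrite !mxE (negbTE ij) mul0r.
by rewrite !mxE !eqxx mulr1 addr0 sqrtr1.
Qed.

End Vectors.

Section PolyMatrix.
Context {R : realType}.
Implicit Types (P Q : {poly R}).

(** Evaluation through an explicit sum: horner evaluation would need the ring
    structure of square matrices, which excludes the empty ones. *)
Definition pmx n P (W : 'M[R]_n) : 'M[R]_n := \sum_(i < size P) P`_i *: W ^+ i.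

Lemma pmx_wide n P (W : 'M[R]_n) k : (size P <= k)%N ->
  pmx P W = \sum_(i < k) P`_i *: W ^+ i.
Proof.
move=> sk; rewrite -(subnKC sk) big_split_ord /= [X in _ + X]big1 ?addr0 //.
by move=> i _; rewrite nth_default ?scale0r // leq_addr.
Qed.

Lemma pmxD n P Q (W : 'M[R]_n) : pmx (P + Q) W = pmx P W + pmx Q W.
Proof.
set k := maxn (size P) (size Q).
rewrite (@pmx_wide _ P _ k) ?leq_maxl // (@pmx_wide _ Q _ k) ?leq_maxr //.
rewrite (@pmx_wide _ _ _ k) ?size_polyD // -big_split; apply: eq_bigr => i _.
by rewrite coefD scalerDl.
Qed.

Lemma pmxZ n c P (W : 'M[R]_n) : pmx (c *: P) W = c *: pmx P W.
Proof.
rewrite (@pmx_wide _ _ _ (size P)) ?size_scale_leq // scaler_sumr.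
by apply: eq_bigr => i _; rewrite coefZ scalerA.
Qed.

Lemma pmx0 n (W : 'M[R]_n) : pmx 0 W = 0.
Proof. by rewrite /pmx size_poly0 big_ord0. Qed.

Lemma pmxC n c (W : 'M[R]_n) : pmx c%:P W = c%:M.
Proof.
rewrite (@pmx_wide _ _ _ 1) ?size_polyC ?leq_b1 // big_ord1 coefC eqxx expr0.
by rewrite -idmxE scalemx1.
Qed.

Lemma pmxMX n P (W : 'M[R]_n) : pmx (P * 'X) W = pmx P W *m W.
Proof.
rewrite (@pmx_wide _ _ _ (size P).+1); last first.
  have [->|P0] := eqVneq P 0; first by rewrite mul0r size_poly0.
  by rewrite size_mulX.
rewrite big_ord_recl coefMX eqxx scale0r add0r mulmx_suml; apply: eq_bigr => i _.
by rewrite coefMX /= -scalemxAl mulmxE -exprSr.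
Qed.

Lemma pmxX n (W : 'M[R]_n) : pmx 'X W = W.
Proof. by rewrite -['X]mul1r pmxMX pmxC mul1mx. Qed.

Lemma pmxM n P Q (W : 'M[R]_n) : pmx (P * Q) W = pmx P W *m pmx Q W.
Proof.
elim/poly_ind: Q => [|Q c IH]; first by rewrite mulr0 pmx0 mulmx0.
rewrite mulrDr !pmxD mulrA !pmxMX IH mulmxDr mulmxA; congr (_ + _).
by rewrite mulrC mul_polyC pmxZ pmxC mul_mx_scalar.
Qed.

Lemma pmx1 n (W : 'M[R]_n) : pmx 1 W = 1%:M.
Proof. exact: pmxC. Qed.

Lemma pmxN n P (W : 'M[R]_n) : pmx (- P) W = - pmx P W.
Proof. by rewrite -scaleN1r pmxZ scaleN1r. Qed.

Lemma pmxB n P Q (W : 'M[R]_n) : pmx (P - Q) W = pmx P W - pmx Q W.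
Proof. by rewrite pmxD pmxN. Qed.

Lemma pmxXn n P k (W : 'M[R]_n) : pmx (P ^+ k) W = pmx P W ^+ k.
Proof. by elim: k => [|k IH]; rewrite ?pmx1 // !exprS pmxM IH. Qed.

Lemma pmx_tr n P (W : 'M[R]_n) : (pmx P W)^T = pmx P W^T.
Proof.
elim/poly_ind: P => [|P c IH]; first by rewrite !pmx0 trmx0.
rewrite !pmxD !pmxC linearD /= tr_scalar_mx; congr (_ + _).
rewrite !pmxMX trmx_mul IH; clear IH.
elim/poly_ind: P => [|P d IH]; first by rewrite !pmx0 mulmx0 mul0mx.
by rewrite !pmxD !pmxMX !pmxC mulmxDr mulmxDl mulmxA IH scalar_mxC.
Qed.

(** Lets a rectangular factor change the side on which the Gram matrix is taken. *)
Lemma pmx_intertwine m n P (Z : 'M[R]_(m, n)) :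
  pmx P (Z *m Z^T) *m Z = Z *m pmx P (Z^T *m Z).
Proof.
elim/poly_ind: P => [|P c IH]; first by rewrite !pmx0 mulmx0 mul0mx.
rewrite !pmxD !pmxMX !pmxC mulmxDr mulmxDl mul_scalar_mx mul_mx_scalar.
by rewrite [Z *m (_ *m _)]mulmxA -IH !mulmxA.
Qed.

End PolyMatrix.

(** * Limits along ultrafilters and truncated resolvents *)

Section UltraLimits.
Context {R : realType}.

(** A filter is the intersection of the ultrafilters above it, so that a limit
    can be identified ultrafilter by ultrafilter. *)
Lemma cvg_ultra (F : set_system nat) {FF : ProperFilter F} (f : nat -> R) (l : R) :
  (forall U, UltraFilter U -> F `<=` U -> f n @[n --> U] --> l) ->
  f n @[n --> F] --> l.
Proof.
move=> h; apply/cvgrPdist_lt => e e0; apply: contrapT => nF.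
pose S : set nat := [set n | `|l - f n| < e].
pose G : set_system nat := [set A | exists2 B, F B & B `&` ~` S `<=` A].
have GF : ProperFilter G.
  apply: Build_ProperFilter_ex => [A [B FB BA]|].
    apply: contrapT => nA; apply: nF; apply: filterS FB => n Bn.
    by apply: contrapT => nS; apply: nA; exists n; apply: BA.
  split.
  - by exists setT => //; exact: filterT.
  - move=> A1 A2 [B1 F1 S1] [B2 F2 S2]; exists (B1 `&` B2); first exact: filterI.
    by move=> n [[b1 b2] s]; split; [apply: S1|apply: S2].
  - by move=> A1 A2 sA [B FB BA]; exists B => //; apply: subset_trans BA sA.
have [U [UU GU]] := ultraFilterLemma GF.
have FU : F `<=` U by move=> A FA; apply: GU; exists A => // n [].
have /cvgrPdist_lt/(_ _ e0) US := h U UU FU.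
have UnS : U (~` S) by apply: GU; exists setT; [exact: filterT | move=> n []].
by have [n [a b]] := @filter_ex _ U _ _ (@filterI _ U _ _ _ US UnS).
Qed.

(** Compactness of a segment: this is what replaces the extraction of
    subsequences. *)
Lemma ultra_bounded (U : set_system nat) {UU : UltraFilter U} (f : nat -> R) C :
  (\forall n \near U, `|f n| <= C) -> exists l : R, f n @[n --> U] --> l.
Proof.
move=> bf.
have cC : compact `[- C, C]%classic by exact: segment_compact.
have UF : ProperFilter (f @ U) by exact: fmap_proper_filter.
have UFU : UltraFilter (f @ U).
  split=> // G GF sG; apply/predeqP => A; split; last exact: sG.
  move=> GA; have [//|FnA] := in_ultra_setVsetC (f @^-1` A) UU.
  have : G (~` A) by apply: sG.
  by move=> /(filterI GA); rewrite setICr => /filter_ex [].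
have := cC _ UF; rewrite (ultra_cvg_clusterE UFU).
have mem : (f @ U) `[- C, C]%classic.
  by apply: filterS bf => n; rewrite /= in_itv /= -ler_norml.
by move=> /(_ mem) [l [_ hl]]; exists l.
Qed.

Lemma cvg_ge_const (U : set_system nat) {UU : ProperFilter U} (f : nat -> R) (l c : R) :
  f n @[n --> U] --> l -> (\forall n \near U, c <= f n) -> c <= l.
Proof. by move=> fl fc; apply: (ler_cvg_to (cvg_cst c) fl). Qed.

Lemma cvg0_le (U : set_system nat) {UU : ProperFilter U} (f g : nat -> R) :
  (\forall n \near U, `|f n| <= g n) -> g n @[n --> U] --> (0 : R) ->
  f n @[n --> U] --> (0 : R).
Proof.
move=> fg g0; apply/cvgrPdist_lt => e e0.
move/cvgrPdist_lt: g0 => /(_ e e0) g0.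
near=> n; rewrite sub0r normrN.
have a : `|f n| <= g n by near: n.
have b : `|0 - g n| < e by near: n.
by move: b; rewrite sub0r normrN; move/(le_lt_trans (ler_norm _)); apply: le_lt_trans.
Unshelve. all: by end_near.
Qed.

Lemma cvg_sumf (U : set_system nat) {UU : ProperFilter U} (I : Type) (s : seq I)
    (Q : pred I) (f : I -> nat -> R) (l : I -> R) :
  (forall i, Q i -> f i n @[n --> U] --> l i) ->
  (\sum_(i <- s | Q i) f i n) @[n --> U] --> \sum_(i <- s | Q i) l i.
Proof.
move=> h; elim: s => [|i s IH].
  by under eq_fun do rewrite big_nil; rewrite big_nil; exact: cvg_cst.
under eq_fun do rewrite big_cons; rewrite big_cons.
by case: ifP => // Qi; apply: cvgD => //; exact: h.
Qed.

End UltraLimits.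

Section Neumann.
Context {R : realType}.

(** Polynomial truncation of the resolvent [1 / (l ^+ 2 - t)]. *)
Definition neumann (l : R) N : {poly R} := \sum_(k < N) (l ^- 2) ^+ k.+1 *: 'X^k.

Lemma neumannE l N : l != 0 ->
  neumann l N * ((l ^+ 2)%:P - 'X) = 1 - (l ^- 2) ^+ N *: 'X^N.
Proof.
move=> l0; have l2 : l ^+ 2 != 0 by rewrite expf_neq0.
elim: N => [|N IH]; first by rewrite /neumann big_ord0 mul0r !expr0 scale1r subrr.
rewrite /neumann big_ord_recr /= mulrDl -/(neumann l N) IH mulrBr.
have -> : l ^- 2 ^+ N.+1 *: 'X^N * (l ^+ 2)%:P = l ^- 2 ^+ N *: 'X^N.
  by rewrite mulrC mul_polyC scalerA (exprS (l ^- 2)) mulrA divff // mul1r.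
by rewrite addrA subrK -scalerAl -exprSr.
Qed.

End Neumann.

Section MoreOpb.
Context {R : realType}.

Lemma dot_delta n (u : 'cV[R]_n) i : dot (delta_mx i 0) u = u i 0.
Proof.
rewrite /dot (bigD1 i) //= big1 => [|j ij]; last by rewrite mxE (negbTE ij) mul0r.
by rewrite mxE !eqxx mul1r addr0.
Qed.

Lemma diag_mulE n (x : 'I_n -> R) (u : 'cV[R]_n) i :
  (diag_mx (\row_i x i) *m u) i 0 = x i * u i 0.
Proof. by rewrite mul_diag_mx mxE [X in X * _]mxE. Qed.

Lemma ratio_sqr_lt1 (a b : R) : 0 <= a -> a < b -> 0 <= (a / b) ^+ 2 < 1.
Proof.
move=> a0 ab; have b0 : 0 < b by exact: le_lt_trans ab.
rewrite sqr_ge0 /= exprn_ilt1 ?divr_ge0 // ?(ltW b0) //.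
by rewrite ltr_pdivrMr // mul1r.
Qed.

Lemma midpoint (a b : R) : 0 <= a -> a < b ->
  [/\ 0 <= (a + b) / 2, (a + b) / 2 < b & a < (a + b) / 2].
Proof. by move=> a0 ab; split; lra. Qed.

Lemma cvg_diff0 (U : set_system nat) {UU : ProperFilter U} (f : nat -> R) (l : R) :
  f n @[n --> U] --> l -> (f n - l) @[n --> U] --> (0 : R).
Proof. by move=> h; rewrite -(subrr l); apply: cvgB h (cvg_cst _). Qed.

Lemma mxE_add m n (M N : 'M[R]_(m, n)) i j : (M + N) i j = M i j + N i j.
Proof. exact: mxE. Qed.

Lemma mxE_opp m n (M : 'M[R]_(m, n)) i j : (- M) i j = - M i j.
Proof. exact: mxE. Qed.

Lemma scalemxE m n c (M : 'M[R]_(m, n)) i j : (c *: M) i j = c * M i j.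
Proof. exact: mxE. Qed.

Lemma pmx_gram m n (P : {poly R}) (Z : 'M[R]_(m, n)) :
  pmx ('X * P) (Z^T *m Z) = Z^T *m pmx P (Z *m Z^T) *m Z.
Proof. by rewrite -mulmxA pmx_intertwine mulmxA pmxM pmxX. Qed.

Lemma opb_pmx n (W : 'M[R]_n) (P : {poly R}) c : 0 <= c -> opb W c ->
  opb (pmx P W) (\sum_(i < size P) `|P`_i| * c ^+ i).
Proof.
move=> c0 h u; rewrite /pmx mulmx_suml mulr_suml.
apply: le_trans (nrm_sum _ _ _) _; apply: ler_sum => i _.
by rewrite -scalemxAl nrmZ -mulrA ler_wpM2l //; apply: opbX.
Qed.

Lemma opb_gram m n (Z : 'M[R]_(m, n)) c : 0 <= c -> opb Z c ->
  opb (Z *m Z^T) (c ^+ 2).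
Proof. by move=> c0 h; rewrite expr2; apply: opbM => //; apply: opb_tr. Qed.

End MoreOpb.

(** * Approximate singular vectors of a spiked matrix *)

(** All that the deterministic analysis retains of the random model, along a
    filter which will be [\oo] and then an ultrafilter above it. The functionals
    [MA] and [MB] are the limiting spectral means of [Z Z^T] and [Z^T Z]. *)
Record spiked (R : realType) (U : set_system nat) (r : nat) (dn dp : nat -> nat)
    (A : forall n, 'M[R]_(dn n, r)) (B : forall n, 'M[R]_(dp n, r))
    (Z : forall n, 'M[R]_(dn n, dp n)) (zp : R) (MA MB : {poly R} -> R) : Prop :=
  Spiked {
    sp_A : \forall n \near U, (A n)^T *m A n = 1%:M;
    sp_B : \forall n \near U, (B n)^T *m B n = 1%:M;
    sp_Z : forall c, zp < c -> \forall n \near U, opb (Z n) c;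
    sp_AA : forall P (b c : 'cV[R]_r),
      dot (A n *m b) (pmx P (Z n *m (Z n)^T) *m (A n *m c)) @[n --> U]
        --> MA P * dot b c;
    sp_BB : forall P (b c : 'cV[R]_r),
      dot (B n *m b) (pmx P ((Z n)^T *m Z n) *m (B n *m c)) @[n --> U]
        --> MB P * dot b c;
    sp_AB : forall P (b c : 'cV[R]_r),
      dot (A n *m b) (pmx P (Z n *m (Z n)^T) *m (Z n *m (B n *m c))) @[n --> U]
        --> (0 : R) }.

(** The model is symmetric in rows and columns, so that every statement on left
    vectors holds for right ones. *)
Lemma spiked_tr (R : realType) (U : set_system nat) {UF : ProperFilter U} (r : nat)
    (dn dp : nat -> nat)
    (A : forall n, 'M[R]_(dn n, r)) (B : forall n, 'M[R]_(dp n, r))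
    (Z : forall n, 'M[R]_(dn n, dp n)) (zp : R) (MA MB : {poly R} -> R) :
  0 <= zp -> spiked U A B Z zp MA MB -> spiked U B A (fun n => (Z n)^T) zp MB MA.
Proof.
move=> zp0 [hA hB hZ hAA hBB hAB]; split=> //.
- move=> c zc; near=> n; apply: opb_tr; first exact: le_trans zp0 (ltW zc).
  by near: n; apply: hZ.
- by move=> P b c; under eq_fun do rewrite trmxK; exact: hBB.
- by move=> P b c; under eq_fun do rewrite trmxK; exact: hAA.
- move=> P b c; rewrite [X in X @ _ --> _](_ : _ = fun n => dot (A n *m c)
     (pmx P (Z n *m (Z n)^T) *m (Z n *m (B n *m b)))); first exact: hAB.
  apply/funext => n; rewrite trmxK dotC [RHS]dot_mulr pmx_tr trmx_mul trmxK.
  have := pmx_intertwine P (Z n)^T; rewrite trmxK => h.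
  by rewrite [RHS]dot_mulr !mulmxA h.
Unshelve. all: by end_near.
Qed.

Section NearSingular.
Context {R : realType} (U : set_system nat) {UF : ProperFilter U} (r : nat).
Variables (dn dp : nat -> nat) (x : 'I_r -> R).
Variables (A : forall n, 'M[R]_(dn n, r)) (B : forall n, 'M[R]_(dp n, r)).
Variables (Z : forall n, 'M[R]_(dn n, dp n)) (zp : R) (MA MB : {poly R} -> R).
Hypothesis (zp0 : 0 <= zp) (sp : spiked U A B Z zp MA MB).

Definition negl (d : nat -> nat) (e : forall n, 'cV[R]_(d n)) :=
  nrm (e n) @[n --> U] --> (0 : R).

Let W n := Z n *m (Z n)^T.
Let D : 'M[R]_r := diag_mx (\row_i x i).
Let X n := A n *m D *m (B n)^T.
Let Y n := X n + Z n.

Lemma negl_opb (d d' : nat -> nat) (e : forall n, 'cV[R]_(d n))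
    (M : forall n, 'M[R]_(d' n, d n)) c :
  (\forall n \near U, opb (M n) c) -> negl e -> negl (fun n => M n *m e n).
Proof.
move=> hM he; apply: (@cvg0_le _ U _ _ (fun n => c * nrm (e n))).
  near=> n; rewrite ger0_norm ?nrm_ge0 //.
  by have h : opb (M n) c by near: n; apply: hM.
by rewrite -(mulr0 c); apply: cvgM he; exact: cvg_cst.
Unshelve. all: by end_near.
Qed.

Lemma neglD (d : nat -> nat) (e f : forall n, 'cV[R]_(d n)) :
  negl e -> negl f -> negl (fun n => e n + f n).
Proof.
move=> he hf; apply: (@cvg0_le _ U _ _ (fun n => nrm (e n) + nrm (f n))).
  by near=> n; rewrite ger0_norm ?nrm_ge0 // nrmD.
by rewrite -(addr0 0); apply: cvgD.
Unshelve. all: by end_near.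
Qed.

Lemma neglZ (d : nat -> nat) c (e : forall n, 'cV[R]_(d n)) :
  negl e -> negl (fun n => c *: e n).
Proof.
move=> he; rewrite /negl; under eq_fun do rewrite nrmZ.
by rewrite -(mulr0 `|c|); apply: cvgM he; exact: cvg_cst.
Qed.

Lemma negl_isom (d : nat -> nat) (M : forall n, 'M[R]_(d n, r)) (f : nat -> 'cV[R]_r) :
  (\forall n \near U, (M n)^T *m M n = 1%:M) ->
  (forall i, f n i 0 @[n --> U] --> (0 : R)) -> negl (fun n => M n *m f n).
Proof.
move=> hM hf; apply: (@negl_opb (fun=> r) d f M 1).
  by near=> n; apply: opb_isom; near: n.
apply: (@cvg0_le _ U _ _ (fun n => \sum_i `|f n i 0|)).
  by near=> n; rewrite ger0_norm ?nrm_ge0 // nrm_le_sum.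
rewrite -[X in _ --> X](@big1_eq R 0 +%R _ (index_enum 'I_r) xpredT).
by apply: cvg_sumf => i _; rewrite -(normr0 R); apply: cvg_norm; exact: hf.
Unshelve. all: by end_near.
Qed.

(** The right-hand side of the linear equation satisfied by a left singular
    vector whose weighted overlaps with the spikes are [al] and [be]. *)
Definition gvec (l : R) (be al : 'cV[R]_r) n : 'cV[R]_(dn n) :=
  l *: (A n *m be) + Z n *m (B n *m al).

(** The limit of the quadratic form of [P] at [gvec l be al]; the cross terms
    disappear by the decoupling of left and right spikes. *)
Definition gform (l : R) (be al : 'cV[R]_r) (P : {poly R}) :=
  l ^+ 2 * dot be be * MA P + dot al al * MB ('X * P).

Lemma gform_lim l be al P :
  dot (gvec l be al n) (pmx P (W n) *m gvec l be al n) @[n --> U] --> gform l be al P.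
Proof.
have -> : (fun n => dot (gvec l be al n) (pmx P (W n) *m gvec l be al n)) = (fun n =>
    l ^+ 2 * dot (A n *m be) (pmx P (W n) *m (A n *m be))
    + (l * 2 * dot (A n *m be) (pmx P (W n) *m (Z n *m (B n *m al)))
    + dot (B n *m al) (pmx ('X * P) ((Z n)^T *m Z n) *m (B n *m al)))).
  apply/funext => n; rewrite /gvec !(mulmxDr, dotDl, dotDr) -!scalemxAr !(dotZl, dotZr).
  have -> : dot (Z n *m (B n *m al)) (pmx P (W n) *m (A n *m be)) =
            dot (A n *m be) (pmx P (W n) *m (Z n *m (B n *m al))).
    by rewrite dot_mulr pmx_tr trmx_mul trmxK dotC.
  have -> : dot (Z n *m (B n *m al)) (pmx P (W n) *m (Z n *m (B n *m al))) =
     dot (B n *m al) (pmx ('X * P) ((Z n)^T *m Z n) *m (B n *m al)).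
    by rewrite dot_mull pmx_gram !mulmxA.
  ring.
have -> : gform l be al P = l ^+ 2 * (MA P * dot be be) + (l * 2 * 0 + MB ('X * P) * dot al al).
  by rewrite /gform; ring.
by apply: cvgD; [|apply: cvgD; [|exact: (sp_BB sp)]];
  (apply: cvgM; [exact: cvg_cst|]); [exact: (sp_AA sp)|exact: (sp_AB sp)].
Qed.

Let c0 := zp + 1.
Let c00 : 0 <= c0. Proof. by rewrite addr_ge0. Qed.
Let Zc0 : \forall n \near U, opb (Z n) c0.
Proof. by apply: (sp_Z sp); rewrite ltrDl. Qed.

Variables (u : forall n, 'cV[R]_(dn n)) (v : forall n, 'cV[R]_(dp n)) (l C : R).
Variables (ka la : 'cV[R]_r).
Hypothesis (u_le : \forall n \near U, nrm (u n) <= C).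
Hypothesis (ures : negl (fun n => l *: u n - Y n *m v n)).
Hypothesis (vres : negl (fun n => l *: v n - (Y n)^T *m u n)).
Hypothesis (ka_lim : forall i, ((A n)^T *m u n) i 0 @[n --> U] --> ka i 0).
Hypothesis (la_lim : forall i, ((B n)^T *m v n) i 0 @[n --> U] --> la i 0).

Let be := D *m la.
Let al := D *m ka.
Let g n := gvec l be al n.

(** Eliminating [v] from the two singular vector equations: up to a negligible
    error, [u] solves a linear equation in the noise whose right-hand side only
    involves the limiting overlaps with the spikes. *)
Lemma resolvent_equation : negl (fun n => l ^+ 2 *: u n - W n *m u n - g n).
Proof.
have -> : (fun n => l ^+ 2 *: u n - W n *m u n - g n) =
  (fun n => l *: (l *: u n - Y n *m v n) + (Z n *m (l *: v n - (Y n)^T *m u n)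
     + (l *: (A n *m (D *m ((B n)^T *m v n - la)))
        + Z n *m (B n *m (D *m ((A n)^T *m u n - ka)))))).
  apply: functional_extensionality_dep => n; rewrite /g /gvec /Y /W /X /be /al.
  have -> : (A n *m D *m (B n)^T + Z n)^T *m u n =
      B n *m (D *m ((A n)^T *m u n)) + (Z n)^T *m u n.
    by rewrite raddfD /= mulmxDl !trmx_mul trmxK tr_diag_mx !mulmxA.
  rewrite mulmxDl !mulmxBr !mulmxDr -!scalemxAr -!mulmxA.
  by apply/colP => i; rewrite !(scalemxE, mxE_add, mxE_opp); ring.
have DD (f : nat -> 'cV[R]_r) : (forall i, f n i 0 @[n --> U] --> (0 : R)) ->
    forall i, (D *m f n) i 0 @[n --> U] --> (0 : R).
  move=> hf i; rewrite /D; under eq_fun do rewrite diag_mulE.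
  by rewrite -(mulr0 (x i)); apply: cvgM; [exact: cvg_cst | exact: hf].
apply: neglD; first exact: neglZ.
apply: neglD; first exact: (negl_opb Zc0).
apply: neglD.
  apply: neglZ; apply: negl_isom; first exact: (sp_A sp).
  apply: DD => i; under eq_fun do rewrite mxE_add mxE_opp.
  by apply: cvg_diff0; exact: la_lim.
apply: (negl_opb Zc0); apply: negl_isom; first exact: (sp_B sp).
apply: DD => i; under eq_fun do rewrite mxE_add mxE_opp.
by apply: cvg_diff0; exact: ka_lim.
Qed.

(** Exchange of the limits in the size and in the truncation order, whose error
    is geometric uniformly in the size. *)
Lemma double_limit (f : nat -> R) (fN : nat -> nat -> R) (rho a : R) (aN : nat -> R) :
  0 <= rho < 1 ->
  (forall N e, 0 < e -> \forall n \near U, `|f n - fN N n| <= rho ^+ N * C + e) ->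
  (forall N, fN N n @[n --> U] --> aN N) -> aN N @[N --> \oo] --> a ->
  f n @[n --> U] --> a.
Proof.
move=> /andP[rho0 rho1] hf hN ha; apply/cvgrPdist_lt => e e0.
have e4 : 0 < e / 4 by rewrite divr_gt0.
have rC : rho ^+ N * C @[N --> \oo] --> (0 : R).
  rewrite -(mul0r C); apply: cvgM; last exact: cvg_cst.
  by apply: cvg_expr; rewrite ger0_norm.
have [N [h1 h2]] : exists N, `|a - aN N| < e / 4 /\ `|0 - rho ^+ N * C| < e / 4.
  move/cvgrPdist_lt: ha => /(_ _ e4) ha; move/cvgrPdist_lt: rC => /(_ _ e4) rC.
  by have [N [? ?]] := filter_ex (filterI ha rC); exists N.
have := hN N; move/cvgrPdist_lt => /(_ _ e4) h3.
have h4 := hf N _ e4.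
near=> n.
have h5 : `|aN N - fN N n| < e / 4 by near: n.
have h6 : `|f n - fN N n| <= rho ^+ N * C + e / 4 by near: n.
move: h1 h2 h5 h6; rewrite sub0r normrN => h1 /(le_lt_trans (ler_norm _)) h2 h5 h6.
have -> : a - f n = (a - aN N) + ((aN N - fN N n) - (f n - fN N n)) by ring.
apply: le_lt_trans (ler_normD _ _) _.
have := ler_normB (aN N - fN N n) (f n - fN N n); lra.
Unshelve. all: by end_near.
Qed.

(** Polynomial approximations of [1 / (l ^+ 2 - t) ^+ 2] which increase with [N]
    where they converge, so that they can detect that a limit is infinite. *)
Definition edgep (l L : R) N : {poly R} :=
  L ^- 2 *: \sum_(k < N) (1 - (L^-1 *: ((l ^+ 2)%:P - 'X)) ^+ 2) ^+ k.

Lemma edgepE l' L N : L != 0 -> edgep l' L N * ((l' ^+ 2)%:P - 'X) ^+ 2 =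
  1 - (1 - (L^-1 *: ((l' ^+ 2)%:P - 'X)) ^+ 2) ^+ N.
Proof.
move=> L0; set s := _ *: _; set q := 1 - s ^+ 2.
have -> : (l' ^+ 2)%:P - 'X = L *: s by rewrite /s scalerA divff // scale1r.
rewrite /edgep -/s -/q exprZn -scalerAl -scalerAr scalerA mulVf ?expf_neq0 //.
have -> : s ^+ 2 = - (q - 1) by rewrite /q addrAC subrr add0r opprK.
by rewrite scale1r mulrN mulrC -subrX1 opprB.
Qed.

(** The resolvent equation gives [u] a squared norm at least equal to this
    quadratic form at each level of approximation, wherever [l] lies with
    respect to the spectrum of the noise: evenness of the exponent makes the
    remainder a square. *)
Lemma edge_bound L M : L != 0 -> gform l be al (edgep l L M.*2) <= C ^+ 2.
Proof.
move=> L0; set P := edgep l L M.*2.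
pose er n := l ^+ 2 *: u n - W n *m u n - g n.
have her : negl er by exact: resolvent_equation.
pose K := \sum_(i < size P) `|P`_i| * (c0 ^+ 2) ^+ i.
have hK : \forall n \near U, opb (pmx P (W n)) K.
  near=> n; apply: opb_pmx; first exact: exprn_ge0.
  by apply: opb_gram => //; near: n; exact: Zc0.
have hg : nrm (g n) @[n --> U] --> Num.sqrt (gform l be al 1).
  apply: continuous_cvg; first exact: sqrt_continuous.
  rewrite (_ : (fun n => _) = (fun n => dot (g n) (pmx 1 (W n) *m g n))).
    exact: gform_lim.
  by apply/funext => n; rewrite pmx1 mul1mx.
have hl : C ^+ 2 + (2 * (nrm (er n) * (K * nrm (g n))) + nrm (er n) * (K * nrm (er n)))
    @[n --> U] --> C ^+ 2.
  have -> : C ^+ 2 = C ^+ 2 + (2 * (0 * (K * Num.sqrt (gform l be al 1))) + 0 * (K * 0)).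
    by rewrite !mul0r mulr0 !addr0.
  apply: cvgD; first by rewrite !mul0r mulr0 !addr0; exact: cvg_cst.
  by apply: cvgD; [apply: cvgM; first exact: cvg_cst|]; apply: cvgM => //;
    apply: cvgM => //; exact: cvg_cst.
apply: (ler_cvg_to (@gform_lim l be al P) hl); near=> n.
pose h := l ^+ 2 *: u n - W n *m u n.
have ge : g n = h - er n by rewrite /er opprB addrC subrK.
have PT : (pmx P (W n))^T = pmx P (W n) by rewrite pmx_tr trmx_mul trmxK.
have E1 : dot h (pmx P (W n) *m h) <= C ^+ 2.
  have hE : h = pmx ((l ^+ 2)%:P - 'X) (W n) *m u n.
    by rewrite pmxB pmxC pmxX mulmxBl mul_scalar_mx.
  have -> : dot h (pmx P (W n) *m h) =
      dot (u n) (pmx (P * ((l ^+ 2)%:P - 'X) ^+ 2) (W n) *m u n).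
    rewrite {1}hE dot_mull pmx_tr trmx_mul trmxK hE !mulmxA -!pmxM.
    congr (dot _ (pmx _ _ *m _)); rewrite expr2 mulrA; congr (_ * _); exact: mulrC.
  rewrite edgepE // -addnn exprD pmxB pmxM pmx1 mulmxBl mul1mx dotBr -mulmxA.
  rewrite [X in _ - X]dot_mulr pmx_tr trmx_mul trmxK.
  apply: le_trans (_ : dot (u n) (u n) <= _); first by rewrite gerBl dot_ge0.
  have uC : nrm (u n) <= C by near: n.
  by rewrite -nrm_sqr !expr2 ler_pM ?nrm_ge0.
have -> : dot (g n) (pmx P (W n) *m g n) = dot h (pmx P (W n) *m h)
   - (2 * dot (er n) (pmx P (W n) *m g n) + dot (er n) (pmx P (W n) *m er n)).
  have hE : h = g n + er n by rewrite ge subrK.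
  have sy : dot (g n) (pmx P (W n) *m er n) = dot (er n) (pmx P (W n) *m g n).
    by rewrite dot_mulr PT dotC.
  move: (g n) (er n) hE sy => gn en -> sy.
  rewrite !(mulmxDr, dotDl, dotDr) sy; ring.
apply: lerD => //; rewrite -[X in _ <= X]opprK lerN2 opprD.
have op : opb (pmx P (W n)) K by near: n.
have b1 (w : 'cV_(dn n)) : `|dot (er n) (pmx P (W n) *m w)| <= nrm (er n) * (K * nrm w).
  by apply: le_trans (cauchy_schwarz _ _) _; rewrite ler_wpM2l ?nrm_ge0.
have := b1 (g n); have := b1 (er n); rewrite !ler_norml => /andP[? _] /andP[? _].
by rewrite lerD // -mulrN ler_pM2l.
Unshelve. all: by end_near.
Qed.

Section Outlier.
Hypothesis (zl : zp < l).

(** Above the edge the resolvent equation can be inverted, with an error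
    controlled by the ratio of the operator norm of the noise to [l]. *)
Lemma neumann_approx : exists2 rho, 0 <= rho < 1 & forall N e, 0 < e ->
  \forall n \near U, nrm (u n - pmx (neumann l N) (W n) *m g n) <= rho ^+ N * C + e.
Proof.
have lp : 0 < l by exact: le_lt_trans zl.
have l0 : l != 0 by rewrite gt_eqF.
pose c := (zp + l) / 2.
have [cp cl zc] : [/\ 0 <= c, c < l & zp < c] by apply: midpoint.
exists ((c / l) ^+ 2).
  exact: ratio_sqr_lt1.
move=> N e e0.
pose p := neumann l N.
pose er n := l ^+ 2 *: u n - W n *m u n - g n.
have key n : u n - pmx p (W n) *m g n = pmx p (W n) *m er n
     + (l ^- 2) ^+ N *: ((W n) ^+ N *m u n).
  have := congr1 (fun q => pmx q (W n) *m u n) (neumannE N l0).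
  rewrite pmxM pmxB pmxC pmxX pmxB pmx1 pmxZ pmxXn pmxX -mulmxA !mulmxBl mul1mx.
  rewrite -scalemxAl mul_scalar_mx => h.
  by rewrite /er [in RHS]mulmxBr h addrAC subrK.
have small : negl (fun n => pmx p (W n) *m er n).
  apply: (@negl_opb dn dn er (fun n => pmx p (W n))
     (\sum_(i < size p) `|p`_i| * (c0 ^+ 2) ^+ i)); last exact: resolvent_equation.
  near=> n; apply: opb_pmx; first exact: exprn_ge0.
  by apply: opb_gram => //; near: n; exact: Zc0.
move/cvgrPdist_lt: small => /(_ _ e0) small.
have Zc : \forall n \near U, opb (Z n) c by apply: (sp_Z sp).
near=> n; rewrite key; apply: le_trans (nrmD _ _) _; rewrite addrC; apply: lerD.
  rewrite nrmZ ger0_norm ?exprn_ge0 ?invr_ge0 ?exprn_ge0 ?(ltW lp) //.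
  have h : opb (W n ^+ N) ((c ^+ 2) ^+ N).
    by apply: opbX; rewrite ?sqr_ge0 //; apply: opb_gram => //; near: n.
  apply: le_trans (ler_wpM2l _ (h _)) _.
    by rewrite exprn_ge0 // invr_ge0 exprn_ge0 // ltW.
  rewrite mulrA -exprMn [_ * c ^+ 2]mulrC -expr_div_n ler_wpM2l //.
    by rewrite exprn_ge0 // sqr_ge0.
  by near: n.
have : `|0 - nrm (pmx p (W n) *m er n)| < e by near: n.
by rewrite sub0r normrN ger0_norm ?nrm_ge0 // => /ltW.
Unshelve. all: by end_near.
Qed.

(** Taking the scalar product of the inverted resolvent equation with a left
    spike: only the left part of the right-hand side survives. *)
Lemma outlier_overlap (phiA : R) : l * MA (neumann l N) @[N --> \oo] --> phiA ->
  forall i, ka i 0 = phiA * be i 0.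
Proof.
move=> hphi i; have [rho rho1 happ] := neumann_approx.
have h1 : dot (A n *m delta_mx i 0) (u n) @[n --> U] --> ka i 0.
  rewrite (_ : (fun n => _) = (fun n => ((A n)^T *m u n) i 0)); first exact: ka_lim.
  by apply/funext => n; rewrite dot_mull dot_delta.
apply: (cvg_unique _ h1); first exact: Rhausdorff.
apply: (@double_limit _ (fun N n => dot (A n *m delta_mx i 0)
   (pmx (neumann l N) (W n) *m g n)) rho _
   (fun N => l * (MA (neumann l N) * be i 0) + 0)) => //.
- move=> N e e0; near=> n; rewrite -dotBr; apply: le_trans (cauchy_schwarz _ _) _.
  rewrite nrm_isom; last by near: n; exact: (sp_A sp).
  have -> : nrm (delta_mx i 0 : 'cV[R]_r) = 1.
    by rewrite /nrm dot_delta mxE !eqxx sqrtr1.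
  by rewrite mul1r; near: n; apply: happ.
- move=> N; rewrite (_ : (fun n => _) = (fun n =>
     l * dot (A n *m delta_mx i 0) (pmx (neumann l N) (W n) *m (A n *m be)) +
     dot (A n *m delta_mx i 0) (pmx (neumann l N) (W n) *m (Z n *m (B n *m al))))).
    apply: cvgD; last exact: (sp_AB sp).
    apply: cvgM; first exact: cvg_cst.
    by rewrite -dot_delta; exact: (sp_AA sp).
  by apply/funext => n; rewrite /g /gvec mulmxDr dotDr -scalemxAr dotZr.
- under eq_fun do rewrite addr0 mulrA.
  by apply: cvgM => //; exact: cvg_cst.
Unshelve. all: by end_near.
Qed.

Lemma outlier_norm (G : R) : gform l be al (neumann l N ^+ 2) @[N --> \oo] --> G ->
  dot (u n) (u n) @[n --> U] --> G.
Proof.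
move=> hG; have [rho rho1 happ] := neumann_approx.
have sq : nrm (u n) @[n --> U] --> Num.sqrt G.
  apply: (@double_limit _ (fun N n => nrm (pmx (neumann l N) (W n) *m g n)) rho _
    (fun N => Num.sqrt (gform l be al (neumann l N ^+ 2)))) => //.
  - move=> N e e0; near=> n; apply: le_trans (nrm_dist _ _) _.
    by near: n; apply: happ.
  - move=> N; apply: continuous_cvg; first exact: sqrt_continuous.
    under eq_fun => n.
      rewrite dot_mull pmx_tr trmx_mul trmxK mulmxA -pmxM -expr2.
      over.
    exact: gform_lim.
  - by apply: continuous_cvg; first exact: sqrt_continuous.
have G0 : 0 <= G.
  apply: (@cvg_ge_const _ \oo _ _ _ _ hG); near=> N.
  apply: (cvg_ge_const (@gform_lim l be al (neumann l N ^+ 2))).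
  near=> n; rewrite expr2 pmxM -mulmxA dot_mulr pmx_tr trmx_mul trmxK.
  exact: dot_ge0.
under eq_fun do rewrite -nrm_sqr expr2.
by rewrite -(sqr_sqrtr G0) expr2; apply: cvgM.
Unshelve. all: by end_near.
Qed.

End Outlier.

End NearSingular.

Section QuasiMode.
Context {R : realType} (U : set_system nat) {UF : ProperFilter U} (r : nat).
Variables (dn dp : nat -> nat) (x : 'I_r -> R).
Variables (A : forall n, 'M[R]_(dn n, r)) (B : forall n, 'M[R]_(dp n, r)).
Variables (Z : forall n, 'M[R]_(dn n, dp n)) (zp : R) (MA MB : {poly R} -> R).
Hypothesis (zp0 : 0 <= zp) (sp : spiked U A B Z zp MA MB).
Let D : 'M[R]_r := diag_mx (\row_i x i).
Let Y n := A n *m D *m (B n)^T + Z n.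

(** An approximate left singular vector at the level [l], built from prescribed
    overlaps. *)
Definition quasimode (l : R) (be al : 'cV[R]_r) N n :=
  pmx (neumann l N) (Z n *m (Z n)^T) *m gvec A B Z l be al n.

(** The truncated resolvents turn a pair of overlaps into a pair of vectors
    which almost satisfies the first singular vector equation; the defect comes
    from the truncation and from the failure of the linear system on the
    overlaps. *)
Lemma quasimode_res l be al : zp < l -> exists2 rho, 0 <= rho < 1 &
  forall N e, 0 < e -> \forall n \near U,
    nrm (l *: quasimode l be al N n -
      Y n *m (pmx (neumann l N) ((Z n)^T *m Z n) *m
              (l *: (B n *m al) + (Z n)^T *m (A n *m be))))
    <= nrm (be - (l * MB (neumann l N)) *: (D *m al)) + rho ^+ N * nrm be + e.
Proof.
move=> zl; have lp : 0 < l by exact: le_lt_trans zl.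
have l0 : l != 0 by rewrite gt_eqF.
pose c := (zp + l) / 2.
have [cp cl zc] : [/\ 0 <= c, c < l & zp < c] by apply: midpoint.
exists ((c / l) ^+ 2); first exact: ratio_sqr_lt1.
move=> N e e0; set p := neumann l N.
pose W n := Z n *m (Z n)^T.
pose w n := pmx p ((Z n)^T *m Z n) *m (l *: (B n *m al) + (Z n)^T *m (A n *m be)).
pose t := (l * MB p) *: (D *m al).
have key n : l *: quasimode l be al N n - Y n *m w n =
   A n *m (be - t) - A n *m (D *m ((B n)^T *m w n) - t)
   - (l ^- 2) ^+ N *: ((W n) ^+ N *m (A n *m be)).
  have := congr1 (fun q => pmx q (W n) *m (A n *m be)) (neumannE N l0).
  rewrite pmxM pmxB pmxC pmxX pmxB pmx1 pmxZ pmxXn pmxX -mulmxA !mulmxBl mul1mx.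
  rewrite -scalemxAl mul_scalar_mx -/p mulmxBr => h.
  have Zw : Z n *m w n = pmx p (W n) *m (l *: (Z n *m (B n *m al)) + W n *m (A n *m be)).
    by rewrite /w mulmxA -pmx_intertwine -mulmxA mulmxDr -scalemxAr !mulmxA.
  rewrite /Y mulmxDl Zw /quasimode -/p -/(W n) /gvec !mulmxDr -!scalemxAr.
  rewrite -scalemxAr in h.
  rewrite !mulmxN -!mulmxA; apply/colP => i; move: (congr1 (fun M : 'cV_(dn n) => M i 0) h).
  rewrite !(scalemxE, mxE_add, mxE_opp) => hi.
  apply: etrans (_ : _ = l ^+ 2 * (pmx p (W n) *m (A n *m be)) i 0
     - (pmx p (W n) *m (Z n *m ((Z n)^T *m (A n *m be)))) i 0
     - (A n *m (D *m ((B n)^T *m w n))) i 0) _; first by ring.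
  by rewrite [Z n *m (_ *m _)]mulmxA hi; ring.
have Zc : \forall n \near U, opb (Z n) c by apply: (sp_Z sp).
have Zw i : (D *m ((B n)^T *m w n) - t) i 0 @[n --> U] --> (0 : R).
  have -> : (fun n => (D *m ((B n)^T *m w n) - t) i 0) =
     (fun n => x i * (dot (B n *m delta_mx i 0) (w n) - l * MB p * al i 0)).
    apply/funext => n; rewrite mxE_add mxE_opp /t scalemxE !diag_mulE.
    by rewrite dot_mull dot_delta; ring.
  rewrite -(mulr0 (x i)); apply: cvgM; first exact: cvg_cst.
  apply: cvg_diff0; have -> : l * MB p * al i 0 = l * (MB p * al i 0) + 0 by rewrite addr0 mulrA.
  rewrite (_ : (fun n => _) = (fun n => l * dot (B n *m delta_mx i 0)
     (pmx p ((Z n)^T *m Z n) *m (B n *m al)) + dot (B n *m delta_mx i 0)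
     (pmx p ((Z n)^T *m Z n) *m ((Z n)^T *m (A n *m be))))).
    apply: cvgD.
      apply: cvgM; first exact: cvg_cst.
      by rewrite -dot_delta; exact: (sp_BB sp).
    have := sp_AB (@spiked_tr _ _ UF _ _ _ _ _ _ _ _ _ zp0 sp) p (delta_mx i 0) be.
    by under eq_fun do rewrite trmxK.
  by apply/funext => n; rewrite /w mulmxDr dotDr -scalemxAr dotZr.
have small : negl U (fun n => A n *m (D *m ((B n)^T *m w n) - t)).
  by apply: (@negl_isom _ U _ _ _ _ (fun n => D *m ((B n)^T *m w n) - t)) => //;
    exact: (sp_A sp).
move/cvgrPdist_lt: small => /(_ _ e0) small.
near=> n; rewrite -/(w n) key.
have iA : (A n)^T *m A n = 1%:M by near: n; exact: (sp_A sp).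
apply: le_trans (nrmB _ _) _; rewrite addrAC; apply: lerD.
  apply: le_trans (nrmB _ _) _; apply: lerD; first by rewrite nrm_isom.
  have : `|0 - nrm (A n *m (D *m ((B n)^T *m w n) - t))| < e by near: n.
  by rewrite sub0r normrN ger0_norm ?nrm_ge0 // => /ltW.
rewrite nrmZ ger0_norm ?exprn_ge0 ?invr_ge0 ?exprn_ge0 ?(ltW lp) //.
have h : opb (W n ^+ N) ((c ^+ 2) ^+ N).
  by apply: opbX; rewrite ?sqr_ge0 //; apply: opb_gram => //; near: n.
apply: le_trans (ler_wpM2l _ (h _)) _.
  by rewrite exprn_ge0 // invr_ge0 exprn_ge0 // ltW.
by rewrite mulrA -exprMn [_ * c ^+ 2]mulrC -expr_div_n nrm_isom.
Unshelve. all: by end_near.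
Qed.

Lemma quasimode_norm l be al N :
  dot (quasimode l be al N n) (quasimode l be al N n) @[n --> U] -->
    gform MA MB l be al (neumann l N ^+ 2).
Proof.
rewrite (_ : (fun n => _) = (fun n => dot (gvec A B Z l be al n)
   (pmx (neumann l N ^+ 2) (Z n *m (Z n)^T) *m gvec A B Z l be al n))).
  exact: (gform_lim sp).
apply/funext => n; rewrite /quasimode dot_mull pmx_tr trmx_mul trmxK mulmxA.
by rewrite -pmxM -expr2.
Qed.

End QuasiMode.

Lemma cvg_dist0 (R : realType) (U : set_system nat) {UU : ProperFilter U} (f : nat -> R) (l : R) :
  f n @[n --> U] --> l -> `|l - f n| @[n --> U] --> (0 : R).
Proof.
move=> h; under eq_fun do rewrite distrC.
by rewrite -(normr0 R); apply: cvg_norm; exact: cvg_diff0.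
Qed.

Lemma dist_quarter (R : realType) (G g q : R) :
  `|G - g| < G / 4 -> `|g - q| < G / 4 -> G / 2 < q.
Proof. by rewrite !ltr_distl => /andP[? ?] /andP[? ?]; lra. Qed.

Lemma residual_contra (R : realType) (t q : R) :
  0 < t -> t / 2 < q -> q <= 2 ^+ 2 * (t / 64) + 2 ^+ 2 * (t / 64) -> False.
Proof. by move=> ? ? ?; lra. Qed.

(** * Singular value decompositions *)

Section SvdFacts.
Context {R : realType} (n p : nat) (Y U : 'M[R]_(n, p)) (s : seq R) (V : 'M[R]_p).
Hypothesis svd : is_svd Y U s V.

Lemma svd_orthoU i j : dot (col i U) (col j U) = (i == j)%:R.
Proof.
case: svd => UU _ _ _; have := congr1 (fun M : 'M[R]_p => M i j) UU.
by rewrite [in X in _ = X]mxE => <-; rewrite mxE; apply: eq_bigr => k _; rewrite !mxE.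
Qed.

Lemma svd_orthoV i j : dot (col i V) (col j V) = (i == j)%:R.
Proof.
case: svd => _ VV _ _; have := congr1 (fun M : 'M[R]_p => M i j) VV.
by rewrite [in X in _ = X]mxE => <-; rewrite mxE; apply: eq_bigr => k _; rewrite !mxE.
Qed.

Lemma svd_nrmU i : nrm (col i U) = 1.
Proof. by rewrite /nrm svd_orthoU eqxx sqrtr1. Qed.

Lemma svd_nrmV i : nrm (col i V) = 1.
Proof. by rewrite /nrm svd_orthoV eqxx sqrtr1. Qed.

Lemma svd_mul w : Y *m w = \sum_(i < p) (s`_i * dot (col i V) w) *: col i U.
Proof.
case: svd => _ _ _ {1}->; rewrite mulmx_suml; apply: eq_bigr => i _.
by rewrite -scalemxAl -mulmxA dot_mx mul_mx_scalar scalerA.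
Qed.

Lemma svd_tmul w : Y^T *m w = \sum_(i < p) (s`_i * dot (col i U) w) *: col i V.
Proof.
case: svd => _ _ _ {1}->; rewrite linear_sum /= mulmx_suml; apply: eq_bigr => i _.
by rewrite linearZ /= trmx_mul trmxK -scalemxAl -mulmxA dot_mx mul_mx_scalar scalerA.
Qed.

Lemma svd_right i : Y *m col i V = s`_i *: col i U.
Proof.
rewrite svd_mul (bigD1 i) //= big1 => [|j ij]; last first.
  by rewrite svd_orthoV (negbTE ij) mulr0 scale0r.
by rewrite svd_orthoV eqxx mulr1 addr0.
Qed.

Lemma svd_left i : Y^T *m col i U = s`_i *: col i V.
Proof.
rewrite svd_tmul (bigD1 i) //= big1 => [|j ij]; last first.
  by rewrite svd_orthoU (negbTE ij) mulr0 scale0r.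
by rewrite svd_orthoU eqxx mulr1 addr0.
Qed.

Lemma svd_ge0 i : 0 <= s`_i.
Proof.
case: svd => _ _ [_ _ /allP h] _; have [lt|ge] := ltnP i (size s).
  by apply: h; exact: mem_nth.
by rewrite nth_default.
Qed.

Lemma svd_sorted i j : (i <= j)%N -> s`_j <= s`_i.
Proof.
move=> ij; have [lt|ge] := ltnP j (size s); last by rewrite (nth_default _ ge) svd_ge0.
case: svd => _ _ [_ srt _] _.
apply: (@sorted_leq_nth _ (fun x y : R => y <= x) _ _ 0 s srt i j) => //.
- by move=> a b c ba cb; exact: le_trans cb ba.
- by rewrite inE (leq_ltn_trans ij).
Qed.

Lemma svd_size : size s = p. Proof. by case: svd => _ _ []. Qed.

Lemma dot_svdU (c e : 'I_p -> R) :
  dot (\sum_i c i *: col i U) (\sum_i e i *: col i U) = \sum_i c i * e i.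
Proof.
rewrite dot_suml; apply: eq_bigr => i _; rewrite dotZl dot_sumr (bigD1 i) //=.
rewrite big1 => [|j ij]; last by rewrite dotZr svd_orthoU eq_sym (negbTE ij) mulr0.
by rewrite dotZr svd_orthoU eqxx mulr1 addr0.
Qed.

Lemma svd_parseval w : dot w w = \sum_i dot (col i V) w ^+ 2.
Proof.
case: svd => _ VV _ _; have VVt : V *m V^T = 1%:M by exact: mulmx1C.
rewrite -{1 2}[w]mul1mx -VVt -mulmxA dot_mull mulmxA VV mul1mx /dot.
apply: eq_bigr => i _; rewrite -expr2; congr (_ ^+ 2).
by rewrite mxE; apply: eq_bigr => k _; rewrite !mxE.
Qed.

Lemma svd_bessel w : \sum_i dot (col i U) w ^+ 2 <= dot w w.
Proof.
case: svd => UU _ _ _; have := opb_coisom UU w; rewrite mul1r => h.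
have {}h : nrm (U^T *m w) ^+ 2 <= nrm w ^+ 2 by rewrite ler_sqr ?nnegrE ?nrm_ge0.
rewrite -[leRHS]nrm_sqr; apply: le_trans h; rewrite nrm_sqr /dot le_eqVlt.
apply/orP; left; apply/eqP.
apply: eq_bigr => i _; rewrite -expr2; congr (_ ^+ 2).
by rewrite mxE; apply: eq_bigr => k _; rewrite !mxE.
Qed.

Lemma svd_sqr w : dot (Y *m w) (Y *m w) = \sum_(i < p) s`_i ^+ 2 * dot (col i V) w ^+ 2.
Proof.
by rewrite svd_mul dot_svdU; apply: eq_bigr => i _; rewrite -expr2 exprMn.
Qed.

Lemma svd_opb : opb Y s`_0.
Proof.
move=> w; rewrite -ler_sqr ?nnegrE ?mulr_ge0 ?nrm_ge0 ?svd_ge0 //.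
rewrite exprMn !nrm_sqr svd_sqr svd_parseval mulr_sumr; apply: ler_sum => i _.
by rewrite ler_wpM2r ?sqr_ge0 // ler_sqr ?nnegrE ?svd_ge0 // svd_sorted.
Qed.

(** Expanding in the singular bases, each term is a sum of squares once
    [s`_i - l] is bounded away from 0: a pair of vectors which almost satisfies
    the singular vector equations at [l] forces a singular value near [l]. *)
Lemma svd_residual (w1 : 'cV[R]_n) (w2 : 'cV[R]_p) (l e : R) : 0 <= l -> 0 <= e ->
  (forall i : 'I_p, e <= `|s`_i - l|) ->
  e ^+ 2 * dot w2 w2 <= nrm (l *: w1 - Y *m w2) ^+ 2 + nrm (l *: w2 - Y^T *m w1) ^+ 2.
Proof.
move=> l0 e0 gap; rewrite !nrm_sqr.
apply: le_trans (lerD (svd_bessel _) (lexx _)); rewrite [X in _ <= _ + X]svd_parseval.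
rewrite svd_parseval mulr_sumr -big_split; apply: ler_sum => i _ /=.
rewrite !dotBr !dotZr dot_mulr svd_left dotZl [dot (col i V) (Y^T *m _)]dot_mulr.
rewrite trmxK svd_right dotZl.
set a := dot _ w1; set b := dot _ w2.
have h : e ^+ 2 <= (s`_i - l) ^+ 2.
  by rewrite -[leRHS](real_normK (num_real _)) ler_sqr ?nnegrE.
have sl : 0 <= s`_i * l by rewrite mulr_ge0 ?svd_ge0.
apply: le_trans (ler_wpM2r (sqr_ge0 b) h) _.
rewrite -subr_ge0.
have -> : (l * a - s`_i * b) ^+ 2 + (l * b - s`_i * a) ^+ 2 - (s`_i - l) ^+ 2 * b ^+ 2 =
  (s`_i - l) ^+ 2 * a ^+ 2 + 2 * (s`_i * l) * (a - b) ^+ 2 by ring.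
by rewrite addr_ge0 // mulr_ge0 ?sqr_ge0 // mulr_ge0.
Qed.

End SvdFacts.

(** Weyl's inequality: a perturbation of rank [r] shifts the indices by at most
    [r], by the dimension count in the minimax principle. *)
Lemma svd_weyl (R : realType) (n p r : nat) (A : 'M[R]_(n, r)) (B : 'M[R]_(p, r))
    (Y Z : 'M[R]_(n, p)) U s V U' s' V' i :
  is_svd Y U s V -> is_svd Z U' s' V' -> Y = A *m B^T + Z -> (i + r < p)%N ->
  s'`_(i + r) <= s`_i.
Proof.
move=> hY hZ YZ irp.
pose wid (k : 'I_(i + r).+1) : 'I_p := widen_ord irp k.
pose widi (k : 'I_i) : 'I_p := widen_ord (leq_trans (leq_addr r i) (ltnW irp)) k.
pose V1 : 'M[R]_(p, (i + r).+1) := \matrix_(k, j) V' k (wid j).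
(* orthogonality to these [i + r] vectors leaves a nonzero vector in the span of
   the first [i + r + 1] right singular vectors of [Z] *)
pose C : 'M[R]_(p, i + r) := row_mx (\matrix_(k, j) V k (widi j)) B.
have : kermx (V1^T *m C) != 0.
  rewrite kermx_eq0 /row_free neq_ltn.
  by rewrite (leq_ltn_trans (rank_leq_col _)).
move/rowV0Pn => [c /sub_kermxP cK c0].
pose w := V1 *m c^T.
have wC : C^T *m w = 0.
  by rewrite /w mulmxA -[C^T *m V1]trmxK trmx_mul trmxK -trmx_mul cK trmx0.
have VV : V1^T *m V1 = 1%:M.
  apply/matrixP => a b; have := svd_orthoV hZ (wid a) (wid b).
  rewrite !mxE => h; apply: etrans (etrans _ h) _; last first.
    by congr (_ %:R); apply/eqP/eqP => [/(congr1 val) /= ?|->] //; exact: val_inj.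
  by apply: eq_bigr => k _; rewrite !mxE.
have BW : B^T *m w = 0.
  by move: wC; rewrite /C tr_row_mx mul_col_mx => /(congr1 dsubmx);
     rewrite col_mxKd linear0.
have VW (j : 'I_p) : (j < i)%N -> dot (col j V) w = 0.
  move=> ji; move: wC; rewrite /C tr_row_mx mul_col_mx => /(congr1 usubmx).
  rewrite col_mxKu linear0 => /(congr1 (fun M : 'cV[R]_i => M (Ordinal ji) 0)).
  rewrite [in X in _ = X]mxE => <-; rewrite mxE; apply: eq_bigr => k _; rewrite !mxE.
  by congr (V _ _ * _); exact: val_inj.
have wn : dot w w = dot c^T c^T by rewrite /w dot_mull mulmxA VV mul1mx.
have cp : 0 < dot c^T c^T.
  rewrite lt_neqAle dot_ge0 andbT eq_sym; apply: contra c0 => /eqP /dot_eq0 h.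
  by rewrite -[c]trmxK h trmx0.
have up : dot (Y *m w) (Y *m w) <= s`_i ^+ 2 * dot w w.
  rewrite (svd_sqr hY) (svd_parseval hY w) mulr_sumr; apply: ler_sum => j _.
  have [ji|ij] := ltnP j i; first by rewrite VW // expr0n !mulr0.
  rewrite ler_wpM2r ?sqr_ge0 // ler_sqr ?nnegrE ?(svd_ge0 hY) //.
  exact: (svd_sorted hY).
have lo : s'`_(i + r) ^+ 2 * dot w w <= dot (Z *m w) (Z *m w).
  rewrite (svd_sqr hZ) (svd_parseval hZ w) mulr_sumr; apply: ler_sum => j _.
  have [ji|ij] := leqP j (i + r).
    rewrite ler_wpM2r ?sqr_ge0 // ler_sqr ?nnegrE ?(svd_ge0 hZ) //.
    exact: (svd_sorted hZ).
  have -> : dot (col j V') w = 0.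
    rewrite /w dot_mulr (_ : V1^T *m _ = 0) ?dot0l //; apply/colP => k.
    have := svd_orthoV hZ (wid k) j; rewrite -val_eqE /= ltn_eqF; last first.
      by rewrite (leq_ltn_trans _ ij) // -ltnS.
    move=> h; rewrite [RHS]mxE; apply: etrans h; rewrite mxE.
    by apply: eq_bigr => q _; rewrite !mxE.
  by rewrite expr0n !mulr0.
have ZY : Z *m w = Y *m w by rewrite YZ mulmxDl -mulmxA BW mulmx0 add0r.
have := le_trans lo _; rewrite ZY => /(_ _ up); rewrite wn ler_pM2r //.
by rewrite ler_sqr ?nnegrE ?(svd_ge0 hZ) ?(svd_ge0 hY).
Qed.

(** * Singular values and vectors of the spiked model *)

(** The limits, as the truncation order grows, of the spectral means that enter
    the secular equation and the normalisation, at a level [l] above the edge. *)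
Record edge_data (R : realType) (MA MB : {poly R} -> R) (l phiA phiB gA hA gB hB : R)
    : Prop := EdgeData {
  ed_phiA : l * MA (neumann l N) @[N --> \oo] --> phiA;
  ed_phiB : l * MB (neumann l N) @[N --> \oo] --> phiB;
  ed_gA : MA (neumann l N ^+ 2) @[N --> \oo] --> gA;
  ed_hA : MA ('X * neumann l N ^+ 2) @[N --> \oo] --> hA;
  ed_gB : MB (neumann l N ^+ 2) @[N --> \oo] --> gB;
  ed_hB : MB ('X * neumann l N ^+ 2) @[N --> \oo] --> hB;
  ed_pos : [/\ 0 < phiA, 0 < phiB, 0 < gA, 0 < gB & (0 <= hA) && (0 <= hB)] }.

Section SpikedSvd.
Context {R : realType} (U : set_system nat) {UU : UltraFilter U} (r : nat).
Variables (dn dp : nat -> nat) (x : 'I_r -> R).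
Variables (A : forall n, 'M[R]_(dn n, r)) (B : forall n, 'M[R]_(dp n, r)).
Variables (Z : forall n, 'M[R]_(dn n, dp n)) (zp : R) (MA MB : {poly R} -> R).
Hypothesis (zp0 : 0 < zp) (sp : spiked U A B Z zp MA MB).
Hypothesis (dp_oo : forall k, \forall n \near U, (k < dp n)%N).
Hypothesis (x_gt0 : forall j, 0 < x j) (x_dec : forall i j : 'I_r, (i < j)%N -> x j < x i).

Let D : 'M[R]_r := diag_mx (\row_i x i).
Let X n := A n *m D *m (B n)^T.
Let Y n := X n + Z n.

Variables (Uu : forall n, 'M[R]_(dn n, dp n)) (ys : nat -> seq R) (V : forall n, 'M[R]_(dp n)).
Hypothesis Y_svd : forall n, is_svd (Y n) (Uu n) (ys n) (V n).

Variables (phiA phiB gA hA gB hB : R -> R).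
Hypothesis data : forall l, zp < l ->
  edge_data MA MB l (phiA l) (phiB l) (gA l) (hA l) (gB l) (hB l).
Let DD l := phiA l * phiB l.
Hypothesis DD_inj : forall l l', zp < l -> zp < l' -> DD l = DD l' -> l = l'.

(** Indexing by nat gives a fixed index a meaning while the dimension varies;
    the null vector is harmless, since it is only used for finitely many sizes. *)
Definition lvec k n : 'cV[R]_(dn n) :=
  if @idP (k < dp n)%N is ReflectT lt then col (Ordinal lt) (Uu n) else 0.
Definition rvec k n : 'cV[R]_(dp n) :=
  if @idP (k < dp n)%N is ReflectT lt then col (Ordinal lt) (V n) else 0.

Lemma lvecE k n (lt : (k < dp n)%N) : lvec k n = col (Ordinal lt) (Uu n).
Proof.
by rewrite /lvec; case: {-}_ / idP => // lt'; congr (col _ _); exact: val_inj.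
Qed.

Lemma rvecE k n (lt : (k < dp n)%N) : rvec k n = col (Ordinal lt) (V n).
Proof.
by rewrite /rvec; case: {-}_ / idP => // lt'; congr (col _ _); exact: val_inj.
Qed.

Lemma nrm_lvec k n : nrm (lvec k n) <= 1.
Proof.
rewrite /lvec; case: {-}_ / idP => [lt|_]; last by rewrite nrm0 ler01.
by rewrite (svd_nrmU (Y_svd n)).
Qed.

Lemma nrm_rvec k n : nrm (rvec k n) <= 1.
Proof.
rewrite /rvec; case: {-}_ / idP => [lt|_]; last by rewrite nrm0 ler01.
by rewrite (svd_nrmV (Y_svd n)).
Qed.

Lemma X_opb n : (A n)^T *m A n = 1%:M -> (B n)^T *m B n = 1%:M ->
  opb (X n) (\sum_j x j).
Proof.
move=> hA' hB' w; rewrite /X -!mulmxA nrm_isom //.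
apply: le_trans (nrm_le_sum _) _; rewrite mulr_suml; apply: ler_sum => j _.
rewrite diag_mulE normrM gtr0_norm // ler_wpM2l ?(ltW (x_gt0 j)) //.
apply: le_trans (abs_coord_nrm _ _) _.
by have := opb_coisom hB' w; rewrite mul1r.
Qed.

Lemma ys_bounded k : \forall n \near U, `|(ys n)`_k| <= (\sum_j x j) + (zp + 1).
Proof.
near=> n; rewrite ger0_norm ?(svd_ge0 (Y_svd n)) //.
have lt : (k < dp n)%N by near: n.
rewrite -[leLHS]ger0_norm ?(svd_ge0 (Y_svd n)) // -[leLHS]mulr1.
rewrite -(svd_nrmU (Y_svd n) (Ordinal lt)) -nrmZ.
have := svd_right (Y_svd n) (Ordinal lt) => /= <-.
have Zb : opb (Z n) (zp + 1) by near: n; apply: (sp_Z sp); rewrite ltrDl.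
have Xb : opb (X n) (\sum_j x j).
  by apply: X_opb; near: n; [exact: (sp_A sp)|exact: (sp_B sp)].
rewrite /Y mulmxDl; apply: le_trans (nrmD _ _) _; apply: le_trans (lerD (Xb _) (Zb _)) _.
by rewrite (svd_nrmV (Y_svd n)) (svd_nrmU (Y_svd n)) !mulr1 addrA.
Unshelve. all: by end_near.
Qed.

Lemma negl_singular k (l : R) : (ys n)`_k @[n --> U] --> l ->
  negl U (fun n => l *: lvec k n - Y n *m rvec k n) /\
  negl U (fun n => l *: rvec k n - (Y n)^T *m lvec k n).
Proof.
move=> hl; have hd : `|l - (ys n)`_k| @[n --> U] --> (0 : R).
  exact: cvg_dist0.
split; apply: cvg0_le hd; near=> n; rewrite ger0_norm ?nrm_ge0 //.
  have lt : (k < dp n)%N by near: n.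
  rewrite (lvecE lt) (rvecE lt) (svd_right (Y_svd n)) -scalerBl nrmZ.
  by rewrite (svd_nrmU (Y_svd n)) mulr1.
have lt : (k < dp n)%N by near: n.
rewrite (lvecE lt) (rvecE lt) (svd_left (Y_svd n)) -scalerBl nrmZ.
by rewrite (svd_nrmV (Y_svd n)) mulr1.
Unshelve. all: by end_near.
Qed.

Lemma overlap_lim (d : nat -> nat) (M : forall n, 'M[R]_(d n, r)) (w : forall n, 'cV[R]_(d n)) :
  (\forall n \near U, (M n)^T *m M n = 1%:M) ->
  (\forall n \near U, nrm (w n) <= 1) ->
  exists ka : 'cV[R]_r, forall i, ((M n)^T *m w n) i 0 @[n --> U] --> ka i 0.
Proof.
move=> hM hw.
have h i : exists l : R, ((M n)^T *m w n) i 0 @[n --> U] --> l.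
  apply: (@ultra_bounded _ U _ _ 1); near=> n.
  apply: le_trans (abs_coord_nrm _ _) _.
  have iM : (M n)^T *m M n = 1%:M by near: n.
  by have := opb_coisom iM (w n); rewrite mul1r => /le_trans; apply; near: n.
have [f hf] := choice h.
by exists (\col_i f i) => i; rewrite mxE; exact: hf.
Unshelve. all: by end_near.
Qed.

Lemma dot_col_sum (a b : 'cV[R]_r) : dot (D *m a) (D *m b) = \sum_i x i ^+ 2 * (a i 0 * b i 0).
Proof. by apply: eq_bigr => i _; rewrite !diag_mulE; ring. Qed.

(** Above the edge the limiting overlaps solve a linear system, solvable when
    [x_j ^+ 2 * DD l = 1] for some [j], and the norm of the vector is determined
    by them. *)
Lemma secular (u : forall n, 'cV[R]_(dn n)) (v : forall n, 'cV[R]_(dp n)) (l C : R)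
    (ka la : 'cV[R]_r) : zp < l ->
  (\forall n \near U, nrm (u n) <= C) -> (\forall n \near U, nrm (v n) <= C) ->
  negl U (fun n => l *: u n - Y n *m v n) ->
  negl U (fun n => l *: v n - (Y n)^T *m u n) ->
  (forall i, ((A n)^T *m u n) i 0 @[n --> U] --> ka i 0) ->
  (forall i, ((B n)^T *m v n) i 0 @[n --> U] --> la i 0) ->
  [/\ forall i, ka i 0 = phiA l * (x i * la i 0),
      forall i, la i 0 = phiB l * (x i * ka i 0) &
      dot (u n) (u n) @[n --> U] -->
        l ^+ 2 * dot (D *m la) (D *m la) * gA l + dot (D *m ka) (D *m ka) * hB l].
Proof.
move=> zl uC vC ru rv kl ll; have ed := data zl.
split.
- move=> i; rewrite (outlier_overlap (ltW zp0) sp uC ru rv kl ll zl (ed_phiA ed)).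
  by rewrite diag_mulE.
- move=> i.
  have sp' := @spiked_tr _ _ (@ultra_proper _ _ UU) _ _ _ _ _ _ _ _ _ (ltW zp0) sp.
  have YT n : (Y n)^T = B n *m D *m (A n)^T + (Z n)^T.
    by rewrite raddfD /= !trmx_mul trmxK tr_diag_mx mulmxA.
  have ru' : negl U (fun n => l *: u n - (B n *m D *m (A n)^T + (Z n)^T)^T *m v n).
    by rewrite /negl; under eq_fun do rewrite -YT trmxK.
  have rv' : negl U (fun n => l *: v n - (B n *m D *m (A n)^T + (Z n)^T) *m u n).
    by rewrite /negl; under eq_fun do rewrite -YT.
  rewrite (outlier_overlap (ltW zp0) sp' vC rv' ru' ll kl zl (ed_phiB ed)).
  by rewrite diag_mulE.
- apply: (outlier_norm (ltW zp0) sp uC ru rv kl ll zl).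
  rewrite /gform; apply: cvgD; apply: cvgM; [exact: cvg_cst|exact: ed_gA ed|
    exact: cvg_cst|exact: ed_hB ed].
Qed.

Lemma x_inj i j : x i ^+ 2 = x j ^+ 2 -> i = j.
Proof.
move=> /eqP; rewrite eqrXn2 ?(ltW (x_gt0 _)) // => /eqP xij.
by apply: val_inj; case: (ltngtP i j) => // /x_dec; rewrite xij ltxx.
Qed.

Lemma overlap_support l (ka la : 'cV[R]_r) :
  (forall i, ka i 0 = phiA l * (x i * la i 0)) ->
  (forall i, la i 0 = phiB l * (x i * ka i 0)) ->
  forall i, x i ^+ 2 * DD l != 1 -> ka i 0 = 0.
Proof.
move=> e f i h; have := e i; rewrite f => k.
have : ka i 0 * (x i ^+ 2 * DD l - 1) = 0.
  rewrite mulrBr mulr1 [X in _ - X]k; rewrite /DD; ring.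
by move/eqP; rewrite mulf_eq0 subr_eq0 (negbTE h) orbF => /eqP.
Qed.

Lemma dot_sing1 k : \forall n \near U, dot (lvec k n) (lvec k n) = 1.
Proof.
near=> n; have lt : (k < dp n)%N by near: n.
by rewrite (lvecE lt) (svd_orthoU (Y_svd n)) eqxx.
Unshelve. all: by end_near.
Qed.

Lemma near_cvg (f : nat -> R) (c l : R) :
  (\forall n \near U, f n = c) -> f n @[n --> U] --> l -> c = l.
Proof.
move=> fc fl; apply: (cvg_unique _ _ fl); first exact: Rhausdorff.
by apply: cvg_near_cst; near=> n; near: n.
Unshelve. all: by end_near.
Qed.

Let lvec1 k : \forall n \near U, nrm (lvec k n) <= 1.
Proof. by near=> n; exact: nrm_lvec. Unshelve. all: by end_near. Qed.
Let rvec1 k : \forall n \near U, nrm (rvec k n) <= 1.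
Proof. by near=> n; exact: nrm_rvec. Unshelve. all: by end_near. Qed.

(** A unit vector cannot have all its overlaps vanish in the limit, so that the
    linear system has a nonzero solution. *)
Lemma sing_overlap k (l : R) (ka la : 'cV[R]_r) : zp < l ->
  (ys n)`_k @[n --> U] --> l ->
  (forall i, ((A n)^T *m lvec k n) i 0 @[n --> U] --> ka i 0) ->
  (forall i, ((B n)^T *m rvec k n) i 0 @[n --> U] --> la i 0) ->
  exists2 j, x j ^+ 2 * DD l = 1 & ka j 0 != 0.
Proof.
move=> zl hl kl ll; have [ru rv] := negl_singular hl.
have [e f nm] := secular zl (lvec1 k) (rvec1 k) ru rv kl ll.
apply: contrapT => nex.
have ka0 : ka = 0.
  apply/colP => i; rewrite mxE; have [h|h] := eqVneq (x i ^+ 2 * DD l) 1.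
    by apply: contrapT => /eqP k0; apply: nex; exists i.
  exact: overlap_support h.
have la0 : la = 0 by apply/colP => i; rewrite f ka0 !mxE !mulr0.
have := near_cvg (dot_sing1 k) nm; rewrite la0 ka0 mulmx0 dot0l mulr0 !mul0r addr0.
by move/eqP; rewrite oner_eq0.
Qed.

(** Two different indices cannot share a limit above the edge: a combination of
    the two singular vectors would have vanishing overlaps, hence vanishing
    norm. *)
Lemma outlier_simple k1 k2 (l : R) : zp < l ->
  (ys n)`_k1 @[n --> U] --> l -> (ys n)`_k2 @[n --> U] --> l -> k1 = k2.
Proof.
move=> zl h1 h2; apply/eqP; apply: contraT => k12.
have [ru1 rv1] := negl_singular h1; have [ru2 rv2] := negl_singular h2.
have [ka1 kl1] := overlap_lim (sp_A sp) (lvec1 k1).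
have [la1 ll1] := overlap_lim (sp_B sp) (rvec1 k1).
have [ka2 kl2] := overlap_lim (sp_A sp) (lvec1 k2).
have [la2 ll2] := overlap_lim (sp_B sp) (rvec1 k2).
have [j xj kj] := sing_overlap zl h1 kl1 ll1.
(* the combination whose overlap with the spike [j] vanishes *)
pose c1 := ka2 j 0; pose c2 := - ka1 j 0.
pose u n := c1 *: lvec k1 n + c2 *: lvec k2 n.
pose v n := c1 *: rvec k1 n + c2 *: rvec k2 n.
pose ka := c1 *: ka1 + c2 *: ka2; pose la := c1 *: la1 + c2 *: la2.
have ub : \forall n \near U, nrm (u n) <= `|c1| + `|c2|.
  near=> n; apply: le_trans (nrmD _ _) _; rewrite !nrmZ lerD //.
    by rewrite -[leRHS]mulr1 ler_wpM2l // nrm_lvec.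
  by rewrite -[leRHS]mulr1 ler_wpM2l // nrm_lvec.
have vb : \forall n \near U, nrm (v n) <= `|c1| + `|c2|.
  near=> n; apply: le_trans (nrmD _ _) _; rewrite !nrmZ lerD //.
    by rewrite -[leRHS]mulr1 ler_wpM2l // nrm_rvec.
  by rewrite -[leRHS]mulr1 ler_wpM2l // nrm_rvec.
have ru : negl U (fun n => l *: u n - Y n *m v n).
  rewrite (_ : (fun n => _) = (fun n => c1 *: (l *: lvec k1 n - Y n *m rvec k1 n)
     + c2 *: (l *: lvec k2 n - Y n *m rvec k2 n))).
    by apply: neglD; apply: neglZ.
  apply: functional_extensionality_dep => n.
  by rewrite /u /v mulmxDr -!scalemxAr !scalerBr !scalerDr opprD !scalerA
    ![_ * l]mulrC addrACA.
have rv : negl U (fun n => l *: v n - (Y n)^T *m u n).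
  rewrite (_ : (fun n => _) = (fun n => c1 *: (l *: rvec k1 n - (Y n)^T *m lvec k1 n)
     + c2 *: (l *: rvec k2 n - (Y n)^T *m lvec k2 n))).
    by apply: neglD; apply: neglZ.
  apply: functional_extensionality_dep => n.
  by rewrite /u /v mulmxDr -!scalemxAr !scalerBr !scalerDr opprD !scalerA
    ![_ * l]mulrC addrACA.
have kl i : ((A n)^T *m u n) i 0 @[n --> U] --> ka i 0.
  under eq_fun do rewrite mulmxDr -!scalemxAr mxE_add !scalemxE.
  rewrite mxE_add !scalemxE.
  by apply: cvgD; apply: cvgM; [exact: cvg_cst|exact: kl1|exact: cvg_cst|exact: kl2].
have ll i : ((B n)^T *m v n) i 0 @[n --> U] --> la i 0.
  under eq_fun do rewrite mulmxDr -!scalemxAr mxE_add !scalemxE.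
  rewrite mxE_add !scalemxE.
  by apply: cvgD; apply: cvgM; [exact: cvg_cst|exact: ll1|exact: cvg_cst|exact: ll2].
have [e f nm] := secular zl ub vb ru rv kl ll.
have ka0 : ka = 0.
  apply/colP => i; rewrite [RHS]mxE; have [h|h] := eqVneq (x i ^+ 2 * DD l) 1.
    have DD0 : DD l != 0 by apply/eqP => D0; move: h => /eqP; rewrite D0 mulr0 eq_sym oner_eq0.
    have -> : i = j by apply: x_inj; apply: (mulIf DD0); rewrite h xj.
    by rewrite mxE_add !scalemxE /c1 /c2; ring.
  exact: overlap_support h.
have la0 : la = 0 by apply/colP => i; rewrite f ka0 !mxE !mulr0.
have du : \forall n \near U, dot (u n) (u n) = c1 ^+ 2 + c2 ^+ 2.
  near=> n; have lt1 : (k1 < dp n)%N by near: n.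
  have lt2 : (k2 < dp n)%N by near: n.
  rewrite /u !(dotDl, dotDr, dotZl, dotZr) !lvecE !(svd_orthoU (Y_svd n)) !eqxx.
  have n12 : Ordinal lt1 == Ordinal lt2 = false by apply/negbTE; apply: contra k12 => /eqP [->].
  by rewrite [Ordinal lt2 == _]eq_sym n12 /=; ring.
have := near_cvg du nm; rewrite la0 ka0 mulmx0 dot0l mulr0 !mul0r addr0.
move/eqP; rewrite paddr_eq0 ?sqr_ge0 // !expf_eq0 /= /c2 oppr_eq0 => /andP[_].
by rewrite (negbTE kj).
Unshelve. all: by end_near.
Qed.

(** Every solution of the secular equation attracts a singular value, because
    quasimodes with the corresponding overlaps have a small residual. *)
Lemma outlier_exists j (l d : R) : zp < l -> x j ^+ 2 * DD l = 1 -> 0 < d ->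
  \forall n \near U, exists2 i, (i < dp n)%N & `|(ys n)`_i - l| < d.
Proof.
move=> zl xl d0; have ed := data zl; have lp : 0 < l by exact: lt_trans zl.
have [phiA0 phiB0 gA0 gB0 /andP[hA0 hB0]] := ed_pos ed.
(* the solution of the linear system on the overlaps carried by the spike [j] *)
pose be : 'cV[R]_r := delta_mx j 0; pose a := x j * phiA l.
pose al : 'cV[R]_r := a *: be.
have a0 : 0 < a by rewrite mulr_gt0.
have nbe : nrm be = 1 by rewrite /nrm dot_delta mxE !eqxx sqrtr1.
have dbe : dot be be = 1 by rewrite dot_delta mxE !eqxx.
have Dbe : D *m be = x j *: be.
  apply/colP => i; rewrite diag_mulE scalemxE mxE eqxx andbT.
  by case: eqVneq => [->//|_]; rewrite !mulr0.
have sp' := @spiked_tr _ _ (@ultra_proper _ _ UU) _ _ _ _ _ _ _ _ _ (ltW zp0) sp.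
have [rho1 /andP[r10 r11] res1] := quasimode_res x (ltW zp0) sp be al zl.
have [rho2 /andP[r20 r21] res2] := quasimode_res x (ltW zp0) sp' al be zl.
pose d' := Num.min d l.
have d'0 : 0 < d' by rewrite lt_min d0.
pose G := l ^+ 2 * a ^+ 2 * gB l + hA l.
have G0 : 0 < G by rewrite ltr_wpDr // !mulr_gt0 ?exprn_gt0.
(* [G] is the limit of the squared norm of the right quasimode; a residual small
   with respect to [d'] times its square root contradicts the gap *)
pose e := d' * Num.sqrt G / 8.
have e0 : 0 < e by rewrite divr_gt0 ?mulr_gt0 ?sqrtr_gt0.
have lim1 : `|1 - l * MB (neumann l N) * (x j * a)| + rho1 ^+ N @[N --> \oo] --> (0 : R).
  rewrite -[X in _ --> X](addr0 0); apply: cvgD; last first.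
    by apply: cvg_expr; rewrite ger0_norm.
  have -> : (0 : R) = `|1 - phiB l * (x j * a)|.
    suff -> : phiB l * (x j * a) = 1 by rewrite subrr normr0.
    by rewrite -xl /a /DD; ring.
  apply: cvg_norm; apply: cvgB; first exact: cvg_cst.
  by apply: cvgM; [exact: ed_phiB ed | exact: cvg_cst].
have lim2 : `|a - l * MA (neumann l N) * x j| + rho2 ^+ N * a @[N --> \oo] --> (0 : R).
  rewrite -[X in _ --> X](addr0 0); apply: cvgD; last first.
    rewrite -(mul0r a); apply: cvgM; last exact: cvg_cst.
    by apply: cvg_expr; rewrite ger0_norm.
  have -> : (0 : R) = `|a - phiA l * x j| by rewrite /a mulrC subrr normr0.
  apply: cvg_norm; apply: cvgB; first exact: cvg_cst.
  by apply: cvgM; [exact: ed_phiA ed | exact: cvg_cst].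
have limG : gform MB MA l al be (neumann l N ^+ 2) @[N --> \oo] --> G.
  rewrite /gform /al dotZl dotZr dbe; have -> : G = l ^+ 2 * (a * (a * 1)) * gB l + 1 * hA l.
    by rewrite /G; ring.
  apply: cvgD; apply: cvgM; [exact: cvg_cst|exact: ed_gB ed|exact: cvg_cst|exact: ed_hA ed].
move/cvgrPdist_lt: lim1 => /(_ _ e0) lim1; move/cvgrPdist_lt: lim2 => /(_ _ e0) lim2.
move/cvgrPdist_lt: limG => /(_ (G / 4)); rewrite divr_gt0 // => /(_ isT) limG.
have [N [h1 [h2 h3]]] := filter_ex (filterI lim1 (filterI lim2 limG)).
have : dot (quasimode B A (fun n => (Z n)^T) l al be N n)
      (quasimode B A (fun n => (Z n)^T) l al be N n) @[n --> U] -->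
    gform MB MA l al be (neumann l N ^+ 2) by exact: (quasimode_norm sp').
move/cvgrPdist_lt => /(_ (G / 4)); rewrite divr_gt0 // => /(_ isT) nn.
have {}res1 := res1 N e e0; have {}res2 := res2 N e e0.
near=> n.
have h4 : `|gform MB MA l al be (neumann l N ^+ 2) -
  dot (quasimode B A (fun n => (Z n)^T) l al be N n)
      (quasimode B A (fun n => (Z n)^T) l al be N n)| < G / 4 by near: n.
have R1 : nrm (l *: quasimode A B Z l be al N n -
      Y n *m (pmx (neumann l N) ((Z n)^T *m Z n) *m
              (l *: (B n *m al) + (Z n)^T *m (A n *m be))))
    <= nrm (be - (l * MB (neumann l N)) *: (D *m al)) + rho1 ^+ N * nrm be + e.
  by near: n.
have R2 : nrm (l *: quasimode B A (fun n => (Z n)^T) l al be N n -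
      (B n *m D *m (A n)^T + (Z n)^T) *m
        (pmx (neumann l N) ((Z n)^T^T *m (Z n)^T) *m
              (l *: (A n *m be) + (Z n)^T^T *m (B n *m al))))
    <= nrm (al - (l * MA (neumann l N)) *: (D *m be)) + rho2 ^+ N * nrm al + e.
  by near: n.
apply: contrapT => nex.
have gap (i : 'I_(dp n)) : d' <= `|(ys n)`_i - l|.
  rewrite leNgt; apply/negP; rewrite lt_min => /andP[lt _].
  by apply: nex; exists i.
have := svd_residual (Y_svd n) (quasimode A B Z l be al N n)
  (quasimode B A (fun n => (Z n)^T) l al be N n) (ltW lp) (ltW d'0) gap.
set w1 := quasimode A B _ _ _ _ _ _; set w2 := quasimode B A _ _ _ _ _ _.
have b1 : nrm (l *: w1 - Y n *m w2) <= 2 * e.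
  have : nrm (l *: w1 - Y n *m w2) <=
    nrm (be - (l * MB (neumann l N)) *: (D *m al)) + rho1 ^+ N * nrm be + e.
    by move: R1; rewrite /w2 /quasimode trmxK.
  have -> : be - (l * MB (neumann l N)) *: (D *m al) =
      (1 - l * MB (neumann l N) * (x j * a)) *: be.
    rewrite /al -scalemxAr Dbe !scalerA scalerBl scale1r; congr (_ - _ *: _); ring.
  rewrite nrmZ nbe !mulr1 => /le_trans; apply.
  move: h1; rewrite sub0r normrN ger0_norm ?addr_ge0 ?exprn_ge0 // => h1.
  by rewrite mulrDl mul1r lerD2r; exact: ltW.
have b2 : nrm (l *: w2 - (Y n)^T *m w1) <= 2 * e.
  have : nrm (l *: w2 - (Y n)^T *m w1) <=
    nrm (al - (l * MA (neumann l N)) *: (D *m be)) + rho2 ^+ N * nrm al + e.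
    have YT : (Y n)^T = B n *m D *m (A n)^T + (Z n)^T.
      by rewrite raddfD /= !trmx_mul trmxK tr_diag_mx mulmxA.
    by move: R2; rewrite YT !trmxK.
  rewrite Dbe scalerA /al -scalerBl !nrmZ nbe !mulr1 (gtr0_norm a0).
  move/le_trans; apply.
  move: h2; rewrite sub0r normrN ger0_norm ?addr_ge0 ?(mulr_ge0 _ (ltW a0)) ?exprn_ge0 //.
  by move=> h2; rewrite mulrDl mul1r lerD2r; exact: ltW.
have dw : G / 2 < dot w2 w2.
  exact: dist_quarter h3 h4.
move=> hres; have e2 : e ^+ 2 = d' ^+ 2 * G / 64.
  by rewrite /e !exprMn sqr_sqrtr ?(ltW G0) // exprVn -natrX.
have q1 : nrm (l *: w1 - Y n *m w2) ^+ 2 <= (2 * e) ^+ 2.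
  by rewrite ler_sqr ?nnegrE ?nrm_ge0 // mulr_ge0 // ltW.
have q2 : nrm (l *: w2 - (Y n)^T *m w1) ^+ 2 <= (2 * e) ^+ 2.
  by rewrite ler_sqr ?nnegrE ?nrm_ge0 // mulr_ge0 // ltW.
have := le_trans hres (lerD q1 q2); rewrite exprMn e2.
apply: residual_contra; first by rewrite mulr_gt0 // exprn_gt0.
by rewrite -mulrA ltr_pM2l // exprn_gt0.
Unshelve. all: by end_near.
Qed.

(** The outliers: their number, and the levels they solve the secular equation at. *)
Variables (m : nat) (Yf : 'I_r -> R).
Hypothesis Yf_gt : forall j : 'I_r, (j < m)%N -> zp < Yf j.
Hypothesis Yf_eq : forall j : 'I_r, (j < m)%N -> x j ^+ 2 * DD (Yf j) = 1.
Hypothesis no_sol : forall j : 'I_r, (m <= j)%N -> forall l, zp < l -> x j ^+ 2 * DD l != 1.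
Hypothesis Yf_dec : forall i j : 'I_r, (i < j)%N -> (j < m)%N -> Yf j < Yf i.

(** By induction, the [k]-th solution is approached by a singular value of index
    at least [k]: the singular values near distinct solutions are ordered like
    the solutions. *)
Lemma outlier_rank k (lt : (k < r)%N) (d : R) : (k < m)%N -> 0 < d ->
  \forall n \near U, exists2 i, (k <= i)%N & `|(ys n)`_i - Yf (Ordinal lt)| < d.
Proof.
elim: k lt d => [|k IH] lt d km d0.
  have := outlier_exists (Yf_gt (j := Ordinal lt) km) (Yf_eq (j := Ordinal lt) km) d0.
  by apply: filterS => n [i _ h]; exists i.
have lt' : (k < r)%N by exact: ltnW.
have gp : 0 < (Yf (Ordinal lt') - Yf (Ordinal lt)) / 2.
  by rewrite divr_gt0 // subr_gt0; apply: Yf_dec.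
have h1 := IH lt' _ (ltnW km) gp.
have d1 : 0 < Num.min d ((Yf (Ordinal lt') - Yf (Ordinal lt)) / 2) by rewrite lt_min d0.
have h2 := outlier_exists (Yf_gt (j := Ordinal lt) km) (Yf_eq (j := Ordinal lt) km) d1.
near=> n.
have [i1 k1 d1'] : exists2 i, (k <= i)%N & `|(ys n)`_i - Yf (Ordinal lt')| <
   (Yf (Ordinal lt') - Yf (Ordinal lt)) / 2 by near: n.
have [i2 _ d2'] : exists2 i, (i < dp n)%N & `|(ys n)`_i - Yf (Ordinal lt)| <
   Num.min d ((Yf (Ordinal lt') - Yf (Ordinal lt)) / 2) by near: n.
move: d2'; rewrite lt_min => /andP[d2 d3]; exists i2 => //.
apply: leq_ltn_trans k1 _; rewrite ltnNge; apply/negP => i21.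
have := svd_sorted (Y_svd n) i21.
by move: d1' d3; rewrite !ltr_distl => /andP[? ?] /andP[? ?] ?; lra.
Unshelve. all: by end_near.
Qed.

Lemma outlier_ge k (lt : (k < r)%N) (l : R) : (k < m)%N ->
  (ys n)`_k @[n --> U] --> l -> Yf (Ordinal lt) <= l.
Proof.
move=> km hl; apply/ler_addgt0Pr => d d0; rewrite -lerBlDr.
apply: (cvg_ge_const hl); have h := outlier_rank lt km d0; near=> n.
have [i ki] : exists2 i, (k <= i)%N & `|(ys n)`_i - Yf (Ordinal lt)| < d by near: n.
have := svd_sorted (Y_svd n) ki.
by rewrite ltr_distl => ? /andP[? ?]; lra.
Unshelve. all: by end_near.
Qed.

Lemma sing_lim_ex k : exists l : R, (ys n)`_k @[n --> U] --> l.
Proof. exact: ultra_bounded (ys_bounded k). Qed.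

Lemma above_edge k (l : R) : zp < l -> (ys n)`_k @[n --> U] --> l ->
  exists2 j : 'I_r, (j < m)%N & l = Yf j.
Proof.
move=> zl hl.
have [ka kl] := overlap_lim (sp_A sp) (lvec1 k).
have [la ll] := overlap_lim (sp_B sp) (rvec1 k).
have [j xj _] := sing_overlap zl hl kl ll.
have jm : (j < m)%N.
  by rewrite ltnNge; apply/negP => mj; have := no_sol mj zl; rewrite xj eqxx.
exists j => //; apply: DD_inj => //; first exact: Yf_gt.
have xj0 : x j ^+ 2 != 0 by rewrite expf_neq0 // gt_eqF.
by apply: (mulfI xj0); rewrite xj Yf_eq.
Qed.

(** A limit of [(ys n)`_k] lies above the [k]-th solution and is itself a
    solution; it cannot be an earlier one, which is already taken by a smaller
    index. *)
Lemma outlier_lim k (lt : (k < r)%N) : (k < m)%N ->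
  (ys n)`_k @[n --> U] --> Yf (Ordinal lt).
Proof.
elim/ltn_ind: k lt => k IH lt km; have [l hl] := sing_lim_ex k.
have ge := outlier_ge lt km hl.
have zl : zp < l by apply: lt_le_trans (Yf_gt _) ge.
have [j jm lj] := above_edge zl hl.
have jk : (j <= k)%N.
  rewrite leqNgt; apply/negP => kj.
  by have := Yf_dec (i := Ordinal lt) kj jm; rewrite ltNge -lj ge.
move: jk; rewrite leq_eqVlt => /predU1P[jk|jk].
  by rewrite (_ : Ordinal lt = j) -?lj //; apply: val_inj.
have := IH j jk (ltn_ord j) jm; rewrite (_ : Ordinal (ltn_ord j) = j); last exact: val_inj.
by rewrite -lj => /(outlier_simple zl hl) kj; rewrite kj ltnn in jk.
Qed.

(** A larger limit would be a solution of the secular equation, but each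
    solution is taken by an index smaller than [m]. *)
Lemma bulk_le k (l : R) : (m <= k)%N -> (ys n)`_k @[n --> U] --> l -> l <= zp.
Proof.
move=> mk hl; rewrite leNgt; apply/negP => zl.
have [j jm lj] := above_edge zl hl.
have := @outlier_lim j (ltn_ord j) jm; rewrite (_ : Ordinal (ltn_ord j) = j); last exact: val_inj.
rewrite -lj => /(outlier_simple zl hl) kj; move: jm.
by rewrite -kj ltnNge mk.
Qed.

Lemma signal_dot n (u : 'cV[R]_(dn n)) (v : 'cV[R]_(dp n)) :
  dot u (X n *m v) = dot ((A n)^T *m u) (D *m ((B n)^T *m v)).
Proof. by rewrite /X -!mulmxA dot_mulr. Qed.

Lemma signal_dot_lim (u : forall n, 'cV[R]_(dn n)) (v : forall n, 'cV[R]_(dp n)) (ka la : 'cV[R]_r) :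
  (forall i, ((A n)^T *m u n) i 0 @[n --> U] --> ka i 0) ->
  (forall i, ((B n)^T *m v n) i 0 @[n --> U] --> la i 0) ->
  dot (u n) (X n *m v n) @[n --> U] --> \sum_i ka i 0 * (x i * la i 0).
Proof.
move=> kl ll; under eq_fun do rewrite signal_dot /dot.
apply: cvg_sumf => i _; under eq_fun do rewrite diag_mulE.
by apply: cvgM; [exact: kl|apply: cvgM; [exact: cvg_cst|exact: ll]].
Qed.

(** Only the overlap with the spike [j] survives, and the unit norm of the
    singular vector fixes its square. *)
Lemma outlier_signal (j : 'I_r) (k := nat_of_ord j) (l := Yf j) : (j < m)%N ->
  dot (lvec k n) (X n *m rvec k n) @[n --> U] -->
    phiB l / (l ^+ 2 * x j ^+ 2 * phiB l ^+ 2 * gA l + hB l).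
Proof.
move=> km; have zl : zp < l by exact: Yf_gt.
have hl : (ys n)`_k @[n --> U] --> l.
  by have := @outlier_lim j (ltn_ord j) km; rewrite (_ : Ordinal _ = j) //; exact: val_inj.
have [ka kl] := overlap_lim (sp_A sp) (lvec1 k).
have [la ll] := overlap_lim (sp_B sp) (rvec1 k).
have [ru rv] := negl_singular hl.
have [e f nm] := secular zl (lvec1 k) (rvec1 k) ru rv kl ll.
have [phiA0 phiB0 gA0 gB0 /andP[hA0 hB0]] := ed_pos (data zl).
have ka0 i : i != j -> ka i 0 = 0.
  move=> ij; apply: (overlap_support e f); apply: contra ij => /eqP xi.
  have DD0 : DD l != 0 by apply/eqP => D0; move: xi => /eqP; rewrite D0 mulr0 eq_sym oner_eq0.
  by apply/eqP; apply: x_inj; apply: (mulIf DD0); rewrite xi Yf_eq.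
have la0 i : i != j -> la i 0 = 0 by move=> ij; rewrite f ka0 // !mulr0.
have := near_cvg (dot_sing1 k) nm.
rewrite !dot_col_sum (bigD1 j) //= big1 ?addr0 => [|i ij]; last by rewrite la0 // !mulr0.
rewrite (bigD1 j) //= big1 ?addr0 => [|i ij]; last by rewrite ka0 // !mulr0.
set den := _ + hB l => h1.
have dp0 : 0 < l ^+ 2 * x j ^+ 2 * phiB l ^+ 2 * gA l.
  by rewrite !mulr_gt0 ?exprn_gt0 // (lt_trans zp0).
have den0 : den != 0 by rewrite gt_eqF // ltr_pwDl.
have -> : phiB l / den = \sum_i ka i 0 * (x i * la i 0).
  rewrite (bigD1 j) //= big1 ?addr0 => [|i ij]; last by rewrite ka0 // mul0r.
  apply: (mulIf den0); rewrite divfK // -[LHS]mulr1 h1 f /den; ring.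
exact: signal_dot_lim.
Qed.

(** At the edge the overlaps vanish when the inverse square of the distance to
    the edge is not integrable: they would give the singular vector an infinite
    norm. *)
Lemma edge_signal k : (ys n)`_k @[n --> U] --> zp ->
  (exists2 L : R, L != 0 & (forall K, exists M, K <= MA (edgep zp L M.*2)) /\
     forall M, 0 <= MB ('X * edgep zp L M.*2)) ->
  dot (lvec k n) (X n *m rvec k n) @[n --> U] --> (0 : R).
Proof.
move=> hl [L L0 [big nneg]].
have [ka kl] := overlap_lim (sp_A sp) (lvec1 k).
have [la ll] := overlap_lim (sp_B sp) (rvec1 k).
have [ru rv] := negl_singular hl.
pose q := zp ^+ 2 * dot (D *m la) (D *m la).
have q0 : q = 0.
  apply/eqP; rewrite eq_le mulr_ge0 ?sqr_ge0 ?dot_ge0 // andbT.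
  apply: contrapT => /negP; rewrite -ltNge => qp.
  (* with [q] times this spectral mean at least 2, a unit vector is impossible *)
  have [M hM] := big (2 / q).
  have := edge_bound (ltW zp0) sp (lvec1 k) ru rv kl ll M L0; move/(_ (@ultra_proper _ _ UU)).
  rewrite /gform -/q expr1n => hb.
  have : q * MA (edgep zp L M.*2) <= 1.
    by apply: le_trans hb; rewrite lerDl mulr_ge0 ?dot_ge0.
  rewrite leNgt => /negP; apply; apply: lt_le_trans (_ : q * (2 / q) <= _).
    by rewrite mulrCA divff ?mulr1 ?gt_eqF // ltr1n.
  by rewrite ler_pM2l.
have Dla : D *m la = 0.
  apply: dot_eq0; apply/eqP; move/eqP: q0; rewrite mulf_eq0 expf_eq0 /=.
  by rewrite gt_eqF.
have -> : (0 : R) = \sum_i ka i 0 * (x i * la i 0).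
  by rewrite big1 // => i _; rewrite -diag_mulE -/D Dla mxE mulr0.
exact: signal_dot_lim.
Qed.

End SpikedSvd.

(** * Expectations of bounded functions and measurable matrices *)

Section BoundedExpectation.
Context {R : realType} (d : measure_display) (T : measurableType d)
  (Q : probability T R) (D : set T).
Hypothesis (mD : measurable D) (QD : Q D = 1%E).

(** The functions for which expectations over [D] behave linearly without any
    further integrability condition. *)
Definition nice (f : T -> R) :=
  measurable_fun setT f /\ exists C, forall c, D c -> `|f c| <= C.

Definition Ex (f : T -> R) : R := \int[Q]_(c in D) f c.

Lemma nice_cst k : nice (fun _ => k).
Proof. by split; [exact: measurable_cst | exists `|k|]. Qed.

Lemma niceD f g : nice f -> nice g -> nice (fun c => f c + g c).
Proof.
move=> [mf [C hC]] [mg [C' hC']]; split; first exact: measurable_funD.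
by exists (C + C') => c Dc; apply: le_trans (ler_normD _ _) (lerD (hC _ Dc) (hC' _ Dc)).
Qed.

Lemma niceM f g : nice f -> nice g -> nice (fun c => f c * g c).
Proof.
move=> [mf [C hC]] [mg [C' hC']]; split; first exact: measurable_funM.
by exists (C * C') => c Dc; rewrite normrM ler_pM // ?hC ?hC'.
Qed.

Lemma niceN f : nice f -> nice (fun c => - f c).
Proof.
move=> [mf [C hC]]; split; first exact: measurable_funN.
by exists C => c Dc; rewrite normrN hC.
Qed.

Lemma niceB f g : nice f -> nice g -> nice (fun c => f c - g c).
Proof. by move=> hf hg; apply: niceD => //; apply: niceN. Qed.

Lemma niceX f k : nice f -> nice (fun c => f c ^+ k).
Proof.
move=> hf; elim: k => [|k IH]; first by under eq_fun do rewrite expr0; exact: nice_cst.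
by under eq_fun do rewrite exprS; apply: niceM.
Qed.

Lemma nice_sum (I : Type) (s : seq I) (P : pred I) (f : I -> T -> R) :
  (forall i, nice (f i)) -> nice (fun c => \sum_(i <- s | P i) f i c).
Proof.
move=> hf; elim: s => [|i s IH]; first by under eq_fun do rewrite big_nil; exact: nice_cst.
under eq_fun do rewrite big_cons; case: (P i) => //.
exact: niceD.
Qed.

Lemma nice_int f : nice f -> Q.-integrable D (EFin \o f).
Proof.
move=> [mf [C hC]]; apply: measurable_bounded_integrable => //.
- exact: le_lt_trans (probability_le1 _ mD) (ltry 1).
- exact: measurable_funS mf.
- exists `|C|; split; first by rewrite num_real.
  move=> M CM c Dc; apply: le_trans (hC _ Dc) _.
  by apply: le_trans (ler_norm _) (ltW CM).
Qed.

Lemma ExD f g : nice f -> nice g -> Ex (fun c => f c + g c) = Ex f + Ex g.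
Proof. by move=> hf hg; rewrite /Ex RintegralD //; apply: nice_int. Qed.

Lemma ExZ k f : nice f -> Ex (fun c => k * f c) = k * Ex f.
Proof. by move=> hf; rewrite /Ex RintegralZl //; apply: nice_int. Qed.

Lemma Ex_cst k : Ex (fun=> k) = k.
Proof.
rewrite /Ex Rintegral_cst // -[RHS]mulr1; congr (_ * _).
by rewrite -[RHS]/(fine (1%E : \bar R)); congr fine; exact: QD.
Qed.

Lemma ExN f : nice f -> Ex (fun c => - f c) = - Ex f.
Proof.
by move=> hf; rewrite -mulN1r -ExZ //; congr Ex; apply/funext => c; rewrite mulN1r.
Qed.

Lemma ExB f g : nice f -> nice g -> Ex (fun c => f c - g c) = Ex f - Ex g.
Proof. by move=> hf hg; rewrite ExD ?ExN //; apply: niceN. Qed.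

Lemma Ex_sum (I : Type) (s : seq I) (f : I -> T -> R) :
  (forall i, nice (f i)) -> Ex (fun c => \sum_(i <- s) f i c) = \sum_(i <- s) Ex (f i).
Proof.
move=> hf; elim: s => [|i s IH].
  by rewrite big_nil -[RHS](Ex_cst 0); congr Ex; apply/funext => c; rewrite big_nil.
rewrite big_cons -IH -ExD //; last exact: nice_sum.
by congr Ex; apply/funext => c; rewrite big_cons.
Qed.

Lemma Ex_le f g : nice f -> nice g -> (forall c, D c -> f c <= g c) -> Ex f <= Ex g.
Proof. by move=> hf hg fg; apply: le_Rintegral => //; apply: nice_int. Qed.

Lemma Ex_eq f g : (forall c, D c -> f c = g c) -> Ex f = Ex g.
Proof. by move=> fg; apply: eq_Rintegral => c; rewrite inE => /fg. Qed.

Lemma Ex_abs_le f C : nice f -> (forall c, D c -> `|f c| <= C) -> `|Ex f| <= C.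
Proof.
move=> hf h; rewrite ler_norml -(Ex_cst C) -(Ex_cst (- Ex (fun=> C))).
apply/andP; split; apply: Ex_le => //; try exact: nice_cst.
  by move=> c Dc; rewrite Ex_cst; move: (h _ Dc); rewrite ler_norml => /andP[].
by move=> c Dc; move: (h _ Dc); rewrite ler_norml => /andP[].
Qed.

Lemma Ex_markov f (e : R) : nice f -> (forall c, D c -> 0 <= f c) -> 0 < e ->
  (Q (D `&` [set c | (e <= f c)%R]) <= (Ex f / e)%:E)%E.
Proof.
move=> hf f0 e0; have mf : measurable_fun D f by apply: measurable_funS hf.1.
set S := D `&` _.
have mS : measurable S.
  by apply: measurable_fun_ler => //; exact: measurable_cst.
have hS : nice (fun c => \1_S c).
  split; first exact: measurable_indic.
  by exists 1 => c _; rewrite indicE; case: (c \in S); rewrite ?normr1 ?normr0.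
have -> : Q S = (Ex (fun c => \1_S c))%:E.
  rewrite /Ex /Rintegral integral_indic // setIC /S setIA setIid.
  rewrite fineK // ge0_fin_numE //; apply: le_lt_trans (ltry 1).
  exact: probability_le1.
rewrite lee_fin ler_pdivlMr // mulrC -ExZ //; apply: Ex_le => //.
  by apply: niceM => //; exact: nice_cst.
move=> c Dc; rewrite indicE; case: (boolP (c \in S)) => [|_]; last by rewrite mulr0 f0.
by rewrite inE => -[_ /=]; rewrite mulr1.
Qed.

End BoundedExpectation.

Section MeasurableMatrices.
Context {R : realType} {d : measure_display} {T : measurableType d}.

(** Closed under the matrix operations entry by entry, unlike measurability for
    the generated sigma-algebra, to which it is equivalent. *)
Definition mxm m n (F : T -> 'M[R]_(m, n)) :=
  forall i j, measurable_fun setT (fun t => F t i j).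

Lemma mxm_cst m n (M : 'M[R]_(m, n)) : mxm (fun=> M).
Proof. by move=> i j; exact: measurable_cst. Qed.

Lemma mxmZ m n (f : T -> R) (F : T -> 'M[R]_(m, n)) :
  measurable_fun setT f -> mxm F -> mxm (fun t => f t *: F t).
Proof.
by move=> hf hF i j; under eq_fun do rewrite mxE; apply: measurable_funM.
Qed.

Lemma mxm_mul m n p (F : T -> 'M[R]_(m, n)) (G : T -> 'M[R]_(n, p)) :
  mxm F -> mxm G -> mxm (fun t => F t *m G t).
Proof.
move=> hF hG i j; under eq_fun do rewrite mxE.
by apply: measurable_sum => k; apply: measurable_funM.
Qed.

Lemma mxm_tr m n (F : T -> 'M[R]_(m, n)) : mxm F -> mxm (fun t => (F t)^T).
Proof. by move=> hF i j; under eq_fun do rewrite mxE; exact: hF. Qed.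

Lemma mxmX n (F : T -> 'M[R]_n) k : mxm F -> mxm (fun t => F t ^+ k).
Proof.
move=> hF; elim: k => [|k IH]; first exact: mxm_cst.
have -> : (fun t => F t ^+ k.+1) = (fun t => F t *m F t ^+ k).
  by apply/funext => t; rewrite exprS.
exact: mxm_mul.
Qed.

Lemma mxm_sum m n (I : Type) (s : seq I) (F : I -> T -> 'M[R]_(m, n)) :
  (forall i, mxm (F i)) -> mxm (fun t => \sum_(i <- s) F i t).
Proof.
move=> hF i j; under eq_fun do rewrite summxE.
by apply: measurable_sum => k; exact: hF.
Qed.

Lemma mxm_pmx n (F : T -> 'M[R]_n) P : mxm F -> mxm (fun t => pmx P (F t)).
Proof.
move=> hF; apply: mxm_sum => i; apply: mxmZ; first exact: measurable_cst.
exact: mxmX.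
Qed.

Lemma mxm_trace n (F : T -> 'M[R]_n) : mxm F -> measurable_fun setT (fun t => \tr (F t)).
Proof. by move=> hF; apply: measurable_sum => i; exact: hF. Qed.

Lemma mxm_random m n (F : T -> 'M[R]_(m, n)) : mxm F -> random_mx F.
Proof.
move=> hF; rewrite /random_mx.
apply: (@measurability _ _ T (mxBorel m n) setT F (@mx_coord_events R m n)) => //.
move=> _ [_ [ij _ [S mS <-]] <-].
by rewrite !setTI; have := hF ij.1 ij.2 measurableT S mS; rewrite setTI.
Qed.

End MeasurableMatrices.

Lemma mxm_id (R : realType) m n : mxm (fun M : mxBorel m n => M : 'M[R]_(m, n)).
Proof.
move=> i j _ S mS; rewrite setTI; apply: sub_sigma_algebra.
by exists (i, j) => //; exists S => //; rewrite setTI.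
Qed.

Lemma random_mxm (R : realType) (d : measure_display) (T : measurableType d) m n
  (F : T -> 'M[R]_(m, n)) : random_mx F -> mxm F.
Proof.
move=> hF i j; exact: (measurableT_comp (mxm_id (R := R) (m := m) (n := n) i j) hF).
Qed.

(** * Concentration of quadratic forms on the sphere *)

Lemma sum_pick (R : realType) n (j : 'I_n) (F : 'I_n -> R) :
  \sum_i (i == j)%:R * F i = F j.
Proof.
rewrite (bigD1 j) //= big1 => [|i ij]; last by rewrite (negbTE ij) mul0r.
by rewrite eqxx mul1r addr0.
Qed.

Section Rotations.
Context {R : realType} (n : nat).

(** The rotation of the plane of the coordinates [j] and [k] by the angle 2
    arctan t, a rational parametrisation which keeps all bounds elementary. *)
Definition rot (j k : 'I_n) (t : R) : 'M[R]_n :=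
  1%:M + (- (2 * t ^+ 2 / (1 + t ^+ 2))) *: (delta_mx j j + delta_mx k k)
       + (2 * t / (1 + t ^+ 2)) *: (delta_mx j k - delta_mx k j).

Lemma delta_mulE (j k : 'I_n) (c : 'cV[R]_n) i :
  (delta_mx j k *m c) i 0 = (i == j)%:R * c k 0.
Proof.
rewrite mxE (bigD1 k) //= big1 ?addr0 => [|l lk]; last first.
  by rewrite mxE (negbTE lk) andbF mul0r.
by rewrite mxE eqxx andbT.
Qed.

Lemma rotE j k t (c : 'cV[R]_n) i :
  (rot j k t *m c) i 0 = c i 0
    - 2 * t ^+ 2 / (1 + t ^+ 2) * ((i == j)%:R * c j 0 + (i == k)%:R * c k 0)
    + 2 * t / (1 + t ^+ 2) * ((i == j)%:R * c k 0 - (i == k)%:R * c j 0).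
Proof.
rewrite /rot !mulmxDl mul1mx -!scalemxAl !mulmxDl mulNmx.
by rewrite !(mxE_add, scalemxE, mxE_opp) !delta_mulE mulNr.
Qed.

Lemma rot_orth j k t : j != k -> (rot j k t)^T *m rot j k t = 1%:M.
Proof.
move=> jk.
have [c [s [hc hs cs]]] : exists c s : R, [/\ c = 2 * t ^+ 2 / (1 + t ^+ 2),
    s = 2 * t / (1 + t ^+ 2) & c ^+ 2 + s ^+ 2 = 2 * c].
  exists (2 * t ^+ 2 / (1 + t ^+ 2)), (2 * t / (1 + t ^+ 2)); split=> //.
  by field; rewrite gt_eqF // ltr_pwDl // sqr_ge0.
rewrite /rot -hc -hs.
pose p : 'M[R]_n := delta_mx j j + delta_mx k k.
pose q : 'M[R]_n := delta_mx j k - delta_mx k j.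
have kj : k != j by rewrite eq_sym.
have pT : p^T = p by rewrite /p linearD /= !trmx_delta.
have qT : q^T = - q by rewrite /q linearB /= !trmx_delta opprB.
have pp : p *m p = p.
  rewrite /p !(mulmxDl, mulmxDr) !mul_delta_mx_cond (negbTE jk) (negbTE kj) !eqxx.
  by rewrite !mulr0n !mulr1n addr0 add0r.
have pq : p *m q = q.
  rewrite /p /q !(mulmxDl, mulmxDr) !mulmxN !mul_delta_mx_cond (negbTE jk) (negbTE kj) !eqxx.
  by rewrite !mulr0n !mulr1n oppr0 addr0 add0r.
have qp : q *m p = q.
  rewrite /p /q !(mulmxDl, mulmxDr) !mulNmx !mul_delta_mx_cond (negbTE jk) (negbTE kj) !eqxx.
  by rewrite !mulr0n !mulr1n subr0 sub0r addrC.
have qq : q *m q = - p.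
  rewrite /p /q !(mulmxDl, mulmxDr) !(mulmxN, mulNmx) !mul_delta_mx_cond.
  rewrite (negbTE jk) (negbTE kj) !eqxx !mulr0n !mulr1n !oppr0 !addr0 !add0r.
  by rewrite opprD.
rewrite (_ : delta_mx j j + delta_mx k k = p) // (_ : delta_mx j k - delta_mx k j = q) //.
have -> : (1%:M + - c *: p + s *: q)^T = 1%:M + - c *: p + s *: - q.
  by rewrite linearD /= linearD /= !linearZ /= pT qT trmx1.
rewrite !(mulmxDl, mulmxDr) !mul1mx !mulmx1 -!scalemxAl -!scalemxAr !mulNmx.
rewrite pp pq qp qq; apply/matrixP => a b; rewrite !(mxE_add, scalemxE, mxE_opp).
move: (delta_mx j j a b) (delta_mx k k a b) (delta_mx j k a b) (delta_mx k j a b).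
move=> d1 d2 d3 d4; apply/eqP; rewrite -subr_eq0; apply/eqP.
transitivity ((c ^+ 2 + s ^+ 2 - 2 * c) * (d1 + d2)); first by ring.
by rewrite cs subrr mul0r.
Qed.

End Rotations.

(** The elimination that ends the fourth moment bound: the integration by parts
    formula bounds the moment by a mixed term, which Young's inequality absorbs. *)
Lemma quad_moment_arith (R : realType) (nn a b e t1 t2 : R) : 0 < nn -> 0 <= a ->
  (nn + 6) * a = 6 * b -> b <= 3 / nn * e + nn / 12 * a -> e <= 8 * t1 + 8 * t2 ->
  a * nn ^+ 2 <= 288 * (t1 + t2).
Proof.
move=> n0 a0 st le1 le2.
have h : nn * (6 * b) <= 18 * e + nn ^+ 2 / 2 * a.
  apply: le_trans (ler_wpM2l (ltW n0) (ler_wpM2l _ le1)) _ => //.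
  by rewrite le_eqVlt; apply/orP; left; apply/eqP; field; rewrite gt_eqF.
rewrite -st in h.
have e1 : nn * ((nn + 6) * a) = nn ^+ 2 * a + nn * (6 * a) by ring.
have h1 : 0 <= nn * (6 * a) by rewrite !mulr_ge0 // ltW.
by move: h; rewrite e1; move: h1; rewrite [a * _]mulrC; lra.
Qed.

Section Sphere.
Context {R : realType} (n : nat) (Q : probability (@mxBorel R n 1) R).
Definition sphere : set (@mxBorel R n 1) :=
  [set c | dot (c : 'cV[R]_n) c = 1].
Hypothesis Q_sphere : Q sphere = 1%E.
Hypothesis Q_inv : forall O : 'M[R]_n, O^T *m O = 1%:M ->
  forall E : set (@mxBorel R n 1), measurable E -> Q [set c | E (O *m (c : 'cV_n))] = Q E.

Lemma measurable_sphere : measurable sphere.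
Proof.
rewrite (_ : sphere = (fun c : @mxBorel R n 1 => dot (c : 'cV[R]_n) c) @^-1` [set 1]) //.
rewrite -[X in measurable X]setTI.
apply: (_ : measurable_fun setT _) => //.
by apply: measurable_sum => i; apply: measurable_funM; exact: mxm_id.
Qed.
Let mS := measurable_sphere.
Notation E := (Ex Q sphere).
Notation nice := (nice sphere).

Lemma nice_coord i : nice (fun c => (c : 'cV[R]_n) i 0).
Proof.
split; first exact: mxm_id.
exists 1 => c Sc; apply: le_trans (abs_coord_nrm _ _) _.
by rewrite /nrm Sc sqrtr1.
Qed.

Lemma Ex_orth (O : 'M[R]_n) (f : @mxBorel R n 1 -> R) : O^T *m O = 1%:M ->
  nice f -> E (fun c => f (O *m (c : 'cV_n))) = E f.
Proof.
move=> hO hf; rewrite /Ex /Rintegral; congr fine.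
pose phi (c : @mxBorel R n 1) : @mxBorel R n 1 := O *m (c : 'cV_n).
have mphi : measurable_fun setT phi.
  by apply: (@mxm_random R _ (@mxBorel R n 1) n 1); apply: mxm_mul;
    [exact: mxm_cst|exact: mxm_id].
have Sphi : phi @^-1` sphere = sphere.
  by apply/seteqP; split=> c; rewrite /sphere /= /phi dot_mull mulmxA hO mul1mx.
have int := nice_int Q mS hf.
have mf : measurable_fun setT (EFin \o f) by apply/measurable_EFinP; exact: hf.1.
transitivity (\int[pushforward Q phi]_(c in sphere) (EFin \o f) c)%E; last first.
  apply: eq_measure_integral => A mA _.
  exact: (Q_inv hO mA).
rewrite (@integral_pushforward _ _ _ _ _ phi mphi Q sphere (EFin \o f) mf) //.
  by rewrite Sphi.
rewrite Sphi.
have hf' : nice (fun c => f (phi c)).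
  split; first exact: (measurableT_comp hf.1 mphi).
  have [_ [C hC]] := hf; exists C => c Sc; apply: hC.
  by rewrite -[sphere _]/((phi @^-1` sphere) c) Sphi.
exact: (nice_int Q mS hf').
Qed.

(** [g] is the derivative of [f] along the rotations of the plane [(j, k)]; the
    bound is quadratic and uniform over the sphere, so that it survives
    integration. *)
Definition gen j k (f g : @mxBorel R n 1 -> R) :=
  [/\ nice f, nice g & exists C, forall c t, sphere c -> 0 <= t <= 1 ->
    `|f (rot j k t *m (c : 'cV_n)) - f c - 2 * t * g c| <= C * t ^+ 2].

(** The expectation of [f] is constant along the rotations, and differentiating
    it at angle 0 gives the expectation of [g]. *)
Lemma gen_Ex0 j k f g : j != k -> gen j k f g -> E g = 0.
Proof.
move=> jk [nf ng [C hC]].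
have key t : 0 < t <= 1 -> `|E g| <= C / 2 * t.
  move=> /andP[t0 t1]; have O := rot_orth t jk.
  have nfO : nice (fun c => f (rot j k t *m (c : 'cV_n))).
    split.
      apply: (measurableT_comp nf.1); apply: (@mxm_random R _ (@mxBorel R n 1) n 1).
      by apply: mxm_mul; [exact: mxm_cst|exact: mxm_id].
    have [_ [K hK]] := nf; exists K => c Sc; apply: hK.
    by rewrite /sphere /= dot_mull mulmxA O mul1mx.
  have n1 : nice (fun c => f (rot j k t *m (c : 'cV_n)) - f c) by apply: niceB.
  have n2 : nice (fun c => 2 * t * g c) by apply: niceM => //; exact: nice_cst.
  have h : `|E (fun c => f (rot j k t *m (c : 'cV_n)) - f c - 2 * t * g c)| <= C * t ^+ 2.
    apply: Ex_abs_le => //; first exact: niceB.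
    by move=> c Sc; apply: hC => //; rewrite (ltW t0).
  rewrite !ExB // ExZ // Ex_orth // subrr sub0r normrN normrM gtr0_norm ?mulr_gt0 // in h.
  by rewrite -(ler_pM2l (_ : 0 < 2 * t)) ?mulr_gt0 //; apply: le_trans h _; rewrite le_eqVlt;
     apply/orP; left; apply/eqP; field.
apply/eqP; rewrite -normr_eq0 eq_le normr_ge0 andbT.
apply/ler_addgt0Pr => e e0; rewrite add0r.
(* a rotation small enough for the quadratic error to be below [e] *)
pose t := Num.min 1 (e / (`|C| + 1)).
have C1 : 0 < `|C| + 1 by rewrite ltr_wpDl.
have t0 : 0 < t by rewrite lt_min ltr01 divr_gt0.
have t1 : t <= 1 by rewrite ge_min lexx.
have := key t; rewrite t0 t1 => /(_ isT) /le_trans; apply.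
have t2 : t <= e / (`|C| + 1) by rewrite ge_min lexx orbT.
have tt : t * (`|C| + 1) <= e by rewrite -ler_pdivlMr.
have := ler_norm C; move: t0 tt e0; clear; move: (`|C|) => c t0 tt e0 Cc.
have : C * t <= c * t by rewrite ler_wpM2r // ltW.
lra.
Qed.

Lemma gen_coord j k l : j != k -> gen j k (fun c => (c : 'cV[R]_n) l 0)
  (fun c => (l == j)%:R * (c : 'cV[R]_n) k 0 - (l == k)%:R * (c : 'cV[R]_n) j 0).
Proof.
move=> jk; split; first exact: nice_coord.
  by apply: niceB; apply: niceM; first [exact: nice_cst|exact: nice_coord].
exists 8 => c t Sc /andP[t0 t1]; rewrite rotE.
set p := _ + (l == k)%:R * _; set q := _ - (l == k)%:R * _.
have cb i : `|(c : 'cV[R]_n) i 0| <= 1.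
  by apply: le_trans (abs_coord_nrm _ _) _; rewrite /nrm Sc sqrtr1.
have bb (b : bool) (y : R) : `|y| <= 1 -> `|b%:R * y| <= 1.
  by case: b; rewrite ?mul1r ?mul0r ?normr0.
have pb : `|p| <= 2.
  by apply: le_trans (ler_normD _ _) _; rewrite (_ : 2 = 1 + 1) // lerD // bb.
have qb : `|q| <= 2.
  by apply: le_trans (ler_normB _ _) _; rewrite (_ : 2 = 1 + 1) // lerD // bb.
have u0 : 0 < 1 + t ^+ 2 by rewrite ltr_pwDl // sqr_ge0.
have -> : (c : 'cV[R]_n) l 0 - 2 * t ^+ 2 / (1 + t ^+ 2) * p + 2 * t / (1 + t ^+ 2) * q
    - (c : 'cV[R]_n) l 0 - 2 * t * q = - (2 * t ^+ 2 / (1 + t ^+ 2) * (p + t * q)).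
  by field; rewrite gt_eqF.
have tq : `|p + t * q| <= 4.
  apply: le_trans (ler_normD _ _) _; rewrite (_ : 4 = 2 + 2); last by ring.
  apply: lerD => //; rewrite normrM ger0_norm //.
  by apply: le_trans qb; rewrite ler_piMl.
rewrite normrN normrM ger0_norm; last by rewrite divr_ge0 ?mulr_ge0 ?sqr_ge0 ?(ltW u0).
have : 2 * t ^+ 2 / (1 + t ^+ 2) <= 2 * t ^+ 2.
  by rewrite ler_pdivrMr // ler_peMr ?mulr_ge0 ?sqr_ge0 // lerDl sqr_ge0.
move=> h; apply: le_trans (ler_pM _ _ h tq) _; rewrite ?divr_ge0 ?mulr_ge0 ?sqr_ge0 ?(ltW u0) //.
by rewrite le_eqVlt; apply/orP; left; apply/eqP; ring.
Qed.

Lemma gen_cst j k a : gen j k (fun=> a) (fun=> 0).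
Proof.
split; try exact: nice_cst.
by exists 0 => c t _ _; rewrite subrr mulr0 subr0 normr0 mul0r.
Qed.

Lemma genD j k f g f' g' : gen j k f g -> gen j k f' g' ->
  gen j k (fun c => f c + f' c) (fun c => g c + g' c).
Proof.
move=> [nf ng [C hC]] [nf' ng' [C' hC']]; split; try exact: niceD.
exists (C + C') => c t Sc ht; rewrite [leRHS]mulrDl.
apply: le_trans (lerD (hC _ _ Sc ht) (hC' _ _ Sc ht)).
apply: le_trans (ler_normD _ _); rewrite le_eqVlt; apply/orP; left; apply/eqP.
congr (`|_|); ring.
Qed.

Lemma genM j k f g f' g' : gen j k f g -> gen j k f' g' ->
  gen j k (fun c => f c * f' c) (fun c => g c * f' c + f c * g' c).
Proof.
move=> [nf ng [C hC]] [nf' ng' [C' hC']]; split; first exact: niceM.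
  by apply: niceD; apply: niceM.
have [_ [F hF]] := nf; have [_ [G hG]] := ng.
have [_ [F' hF']] := nf'; have [_ [G' hG']] := ng'.
exists (4 * (G * G') + C * (F' + 2 * G' + `|C'|) + (F + 2 * G) * C') => c t Sc ht.
have /andP[t0 t1] := ht.
pose r := f (rot j k t *m (c : 'cV_n)) - f c - 2 * t * g c.
pose r' := f' (rot j k t *m (c : 'cV_n)) - f' c - 2 * t * g' c.
have hr : `|r| <= C * t ^+ 2 by exact: hC.
have hr' : `|r'| <= C' * t ^+ 2 by exact: hC'.
have e1 : f (rot j k t *m (c : 'cV_n)) = f c + 2 * t * g c + r by rewrite /r; ring.
have e2 : f' (rot j k t *m (c : 'cV_n)) = f' c + 2 * t * g' c + r' by rewrite /r'; ring.
rewrite e1 e2; clearbody r r'.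
have -> : (f c + 2 * t * g c + r) * (f' c + 2 * t * g' c + r') - f c * f' c
   - 2 * t * (g c * f' c + f c * g' c) = t ^+ 2 * (4 * (g c * g' c))
   + r * (f' c + 2 * t * g' c + r') + (f c + 2 * t * g c) * r' by ring.
have C0' : 0 <= C' * t ^+ 2 by apply: le_trans hr'.
have C0 : 0 <= C * t ^+ 2 by apply: le_trans hr.
have tt : t ^+ 2 <= 1 by rewrite expr_le1.
have b1 : `|t ^+ 2 * (4 * (g c * g' c))| <= t ^+ 2 * (4 * (G * G')).
  rewrite normrM (ger0_norm (sqr_ge0 _)) ler_wpM2l ?sqr_ge0 // normrM ger0_norm //.
  by rewrite ler_wpM2l // normrM ler_pM // ?hG ?hG'.
have b2 : `|f c + 2 * t * g c| <= F + 2 * G.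
  apply: le_trans (ler_normD _ _) _; apply: lerD; first exact: hF.
  rewrite normrM ger0_norm ?mulr_ge0 // ler_pM ?mulr_ge0 ?hG //.
  by rewrite -[leRHS]mulr1 ler_wpM2l.
have b3 : `|f' c + 2 * t * g' c + r'| <= F' + 2 * G' + `|C'|.
  apply: le_trans (ler_normD _ _) _; apply: lerD; last first.
    apply: le_trans hr' _; apply: le_trans (ler_wpM2r (sqr_ge0 t) (ler_norm C')) _.
    by rewrite -[leRHS]mulr1 ler_wpM2l.
  apply: le_trans (ler_normD _ _) _; apply: lerD; first exact: hF'.
  rewrite normrM ger0_norm ?mulr_ge0 // ler_pM ?mulr_ge0 ?hG' //.
  by rewrite -[leRHS]mulr1 ler_wpM2l.
apply: le_trans (ler_normD _ _) _; rewrite [leRHS]mulrDl; apply: lerD; last first.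
  by rewrite -[leRHS]mulrA normrM ler_pM.
apply: le_trans (ler_normD _ _) _; rewrite [leRHS]mulrDl; apply: lerD.
  by rewrite [leRHS]mulrC.
by rewrite [leRHS]mulrAC normrM ler_pM.
Qed.

Lemma gen_sum j k (I : Type) (s : seq I) (f g : I -> mxBorel n 1 -> R) :
  (forall i, gen j k (f i) (g i)) ->
  gen j k (fun c => \sum_(i <- s) f i c) (fun c => \sum_(i <- s) g i c).
Proof.
move=> h; elim: s => [|i s IH].
  by under eq_fun do rewrite big_nil; under [X in gen _ _ _ X]eq_fun do rewrite big_nil;
     exact: gen_cst.
under eq_fun do rewrite big_cons; under [X in gen _ _ _ X]eq_fun do rewrite big_cons.
exact: genD.
Qed.

Lemma gen_eq j k f g f' g' : gen j k f g -> f =1 f' -> g =1 g' -> gen j k f' g'.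
Proof. by move=> h /funext <- /funext <-. Qed.

Lemma genX j k f g m : gen j k f g ->
  gen j k (fun c => f c ^+ m) (fun c => m%:R * f c ^+ m.-1 * g c).
Proof.
move=> h; elim: m => [|m IH].
  apply: gen_eq (gen_cst j k 1) _ _ => c; first by rewrite expr0.
  by rewrite !mul0r.
apply: gen_eq (genM h IH) _ _ => c; first by rewrite exprS.
by case: m {IH} => [|m]; rewrite /= ?expr0 ?exprS -?natr1; ring.
Qed.

Section Quadratic.
Variable N : 'M[R]_n.
Hypothesis Nsym : N^T = N.
Implicit Type c : @mxBorel R n 1.

Let Nc c i : R := \sum_l N i l * (c : 'cV[R]_n) l 0.
Let q c : R := \sum_l (c : 'cV[R]_n) l 0 * Nc c l.

Lemma NcE c i : Nc c i = (N *m (c : 'cV_n)) i 0.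
Proof. by rewrite mxE. Qed.

Lemma quadE c : q c = dot (c : 'cV_n) (N *m (c : 'cV_n)).
Proof. by apply: eq_bigr => i _; rewrite NcE. Qed.

Lemma gen_Nc j k i : j != k -> gen j k (Nc^~ i)
  (fun c => N i j * (c : 'cV[R]_n) k 0 - N i k * (c : 'cV[R]_n) j 0).
Proof.
move=> jk.
apply: gen_eq (gen_sum (index_enum 'I_n)
  (fun l => genM (gen_cst j k (N i l)) (gen_coord l jk))) _ _ => c //.
under eq_bigr => l _.
  rewrite (_ : _ + _ = (l == j)%:R * (N i l * (c : 'cV[R]_n) k 0)
    - (l == k)%:R * (N i l * (c : 'cV[R]_n) j 0)); last by ring.
  over.
by rewrite sumrB !sum_pick.
Qed.

Lemma gen_quad j k : j != k -> gen j k q (fun c => 2 * ((c : 'cV[R]_n) k 0 * Nc c j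
   - (c : 'cV[R]_n) j 0 * Nc c k)).
Proof.
move=> jk.
apply: gen_eq (gen_sum (index_enum 'I_n)
  (fun l => genM (gen_coord l jk) (gen_Nc l jk))) _ _ => c //.
have sy a b : N a b = N b a by rewrite -[in LHS]Nsym mxE.
rewrite big_split /=.
have -> : \sum_(i < n) ((i == j)%:R * (c : 'cV[R]_n) k 0 - (i == k)%:R * (c : 'cV[R]_n) j 0)
     * Nc c i = (c : 'cV[R]_n) k 0 * Nc c j - (c : 'cV[R]_n) j 0 * Nc c k.
  by under eq_bigr do rewrite mulrBl -!mulrA; rewrite sumrB !sum_pick.
have -> : \sum_(i < n) (c : 'cV[R]_n) i 0 * (N i j * (c : 'cV[R]_n) k 0 - N i k * (c : 'cV[R]_n) j 0)
   = (c : 'cV[R]_n) k 0 * Nc c j - (c : 'cV[R]_n) j 0 * Nc c k.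
  rewrite /Nc !mulr_sumr -sumrB; apply: eq_bigr => i _; rewrite (sy i j) (sy i k); ring.
ring.
Qed.

Let nq : nice q.
Proof.
by apply: nice_sum => l; apply: niceM; [exact: nice_coord|];
   apply: nice_sum => l'; apply: niceM; [exact: nice_cst|exact: nice_coord].
Qed.

Let nNc i : nice (Nc^~ i).
Proof.
by apply: nice_sum => l'; apply: niceM; [exact: nice_cst|exact: nice_coord].
Qed.

(** The integration by parts formula on the sphere for powers of a quadratic
    form: rotation invariance annihilates the generators of all coordinate
    planes, and their sum over the planes telescopes on the unit sphere. *)
Lemma stein_quad m : (n + 2 * m)%:R * E (fun c => q c ^+ m.+1) =
  \tr N * E (fun c => q c ^+ m)
  + 2 * m%:R * E (fun c => q c ^+ m.-1 * \sum_i Nc c i ^+ 2).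
Proof.
pose co c i : R := (c : 'cV[R]_n) i 0.
(* the derivative of [c k * (N c) j * q ^+ m] along the plane [(j, k)] *)
pose h j k c : R := (- co c j * Nc c j + co c k * (N j j * co c k - N j k * co c j)) * q c ^+ m
  + co c k * Nc c j * (m%:R * q c ^+ m.-1 * (2 * (co c k * Nc c j - co c j * Nc c k))).
have nco i : nice (co^~ i) by exact: nice_coord.
have nh j k : nice (h j k).
  rewrite /h; repeat first [apply: niceD | apply: niceM | apply: niceB | apply: niceX |
    apply: niceN | exact: nq | exact: nNc | exact: nco | exact: nice_cst].
have hjk j k : j != k -> E (h j k) = 0.
  move=> jk; apply: (gen_Ex0 jk); last first.
    apply: gen_eq (genM (genM (gen_coord k jk) (gen_Nc j jk)) (genX m (gen_quad jk))) _ _ => c.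
      reflexivity.
    by rewrite /h /co eqxx [k == j]eq_sym (negbTE jk) /=; ring.
have hjj j c : h j j c = - (co c j * Nc c j * q c ^+ m) by rewrite /h; ring.
have S1 : \sum_j \sum_k E (h j k) = - E (fun c => q c ^+ m.+1).
  rewrite -ExN //; last exact: niceX.
  transitivity (\sum_j E (h j j)).
    by apply: eq_bigr => j _; rewrite (bigD1 j) //= big1 ?addr0 // => k kj; rewrite hjk // eq_sym.
  rewrite -Ex_sum //; apply: Ex_eq => c _; rewrite exprS /q mulr_suml -sumrN.
  by apply: eq_bigr => j _; rewrite hjj.
have row j c : sphere c -> \sum_k h j k c = - (n%:R + 1) * (co c j * Nc c j) * q c ^+ m
    + N j j * q c ^+ m
    + m%:R * q c ^+ m.-1 * 2 * (Nc c j ^+ 2 - co c j * Nc c j * q c).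
  move=> Sc; have S1c : \sum_k co c k * co c k = 1 by exact: Sc.
  have -> : \sum_k h j k c = \sum_k (- co c j * Nc c j * q c ^+ m
     + (N j j * q c ^+ m + m%:R * q c ^+ m.-1 * 2 * Nc c j ^+ 2) * (co c k * co c k)
     + (- co c j * q c ^+ m) * (N j k * co c k)
     - (m%:R * q c ^+ m.-1 * 2 * Nc c j * co c j) * (co c k * Nc c k)).
    by apply: eq_bigr => k _; rewrite /h; ring.
  rewrite sumrB !big_split /= -!mulr_sumr sumr_const card_ord S1c.
  rewrite -/(Nc c j) -/(q c) -mulr_natl; ring.
have S2 c : sphere c -> \sum_j \sum_k h j k c = - (n%:R + 1 + 2 * m%:R) * q c ^+ m.+1
    + \tr N * q c ^+ m + 2 * m%:R * (q c ^+ m.-1 * \sum_i Nc c i ^+ 2).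
  move=> Sc; under eq_bigr do rewrite row //.
  have -> : \sum_(j < n) (- (n%:R + 1) * (co c j * Nc c j) * q c ^+ m + N j j * q c ^+ m
       + m%:R * q c ^+ m.-1 * 2 * (Nc c j ^+ 2 - co c j * Nc c j * q c)) =
     \sum_(j < n) ((- (n%:R + 1) * q c ^+ m - m%:R * q c ^+ m.-1 * 2 * q c) * (co c j * Nc c j)
       + q c ^+ m * N j j + m%:R * q c ^+ m.-1 * 2 * (Nc c j ^+ 2)).
    by apply: eq_bigr => j _; ring.
  rewrite !big_split /= -!mulr_sumr -/(q c) -/(\tr N).
  by case: (m) => [|k] /=; rewrite ?expr0 ?exprS; ring.
move: S1; under eq_bigr do rewrite -Ex_sum //.
rewrite -Ex_sum //; last by move=> j; apply: nice_sum.
rewrite (Ex_eq Q S2) => S1.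
have n1 : nice (fun c => q c ^+ m.+1) by exact: niceX.
have n2 : nice (fun c => q c ^+ m) by exact: niceX.
have n3 : nice (fun c => q c ^+ m.-1 * \sum_i Nc c i ^+ 2).
  by apply: niceM; [exact: niceX | apply: nice_sum => i; exact: niceX].
have n4 a f : nice f -> nice (fun c => a * f c).
  by move=> nf; apply: niceM => //; exact: nice_cst.
move: S1; rewrite !ExD ?ExZ //; try by [apply: n4|apply: niceD; apply: n4].
rewrite natrD natrM; lra.
Qed.
End Quadratic.

Lemma Ex_quad (N : 'M[R]_n) : N^T = N ->
  n%:R * E (fun c => dot (c : 'cV_n) (N *m (c : 'cV_n))) = \tr N.
Proof.
move=> sy; have := stein_quad sy 0; rewrite muln0 addn0 mulr0 mul0r addr0.
under eq_fun do rewrite expr1 (quadE N).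
move=> ->; rewrite -[RHS]mulr1; congr (_ * _).
by under eq_fun do rewrite expr0; rewrite Ex_cst.
Qed.

Lemma nice_mul (N : 'M[R]_n) i : nice (fun c => (N *m (c : 'cV_n)) i 0).
Proof.
under eq_fun do rewrite mxE.
by apply: nice_sum => l; apply: niceM; [exact: nice_cst|exact: nice_coord].
Qed.

Lemma nice_quad (N M : 'M[R]_n) : nice (fun c => dot (N *m (c : 'cV_n)) (M *m (c : 'cV_n))).
Proof. by apply: nice_sum => l; apply: niceM; exact: nice_mul. Qed.

Lemma nice_quad1 (M : 'M[R]_n) : nice (fun c => dot (c : 'cV_n) (M *m (c : 'cV_n))).
Proof. by apply: nice_sum => l; apply: niceM; [exact: nice_coord|exact: nice_mul]. Qed.

(** Fourth moment of the fluctuation of a quadratic form. Its decay in the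
    square of the dimension is what makes the deviation probabilities summable. *)
Lemma quad_moment (M : 'M[R]_n) (mu := \tr M / n%:R) : M^T = M -> (0 < n)%N ->
  E (fun c => (dot (c : 'cV_n) (M *m (c : 'cV_n)) - mu) ^+ 4) <=
    288 * (\tr (M ^+ 4) / n%:R + mu ^+ 4) / n%:R ^+ 2.
Proof.
move=> sy n0; have n0' : 0 < n%:R :> R by rewrite ltr0n.
(* removing the trace turns the integration by parts formula into a recursion
   without a main term *)
pose N := M - mu%:M.
have syN : N^T = N by rewrite /N linearB /= sy tr_scalar_mx.
have trN : \tr N = 0.
  by rewrite /N linearB /= mxtrace_scalar -mulr_natr /mu divfK ?subrr ?gt_eqF.
pose q (c : @mxBorel R n 1) := dot (c : 'cV_n) (N *m (c : 'cV_n)).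
pose s (c : @mxBorel R n 1) := dot (N *m (c : 'cV_n)) (N *m (c : 'cV_n)).
have qE c : sphere c -> q c = dot (c : 'cV_n) (M *m (c : 'cV_n)) - mu.
  by move=> Sc; rewrite /q /N mulmxBl mul_scalar_mx dotBr dotZr Sc mulr1.
have nq : nice q by exact: nice_quad1.
have ns : nice s by exact: nice_quad.
have st : (n%:R + 6) * E (fun c => q c ^+ 4) = 6 * E (fun c => q c ^+ 2 * s c).
  have := stein_quad syN 3; rewrite trN mul0r add0r natrD => h.
  have {}h : (n%:R + 6) * E (fun c => (\sum_l (c : 'cV[R]_n) l 0 * \sum_i N l i * (c : 'cV[R]_n) i 0) ^+ 4)
     = 6 * E (fun c => (\sum_l (c : 'cV[R]_n) l 0 * \sum_i N l i * (c : 'cV[R]_n) i 0) ^+ 2 *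
        \sum_l (\sum_i N l i * (c : 'cV[R]_n) i 0) ^+ 2).
    by apply: etrans h _; congr (_ * _); rewrite -natrM.
  have e1 (c : @mxBorel R n 1) : \sum_l (c : 'cV[R]_n) l 0 * \sum_i N l i * (c : 'cV[R]_n) i 0 = q c.
    by rewrite /q /dot; apply: eq_bigr => l _; rewrite mxE.
  have e2 (c : @mxBorel R n 1) : \sum_l (\sum_i N l i * (c : 'cV[R]_n) i 0) ^+ 2 = s c.
    by rewrite /s /dot; apply: eq_bigr => l _; rewrite mxE expr2.
  by move: h; under eq_fun do rewrite e1; under [X in _ = _ * E X]eq_fun do rewrite e1 e2.
have le1 : E (fun c => q c ^+ 2 * s c) <=
    (3 / n%:R) * E (fun c => s c ^+ 2) + (n%:R / 12) * E (fun c => q c ^+ 4).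
  rewrite -!(ExZ Q mS); try by apply: niceX.
  rewrite -(ExD Q mS); try by apply: niceM; [exact: nice_cst|exact: niceX].
  apply: Ex_le => //.
  - by apply: niceM => //; exact: niceX.
  - by apply: niceD; apply: niceM; first [exact: nice_cst|exact: niceX].
  move=> c _; rewrite -subr_ge0.
  have -> : 3 / n%:R * s c ^+ 2 + n%:R / 12 * q c ^+ 4 - q c ^+ 2 * s c =
     (3 / n%:R) * (s c - n%:R / 6 * q c ^+ 2) ^+ 2 by field; rewrite gt_eqF.
  by rewrite mulr_ge0 ?sqr_ge0 // divr_ge0 // ltW.
have le2 : E (fun c => s c ^+ 2) <= 8 * (\tr (M ^+ 4) / n%:R) + 8 * mu ^+ 4.
  have sy4 : (M ^+ 4)^T = M ^+ 4.
    by rewrite !exprS expr0 !mulr1 -!mulmxE !trmx_mul sy !mulmxA.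
  have -> : \tr (M ^+ 4) / n%:R = E (fun c => dot (c : 'cV_n) (M ^+ 4 *m (c : 'cV_n))).
    by rewrite -(Ex_quad sy4) mulrC mulKf // gt_eqF.
  rewrite -(ExZ Q mS); last exact: nice_quad1.
  rewrite -[X in _ + X](Ex_cst mS Q_sphere) -(ExD Q mS); first last.
  - exact: nice_cst.
  - by apply: niceM; [exact: nice_cst|exact: nice_quad1].
  apply: Ex_le => //; first exact: niceX.
    by apply: niceD; [apply: niceM; [exact: nice_cst|exact: nice_quad1] | exact: nice_cst].
  move=> c Sc.
  have c1 : nrm (c : 'cV_n) = 1 by rewrite /nrm Sc sqrtr1.
  set m2 := dot (M *m (c : 'cV_n)) (M *m (c : 'cV_n)).
  have m20 : 0 <= m2 by exact: dot_ge0.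
  have sle : s c <= 2 * m2 + 2 * mu ^+ 2.
    rewrite -subr_ge0.
    have -> : 2 * m2 + 2 * mu ^+ 2 - s c =
        dot (M *m (c : 'cV_n) + mu *: (c : 'cV_n)) (M *m (c : 'cV_n) + mu *: (c : 'cV_n)).
      rewrite /s /N mulmxBl mul_scalar_mx !(dotBl, dotBr, dotDl, dotDr, dotZl, dotZr) -/m2 Sc.
      ring.
    exact: dot_ge0.
  have m4 : m2 ^+ 2 <= dot (c : 'cV_n) (M ^+ 4 *m (c : 'cV_n)).
    have -> : dot (c : 'cV_n) (M ^+ 4 *m (c : 'cV_n)) =
       dot (M *m (M *m (c : 'cV_n))) (M *m (M *m (c : 'cV_n))).
      rewrite dot_mull sy dot_mull sy !exprS expr0 mulr1 -!mulmxE.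
      by rewrite !mulmxA.
    have -> : m2 = dot (c : 'cV_n) (M *m (M *m (c : 'cV_n))) by rewrite /m2 dot_mull sy.
    by apply: le_trans (dot_sqr_le _ _) _; rewrite Sc mul1r.
  have s0 : 0 <= s c by exact: dot_ge0.
  apply: le_trans (_ : (2 * m2 + 2 * mu ^+ 2) ^+ 2 <= _).
    by rewrite ler_sqr ?nnegrE // (le_trans s0).
  apply: le_trans (_ : 8 * m2 ^+ 2 + 8 * mu ^+ 4 <= _); last first.
    by rewrite lerD2r ler_pM2l.
  rewrite -subr_ge0.
  have -> : 8 * m2 ^+ 2 + 8 * mu ^+ 4 - (2 * m2 + 2 * mu ^+ 2) ^+ 2 =
    4 * (m2 - mu ^+ 2) ^+ 2 by ring.
  by rewrite mulr_ge0 ?sqr_ge0.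
rewrite (Ex_eq Q (g := fun c => q c ^+ 4)); last by move=> c Sc; rewrite qE.
have q40 : 0 <= E (fun c => q c ^+ 4).
  by apply: Rintegral_ge0 => c _; rewrite exprn_even_ge0.
rewrite ler_pdivlMr ?exprn_gt0 //.
exact: quad_moment_arith n0' q40 st le1 le2.
Qed.

End Sphere.

(** * Independence, Borel-Cantelli and uniform frames *)

Section Independence.
Context {R : realType} {d d1 d2 : measure_display} {T : measurableType d}
  {T1 : measurableType d1} {T2 : measurableType d2} (P : probability T R).

Definition mfun_of (dd : measure_display) (T' : measurableType dd) (X : T -> T')
    (mX : measurable_fun setT X) : {mfun T >-> T'} :=
  HB.pack X (isMeasurableFun.Build _ _ _ _ X mX).

Lemma mpre (dd : measure_display) (T' : measurableType dd) (X : T -> T') B :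
  measurable_fun setT X -> measurable B -> measurable (X @^-1` B).
Proof. by move=> mX mB; rewrite -[X in measurable X]setTI; exact: mX. Qed.

(** Freezing one of two independent variables, by Fubini's theorem: a bound on
    the probability of all the sections of an event bounds the probability of
    the event. *)
Lemma indep_section (Z : T -> T2) (X : T -> T1) (B : set (T2 * T1)) (c : R) :
  measurable_fun setT Z -> measurable_fun setT X ->
  (forall E F, measurable E -> measurable F ->
    P (X @^-1` E `&` Z @^-1` F) = (P (X @^-1` E) * P (Z @^-1` F))%E) ->
  measurable B -> 0 <= c ->
  (forall z, (P [set w | B (z, X w)] <= c%:E)%E) ->
  (P [set w | B (Z w, X w)] <= c%:E)%E.
Proof.
move=> mZ mX ind mB c0 hB.
pose m1 : probability T2 R := distribution P (mfun_of mZ).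
pose m2 : probability T1 R := distribution P (mfun_of mX).
have mZX : measurable_fun setT (fun w => (Z w, X w)) by exact: measurable_fun_pair.
pose m' : probability (T2 * T1)%type R := distribution P (mfun_of mZX).
have E1 : (m1 \x m2)%E B = m' B.
  apply: product_measure_unique => // E F mE mF.
  rewrite /m' /m1 /m2 /distribution /pushforward /= muleC -ind //.
  by congr (P _); apply/seteqP; split => w [].
have -> : P [set w | B (Z w, X w)] = (m1 \x m2)%E B by rewrite E1.
rewrite /product_measure1.
apply: le_trans (_ : (\int[m1]_x (cst c%:E x) <= _)%E); last first.
  by rewrite integral_cst // [X in (_ * X)%E](probability_setT m1) mule1.
apply: ge0_le_integral => //.
- by apply: measurable_fun_xsection.
- move=> z _ /=; apply: le_trans (hB z).
  rewrite /m2 /distribution /pushforward /=.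
  apply: le_measure; rewrite ?inE.
  + by apply: mpre => //; exact: measurable_xsection.
  + rewrite (_ : [set w | _] = X @^-1` xsection B z); first by apply: mpre => //; exact: measurable_xsection.
    by apply/seteqP; split => w; rewrite /xsection /= inE.
  + by move=> w; rewrite /xsection /= inE.
Qed.

End Independence.

Section AlmostSure.
Context {R : realType} {d : measure_display} {T : measurableType d} (P : probability T R).

Lemma prob_ae (A S : set T) (c : \bar R) : measurable A -> measurable S ->
  {ae P, forall w, S w} -> (P (A `&` S) <= c)%E -> (P A <= c)%E.
Proof.
move=> mA mS [N [mN N0 sN]] h; apply: le_trans h.
have : (P A <= P ((A `&` S) `|` N))%E.
  apply: le_measure; rewrite ?inE //.
    by apply: measurableU => //; exact: measurableI.
  move=> w Aw; have [Sw|nSw] := pselect (S w); first by left.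
  by right; apply: sN.
move=> /le_trans; apply; have := measureU2 P (measurableI _ _ mA mS) mN.
move=> /le_trans; apply; rewrite -[leRHS]adde0; apply: leeD => //.
by rewrite le_eqVlt; apply/orP; left; apply/eqP; exact: N0.
Qed.

Lemma sum_inv_sqr n : \sum_(k < n.+1) (k.+1%:R ^- 2 : R) <= 2 - n.+1%:R^-1.
Proof.
elim: n => [|n IH]; first by rewrite big_ord1 invr1 expr1n invr1; lra.
rewrite big_ord_recr /=; apply: le_trans (lerD IH (lexx _)) _.
have h1 : (0 : R) < n.+1%:R by rewrite ltr0n.
have h2 : (0 : R) < n.+2%:R by rewrite ltr0n.
rewrite -subr_ge0.
have -> : 2 - n.+2%:R^-1 - (2 - n.+1%:R^-1 + n.+2%:R ^- 2) =
   (n.+1%:R * n.+2%:R ^+ 2)^-1 :> R.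
  move: h1 h2; rewrite -(natr1 n.+1); move: (n.+1%:R) => y y0 y1; field.
  by rewrite !gt_eqF.
by rewrite invr_ge0 mulr_ge0 ?sqr_ge0 // ltW.
Qed.

(** The inverse squares are summable. *)
Lemma borel_cantelli_sqr (F : nat -> set T) (C : R) : (forall n, measurable (F n)) ->
  (forall n, (P (F n) <= (C / n.+1%:R ^+ 2)%:E)%E) ->
  {ae P, forall w, \forall n \near \oo, ~ F n w}.
Proof.
move=> mF hF.
have C0 : 0 <= C.
  have := le_trans (measure_ge0 P (F 0%N)) (hF 0%N).
  by rewrite expr1n divr1 lee_fin.
have fin : (\sum_(n <oo) P (F n) < +oo)%E.
  apply: le_lt_trans (ltry (C * 2)).
  apply: lime_le; first exact: is_cvg_nneseries.
  near=> n; rewrite big_mkord.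
  apply: le_trans (lee_sum _ (fun (i : 'I_n) _ => hF i)) _.
  rewrite sumEFin lee_fin -mulr_sumr ler_wpM2l //.
  case: (n) => [|m]; first by rewrite big_ord0.
  by apply: le_trans (sum_inv_sqr m) _; rewrite gerBl invr_ge0.
have null := lim_sup_set_cvg0 mF fin.
exists (lim_sup_set F); split=> //.
  by apply: bigcap_measurable => // k _; exact: bigcup_measurable.
move=> w /= nw k _; apply: contrapT => nk; apply: nw; exists k => // n /= kn Fn.
by apply: nk; exists n.
Unshelve. all: by end_near.
Qed.

End AlmostSure.

Section FrameConcentration.
Context {R : realType} {d : measure_display} {T : measurableType d} (P : probability T R).
Variables (n r : nat) (A : T -> 'M[R]_(n, r)).
Hypotheses (uA : uniform_frame P A) (n0 : (0 < n)%N).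

(** A unit combination of the columns of a uniform frame is uniform on the
    sphere, so that Markov's inequality applies to the fourth moment. *)
Lemma frame_quad (w : 'cV[R]_r) (M : 'M[R]_n) (e : R) : dot w w = 1 -> M^T = M -> 0 < e ->
  (P [set t | (e <= `|dot (A t *m w) (M *m (A t *m w)) - \tr M / n%:R|)%R] <=
   (288 * (\tr (M ^+ 4) / n%:R + (\tr M / n%:R) ^+ 4) / n%:R ^+ 2 / e ^+ 4)%:E)%E.
Proof.
case: uA => rA AA inv ww sy e0.
have mAw : measurable_fun setT (fun t => A t *m w : @mxBorel R n 1).
  apply: (@mxm_random R _ T n 1); apply: mxm_mul; last exact: mxm_cst.
  exact: random_mxm.
pose Q : probability (@mxBorel R n 1) R := distribution P (mfun_of mAw).
have mS := @measurable_sphere R n.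
have QS : Q (@sphere R n) = 1%E.
  apply/eqP; rewrite eq_le probability_le1 //=.
  have : (P setT <= Q (@sphere R n))%E.
    apply: (prob_ae (S := [set t | @sphere R n (A t *m w)])) => //.
    - exact: (mpre mAw mS).
    - apply: filterS AA => t At; rewrite /sphere /= dot_mull mulmxA At mul1mx //.
    - by rewrite setTI.
  by rewrite probability_setT.
have Qinv (O : 'M[R]_n) : O^T *m O = 1%:M -> forall E : set (@mxBorel R n 1),
    measurable E -> Q [set c | E (O *m (c : 'cV_n))] = Q E.
  move=> hO E mE.
  have mmul : measurable_fun setT (fun B : @mxBorel R n r => (B : 'M[R]_(n, r)) *m w : @mxBorel R n 1).
    apply: (@mxm_random R _ (@mxBorel R n r) n 1); apply: mxm_mul; last exact: mxm_cst.
    exact: mxm_id.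
  have := inv O hO _ (mpre mmul mE).
  move=> h; change (P [set t | E (O *m (A t *m w))] = P [set t | E (A t *m w)]).
  apply: etrans (etrans _ h) _ => //; congr (P _).
  by apply/seteqP; split => t /=; rewrite mulmxA.
have mq : nice (@sphere R n) (fun c : @mxBorel R n 1 => dot (c : 'cV_n) (M *m (c : 'cV_n)) - \tr M / n%:R).
  by apply: niceB; [exact: nice_quad1|exact: nice_cst].
have nn (c : @mxBorel R n 1) : sphere c ->
    0 <= (dot (c : 'cV_n) (M *m (c : 'cV_n)) - \tr M / n%:R) ^+ 4.
  by move=> _; rewrite exprn_even_ge0.
have mk := Ex_markov Q mS (niceX 4 mq) nn (exprn_gt0 4 e0).
have mB : measurable [set c : @mxBorel R n 1 |
    (e <= `|dot (c : 'cV_n) (M *m (c : 'cV_n)) - \tr M / n%:R|)%R].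
  rewrite -[X in measurable X]setTI; apply: measurable_fun_ler => //.
  by apply: measurableT_comp => //; exact: mq.1.
apply: (prob_ae (S := [set t | @sphere R n (A t *m w)])).
- exact: (mpre mAw mB).
- exact: (mpre mAw mS).
- by apply: filterS AA => t At; rewrite /sphere /= dot_mull mulmxA At mul1mx.
apply: le_trans (le_trans _ mk) _; last first.
  rewrite lee_fin ler_pM2r ?invr_gt0 ?exprn_gt0 //.
  exact: (quad_moment QS Qinv sy n0).
apply: le_measure; rewrite ?inE.
- by apply: measurableI; [exact: (mpre mAw mB)|exact: (mpre mAw mS)].
- apply: (mpre mAw); apply: measurableI => //.
  rewrite -[X in measurable X]setTI; apply: measurable_fun_ler => //.
  by have [] := niceX 4 mq.
- move=> t [/= h1 h2]; split=> //=.
  rewrite -[leRHS]ger0_norm ?exprn_even_ge0 // normrX.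
  by rewrite ler_pXn2r ?nnegrE ?(ltW e0).
Qed.

End FrameConcentration.

(** * Recovering the spikes from the signal *)

Section Lagrange.
Context {R : realType} (r : nat) (x : 'I_r -> R).
Hypotheses (x_neq0 : forall i, x i != 0) (x_sqr_inj : forall i j, x i ^+ 2 = x j ^+ 2 -> i = j).

(** The Lagrange interpolation polynomial at the squared spikes, scaled so that
    its product with the variable is normalised. *)
Definition lag0 i : {poly R} :=
  (x i ^+ 2 * \prod_(k | k != i) (x i ^+ 2 - x k ^+ 2))^-1 *:
    \prod_(k | k != i) ('X - (x k ^+ 2)%:P).

(** The polynomial vanishing at 0 which separates one squared spike from the
    others; it has to vanish at 0 because of the kernel of the signal. *)
Definition lag i := lag0 i * 'X.

Lemma lag0E i l : (lag0 i).[x l ^+ 2] * x l ^+ 2 = (l == i)%:R.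
Proof.
rewrite /lag0 hornerZ horner_prod.
have [->|li] := eqVneq l i.
  under [X in _ * X * _]eq_bigr do rewrite hornerXsubC.
  set p := \prod_(k | _) _; have p0 : p != 0.
    rewrite prodf_seq_neq0; apply/allP => k _; apply/implyP => ki.
    by rewrite subr_eq0; apply: contra ki => /eqP/x_sqr_inj ->.
  by rewrite mulr1n; field; rewrite p0 x_neq0.
by rewrite [X in _ * X * _](bigD1 l) //= hornerXsubC subrr mul0r mulr0 mul0r.
Qed.

Lemma pmx_conj n (A : 'M[R]_(n, r)) (W : 'M[R]_n) (E : 'M[R]_r) (P : {poly R}) :
  W *m A = A *m E -> pmx P W *m A = A *m pmx P E.
Proof.
move=> WA; elim/poly_ind: P => [|P c IH]; first by rewrite !pmx0 mul0mx mulmx0.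
rewrite !pmxD !pmxMX !pmxC mulmxDl mulmxDr -mulmxA WA mulmxA IH mulmxA.
by rewrite mul_scalar_mx mul_mx_scalar.
Qed.

Lemma pmx_diag (v : 'rV[R]_r) (P : {poly R}) :
  pmx P (diag_mx v) = diag_mx (\row_i P.[v 0 i]).
Proof.
elim/poly_ind: P => [|P c IH].
  by rewrite pmx0; apply/matrixP => i j; rewrite !mxE horner0 mul0rn.
rewrite pmxD pmxMX pmxC IH; apply/matrixP => i j.
rewrite mul_diag_mx !mxE !hornerE mulrnDl; case: eqP => [->|_]; rewrite ?mulr0n ?mulr1n //.
by rewrite mulr0 addr0.
Qed.

Let D : 'M[R]_r := diag_mx (\row_i x i).

(** The rank one projections on the left spikes are polynomials in the signal,
    which only knows the spikes up to a common sign. *)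
Lemma lag_spike n p (A : 'M[R]_(n, r)) (B : 'M[R]_(p, r)) i :
  A^T *m A = 1%:M -> B^T *m B = 1%:M ->
  pmx (lag i) ((A *m D *m B^T) *m (A *m D *m B^T)^T) =
    (A *m (delta_mx i 0 : 'cV[R]_r)) *m (A *m (delta_mx i 0 : 'cV[R]_r))^T.
Proof.
move=> hA hB; pose d : 'rV[R]_r := \row_l x l ^+ 2.
have -> : (A *m D *m B^T) *m (A *m D *m B^T)^T = A *m diag_mx d *m A^T.
  rewrite !trmx_mul trmxK tr_diag_mx -!mulmxA [B^T *m _]mulmxA hB mul1mx.
  rewrite [D *m (D *m _)]mulmxA /D mulmx_diag; congr (_ *m (diag_mx _ *m _)).
  by apply/rowP => l; rewrite !mxE expr2.
rewrite /lag pmxMX !mulmxA (pmx_conj (E := diag_mx d)); last first.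
  by rewrite -!mulmxA hA mulmx1.
rewrite pmx_diag -!mulmxA [diag_mx _ *m (_ *m _)]mulmxA mulmx_diag trmx_mul mulmxA.
rewrite [delta_mx i 0 *m _]mulmxA trmx_delta mul_delta_mx mulmxA; congr (_ *m _ *m _).
apply/matrixP => a b; rewrite !mxE lag0E.
have [->|ab] := eqVneq a b; first by rewrite mulr1n andbb.
rewrite mulr0n; case: (a =P i) => [ai|//]; case: (b =P i) => [bi|//].
by rewrite ai bi eqxx in ab.
Qed.

End Lagrange.

(** * Deviation probabilities at a fixed size *)

Section RankOne.
Context {R : realType}.

Lemma trace_rank1 n (u : 'cV[R]_n) (M : 'M[R]_n) : \tr (u *m u^T *m M) = dot u (M *m u).
Proof. by rewrite -mulmxA mxtrace_mulC -mulmxA dot_mx mxtrace_scalar. Qed.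

Lemma trace_rank1_2 n p (u : 'cV[R]_n) (v : 'cV[R]_p) (N : 'M[R]_(n, p)) (M : 'M[R]_(p, n)) :
  \tr (u *m u^T *m N *m (v *m v^T) *m M) = dot u (N *m v) * dot v (M *m u).
Proof.
rewrite -!mulmxA mxtrace_mulC -!mulmxA [N *m (v *m _)]mulmxA [u^T *m (_ *m _)]mulmxA.
by rewrite dot_mx mul_scalar_mx linearZ /= dot_mx mxtrace_scalar.
Qed.

Lemma rank1_exp4 n (h : 'cV[R]_n) : \tr ((h *m h^T) ^+ 4) = dot h h ^+ 4.
Proof.
have sq (M : 'M[R]_n) : h *m h^T *m (h *m h^T *m M) = dot h h *: (h *m h^T *m M).
  by rewrite -!mulmxA [h^T *m (h *m _)]mulmxA dot_mx mul_scalar_mx -scalemxAr.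
rewrite !exprS expr0 -!mulmxE !sq !scalerA linearZ /= trace_rank1 mul1mx.
ring.
Qed.

Lemma trace_rank1_self n (h : 'cV[R]_n) : \tr (h *m h^T) = dot h h.
Proof. by rewrite mxtrace_mulC dot_mx mxtrace_scalar. Qed.

End RankOne.


Section Events.
Context {R : realType} {d : measure_display} {T : measurableType d} (P : probability T R).

Lemma prob_ae_le (A C : set T) (c : \bar R) : measurable A -> measurable C ->
  {ae P, forall w, A w -> C w} -> (P C <= c)%E -> (P A <= c)%E.
Proof.
move=> mA mC [N [mN N0 sN]] h; apply: le_trans h.
have : (P A <= P (C `|` N))%E.
  apply: le_measure; rewrite ?inE //; first exact: measurableU.
  move=> w Aw; have [Sw|nSw] := pselect (C w); first by left.
  by right; apply: sN => h; apply: nSw; exact: h.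
move=> /le_trans; apply; have := measureU2 P mC mN.
move=> /le_trans; apply; rewrite -[leRHS]adde0; apply: leeD => //.
by rewrite le_eqVlt; apply/orP; left; apply/eqP; exact: N0.
Qed.

Lemma prob_ae_le2 (A C1 C2 : set T) (c : R) : measurable A -> measurable C1 -> measurable C2 ->
  {ae P, forall w, A w -> C1 w \/ C2 w} -> (P C1 <= c%:E)%E -> (P C2 <= c%:E)%E ->
  (P A <= (2 * c)%:E)%E.
Proof.
move=> mA m1 m2 h h1 h2; apply: (prob_ae_le mA (measurableU _ _ m1 m2)).
  by apply: filterS h => w.
apply: le_trans (measureU2 P m1 m2) _.
by rewrite mulr_natl mulr2n EFinD; apply: leeD.
Qed.

Lemma mx_ler (f g : T -> R) : measurable_fun setT f -> measurable_fun setT g ->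
  measurable [set t | f t <= g t].
Proof. by move=> mf mg; rewrite -[X in measurable X]setTI; exact: measurable_fun_ler. Qed.

Lemma mx_le_norm (f : T -> R) (e : R) : measurable_fun setT f ->
  measurable [set t | e <= `|f t|].
Proof. by move=> mf; apply: mx_ler => //; exact: measurableT_comp. Qed.

Lemma mxm_comp (d' : measure_display) (T' : measurableType d') m n (F : T' -> 'M[R]_(m, n))
  (g : T -> T') : mxm F -> measurable_fun setT g -> mxm (fun t => F (g t)).
Proof. by move=> hF hg i j; exact: (measurableT_comp (hF i j) hg). Qed.

Lemma mxm_dot n (F G : T -> 'cV[R]_n) : mxm F -> mxm G ->
  measurable_fun setT (fun t => dot (F t) (G t)).
Proof.
by move=> hF hG; apply: measurable_sum => i; apply: measurable_funM; [exact: hF|exact: hG].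
Qed.

End Events.

Section FixedSize.
Context {R : realType} {d : measure_display} {T : measurableType d} (P : probability T R).
Variables (n p r : nat) (x : 'I_r -> R).
Variables (A : T -> 'M[R]_(n, r)) (B : T -> 'M[R]_(p, r)) (Z : T -> 'M[R]_(n, p)).
Hypotheses (x_neq0 : forall i, x i != 0) (x_sqr_inj : forall i j, x i ^+ 2 = x j ^+ 2 -> i = j).
Hypotheses (uA : uniform_frame P A) (uB : uniform_frame P B) (AB : independent_mx P A B).
Let X w := A w *m diag_mx (\row_i x i) *m (B w)^T.
Hypotheses (rZ : random_mx Z) (ZX : independent_mx P Z X) (n0 : (0 < n)%N).

Let mA : mxm A. Proof. by apply: random_mxm; case: uA. Qed.
Let mB : mxm B. Proof. by apply: random_mxm; case: uB. Qed.
Let mZ : mxm Z. Proof. exact: random_mxm. Qed.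
Let mX : mxm X.
Proof. by apply: mxm_mul (mxm_tr mB); apply: mxm_mul mA _; exact: mxm_cst. Qed.

Let e_ i : 'cV[R]_r := delta_mx i 0.

Let orthonormal : {ae P, forall w, (A w)^T *m A w = 1%:M /\ (B w)^T *m B w = 1%:M}.
Proof. by case: uA uB => _ hA _ [_ hB _]; apply: filterS2 hA hB => w; split. Qed.

Let spikeA i (M : 'M[R]_(n, p)) := pmx (lag x i) (M *m M^T).
Let spikeB i (M : 'M[R]_(n, p)) := pmx (lag x i) (M^T *m M).

Let spikeA_E i w : (A w)^T *m A w = 1%:M -> (B w)^T *m B w = 1%:M ->
  spikeA i (X w) = (A w *m e_ i) *m (A w *m e_ i)^T.
Proof. by move=> hA hB; rewrite /spikeA (lag_spike x_neq0 x_sqr_inj). Qed.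

Let spikeB_E i w : (A w)^T *m A w = 1%:M -> (B w)^T *m B w = 1%:M ->
  spikeB i (X w) = (B w *m e_ i) *m (B w *m e_ i)^T.
Proof.
move=> hA hB; rewrite /spikeB -(lag_spike x_neq0 x_sqr_inj i hB hA).
by rewrite !trmx_mul !trmxK tr_diag_mx !mulmxA.
Qed.

Let zx_freeze (E : set (@mxBorel R n p * @mxBorel R n p)) (c : R) : measurable E -> 0 <= c ->
  (forall z, (P [set w | E (z, X w)] <= c%:E)%E) -> (P [set w | E (Z w, X w)] <= c%:E)%E.
Proof.
move=> mE c0 h; apply: (@indep_section R d _ _ T (@mxBorel R n p) (@mxBorel R n p) P Z X) => //.
  exact: mxm_random.
by move=> F G mF mG; rewrite setIC ZX // muleC.
Qed.

Section Quadratic.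
Variables (M : 'M[R]_(n, p) -> 'M[R]_n) (K e : R).
Hypotheses (mM : mxm (M : @mxBorel R n p -> 'M[R]_n)) (M_sym : forall z, (M z)^T = M z).
Hypotheses (K0 : 0 <= K) (e0 : 0 < e).

(** The event on which the spectrum of [M z] is of bounded order, so that the
    moment bound is effective. *)
Definition tame z := (\tr (M z ^+ 4) <= K * n%:R) /\ (`|\tr (M z)| <= K * n%:R).

Let c := 288 * (K + K ^+ 4) / n%:R ^+ 2 / e ^+ 4.

Let c0 : 0 <= c.
Proof.
have h1 : 0 <= K + K ^+ 4 by rewrite addr_ge0 ?exprn_ge0.
have h2 : 0 <= 288 :> R by rewrite ler0n.
rewrite /c; move: (288 : R) h2 => k h2.
apply: divr_ge0; last by rewrite exprn_ge0 // ltW.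
by apply: divr_ge0; [exact: mulr_ge0|exact: exprn_ge0].
Qed.

Let mtame (d' : measure_display) (T' : measurableType d') (g : T' -> @mxBorel R n p) :
  measurable_fun setT g -> measurable [set t | tame (g t)].
Proof.
move=> mg; have h := mxm_comp mM mg.
apply: measurableI; apply: mx_ler => //; first by apply: mxm_trace; exact: mxmX.
by apply: measurableT_comp => //; exact: mxm_trace.
Qed.

Let tame_bound z (w : 'cV[R]_r) : dot w w = 1 -> tame z ->
  (P [set t | (e <= `|dot (A t *m w) (M z *m (A t *m w)) - \tr (M z) / n%:R|)%R] <= c%:E)%E.
Proof.
move=> w1 [t4 t1]; apply: le_trans (frame_quad uA n0 w1 (M_sym z) e0) _.
have nn : 0 < n%:R :> R by rewrite ltr0n.
rewrite lee_fin /c ler_pM2r ?invr_gt0 ?exprn_gt0 // ler_pM2r ?invr_gt0 ?exprn_gt0 //.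
rewrite ler_pM2l ?ltr0n //; apply: lerD; first by rewrite ler_pdivrMr.
rewrite -[leLHS]ger0_norm ?exprn_even_ge0 // normrX.
rewrite lerXn2r ?nnegrE // normrM normfV (ger0_norm (ltW nn)).
by rewrite ler_pdivrMr.
Qed.

(** The quadratic form is a function of the signal and of the noise, hence the
    noise can be frozen. *)
Lemma diag_event i :
  (P [set w | tame (Z w) /\
     (e <= `|dot (A w *m e_ i) (M (Z w) *m (A w *m e_ i)) - \tr (M (Z w)) / n%:R|)%R]
   <= c%:E)%E.
Proof.
pose E : set (@mxBorel R n p * @mxBorel R n p) := [set t | tame t.1 /\
   e <= `|\tr (spikeA i t.2 *m M t.1) - \tr (M t.1) / n%:R|].
have mS (d' : measure_display) (T' : measurableType d') (f g : T' -> @mxBorel R n p) :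
    measurable_fun setT f -> measurable_fun setT g ->
    measurable [set t | tame (f t) /\ e <= `|\tr (spikeA i (g t) *m M (f t)) - \tr (M (f t)) / n%:R|].
  move=> mf mg; apply: measurableI; first exact: mtame.
  apply: mx_le_norm; apply: measurable_funB; last first.
    by apply: measurable_funM => //; apply: mxm_trace; exact: mxm_comp mf.
  have hg := mxm_comp (@mxm_id R n p) mg.
  apply: mxm_trace; apply: mxm_mul; last exact: mxm_comp mf.
  by apply: mxm_pmx; apply: mxm_mul => //; exact: mxm_tr.
have mu : mxm (fun w => A w *m e_ i) by apply: mxm_mul => //; exact: mxm_cst.
have mX' := mxm_random mX.
apply: (@prob_ae_le _ _ _ _ _ [set w | E (Z w, X w)]).
- apply: measurableI; first exact: mtame.
  have mMZ := mxm_comp mM rZ.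
  apply: mx_le_norm; apply: measurable_funB; last by apply: measurable_funM => //; exact: mxm_trace.
  by apply: mxm_dot => //; exact: mxm_mul.
- exact: mS.
- apply: filterS orthonormal => w [hA hB] [tz h]; split=> //=.
  by rewrite spikeA_E // trace_rank1.
apply: zx_freeze => // [|z]; first by apply: mS; [exact: measurable_fst|exact: measurable_snd].
have [tz|ntz] := pselect (tame z); last first.
  by rewrite (_ : [set w | _] = set0) ?measure0 ?lee_fin //; apply/seteqP; split=> w // [].
apply: (prob_ae_le _ _ _ (tame_bound (w := e_ i) _ tz)).
- exact: (mS _ _ (fun=> z) X).
- apply: mx_le_norm; apply: measurable_funB => //.
  by apply: mxm_dot => //; apply: mxm_mul => //; exact: mxm_cst.
- apply: filterS orthonormal => w [hA hB] [_ /=].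
  by rewrite spikeA_E // trace_rank1.
- by rewrite dot_delta mxE !eqxx.
Qed.

(** The sign of the form is not determined by the signal, but its square is.
    Once the noise is frozen, polarisation reduces the form to the diagonal
    case. *)
Lemma offdiag_event i j : i != j ->
  (P [set w | tame (Z w) /\ (e <= `|dot (A w *m e_ i) (M (Z w) *m (A w *m e_ j))|)%R]
   <= (2 * c)%:E)%E.
Proof.
move=> ij.
have mS (d' : measure_display) (T' : measurableType d') (f g : T' -> @mxBorel R n p) :
    measurable_fun setT f -> measurable_fun setT g ->
    measurable [set t | tame (f t) /\
      e ^+ 2 <= `|\tr (spikeA i (g t) *m M (f t) *m spikeA j (g t) *m M (f t))|].
  move=> mf mg; apply: measurableI; first exact: mtame.
  have hg := mxm_comp (@mxm_id R n p) mg; have hf := mxm_comp mM mf.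
  have hS k : mxm (fun t => spikeA k (g t)).
    by apply: mxm_pmx; apply: mxm_mul => //; exact: mxm_tr.
  apply: mx_le_norm; apply: mxm_trace.
  by do 3! [apply: mxm_mul => //].
have mu k : mxm (fun w => A w *m e_ k) by apply: mxm_mul => //; exact: mxm_cst.
have mX' := mxm_random mX.
(* the trace depends on the frames through the signal only *)
have sq w : (A w)^T *m A w = 1%:M -> (B w)^T *m B w = 1%:M -> forall z,
    `|\tr (spikeA i (X w) *m M z *m spikeA j (X w) *m M z)| =
    `|dot (A w *m e_ i) (M z *m (A w *m e_ j))| ^+ 2.
  move=> hA hB z; rewrite !spikeA_E // trace_rank1_2 [X in _ * X]dotC [X in _ * X]dot_mull.
  by rewrite M_sym -expr2 normrX.
apply: (@prob_ae_le _ _ _ _ _ [set w | [set t : @mxBorel R n p * @mxBorel R n p | tame t.1 /\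
   e ^+ 2 <= `|\tr (spikeA i t.2 *m M t.1 *m spikeA j t.2 *m M t.1)|] (Z w, X w)]).
- apply: measurableI; first exact: mtame.
  have mMZ := mxm_comp mM rZ.
  apply: mx_le_norm.
  by apply: mxm_dot => //; exact: mxm_mul.
- exact: mS.
- apply: filterS orthonormal => w [hA hB] [tz h]; split=> //=.
  by rewrite sq // lerXn2r ?nnegrE // ltW.
apply: zx_freeze => [||z].
- by apply: mS; [exact: measurable_fst|exact: measurable_snd].
- exact: (mulr_ge0 (ler0n R 2) c0).
have [tz|ntz] := pselect (tame z); last first.
  rewrite (_ : [set w | _] = set0); first by rewrite measure0 lee_fin; exact: (mulr_ge0 (ler0n R 2) c0).
  by apply/seteqP; split=> w // [].
pose s := Num.sqrt 2^-1 : R; have s2 : s * s = 2^-1 by rewrite -expr2 sqr_sqrtr.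
(* unit vectors for the polarisation identity *)
pose wp : 'cV[R]_r := s *: (e_ i + e_ j).
pose wm : 'cV[R]_r := s *: (e_ i - e_ j).
have dd k l : dot (e_ k) (e_ l) = (k == l)%:R by rewrite dot_delta mxE eqxx andbT.
have ji : (j == i) = false by rewrite eq_sym (negbTE ij).
have wp1 : dot wp wp = 1.
  rewrite dotZl dotZr !dotDl !dotDr !dd !eqxx (negbTE ij) ji mulrA s2 !mulr1n !mulr0n.
  by rewrite addr0 add0r mulVf ?pnatr_eq0.
have wm1 : dot wm wm = 1.
  rewrite dotZl dotZr !dotDl !dotDr !dotNl !dotNr !dd !eqxx (negbTE ij) ji mulrA s2.
  by rewrite !mulr1n !mulr0n oppr0 addr0 add0r opprK mulVf ?pnatr_eq0.
have mw (w0 : 'cV[R]_r) : measurable [set t | e <= `|dot (A t *m w0) (M z *m (A t *m w0)) - \tr (M z) / n%:R|].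
  apply: mx_le_norm; apply: measurable_funB => //.
  have h := mxm_mul mA (mxm_cst (T := T) w0).
  by apply: mxm_dot => //; apply: mxm_mul => //; exact: mxm_cst.
apply: (prob_ae_le2 _ (mw wp) (mw wm) _ (tame_bound wp1 tz) (tame_bound wm1 tz)).
  exact: (mS _ _ (fun=> z) X).
apply: filterS orthonormal => w [hA hB] [_ /=]; rewrite sq //.
rewrite ler_pXn2r ?nnegrE ?(ltW e0) // => h.
apply: contrapT => /not_orP [/negP h1 /negP h2].
have sym : dot (A w *m e_ j) (M z *m (A w *m e_ i)) = dot (A w *m e_ i) (M z *m (A w *m e_ j)).
  by rewrite dotC dot_mull M_sym.
have pol : dot (A w *m wp) (M z *m (A w *m wp)) - dot (A w *m wm) (M z *m (A w *m wm)) =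
   2 * dot (A w *m e_ i) (M z *m (A w *m e_ j)).
  rewrite /wp /wm -!scalemxAr !dotZl !dotZr !mulrA !s2 !mulmxBr !mulmxDr.
  rewrite !dotDl !dotDr !dotNl !dotNr sym; lra.
move: h1 h2 h pol; rewrite -!ltNge.
move: (dot (A w *m wp) _) (dot (A w *m wm) _) (dot (A w *m e_ i) _) (_ / _) => q1 q2 q t.
by rewrite !ltr_norml ler_normr => /andP[? ?] /andP[? ?] /orP[] ? ?; lra.
Qed.

End Quadratic.
(** As in the off-diagonal case the square of the form is a function of the
    signal and of the noise. Once the noise and then [B] are frozen, the square
    is the quadratic form of a rank one matrix in a uniform vector. *)
Lemma cross_event (N : 'M[R]_(n, p) -> 'M[R]_(n, p)) (K e : R) i j :
  mxm (N : @mxBorel R n p -> 'M[R]_(n, p)) -> 0 <= K -> 0 < e -> 2 * K <= n%:R * e ^+ 2 ->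
  (P [set w | (dot (N (Z w) *m (B w *m e_ j)) (N (Z w) *m (B w *m e_ j)) <= K)%R /\
     (e <= `|dot (A w *m e_ i) (N (Z w) *m (B w *m e_ j))|)%R]
   <= (288 * (K ^+ 4 + K ^+ 4) / n%:R ^+ 2 / (e ^+ 2 / 2) ^+ 4)%:E)%E.
Proof.
move=> mN K0 e0 Kn; set c := 288 * _ / _ / _.
have nn : 0 < n%:R :> R by rewrite ltr0n.
have e2 : 0 < e ^+ 2 / 2 by rewrite divr_gt0 ?exprn_gt0 // ltr0n.
have c0 : 0 <= c.
  have h1 : 0 <= K ^+ 4 + K ^+ 4 by rewrite addr_ge0 ?exprn_ge0.
  have h2 : 0 <= 288 :> R by rewrite ler0n.
  rewrite /c; move: (288 : R) h2 => k h2.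
  apply: divr_ge0; last by rewrite exprn_ge0 // ltW.
  by apply: divr_ge0; [exact: mulr_ge0|exact: exprn_ge0].
have mX' := mxm_random mX.
have muA k : mxm (fun w => A w *m e_ k) by apply: mxm_mul => //; exact: mxm_cst.
have muB k : mxm (fun w => B w *m e_ k) by apply: mxm_mul => //; exact: mxm_cst.
pose h (z : 'M[R]_(n, p)) (b0 : 'M[R]_(p, r)) := N z *m (b0 *m e_ j).
have mh (d' : measure_display) (T' : measurableType d') (f : T' -> @mxBorel R n p)
    (a : T' -> 'M[R]_(n, r)) (b : T' -> 'M[R]_(p, r)) : measurable_fun setT f -> mxm a -> mxm b ->
    measurable [set t | dot (h (f t) (b t)) (h (f t) (b t)) <= K /\
      e <= `|dot (a t *m e_ i) (h (f t) (b t))|].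
  move=> mf ma mb.
  have mhh : mxm (fun t => h (f t) (b t)).
    apply: mxm_mul (mxm_comp mN mf) _; apply: mxm_mul => //; exact: mxm_cst.
  apply: measurableI; first by apply: mx_ler => //; exact: mxm_dot.
  apply: mx_le_norm; apply: mxm_dot => //; apply: mxm_mul => //; exact: mxm_cst.
have mS (d' : measure_display) (T' : measurableType d') (f g : T' -> @mxBorel R n p) :
    measurable_fun setT f -> measurable_fun setT g ->
    measurable [set t | \tr (spikeB j (g t) *m ((N (f t))^T *m N (f t))) <= K /\
      e ^+ 2 <= `|\tr (spikeA i (g t) *m N (f t) *m spikeB j (g t) *m (N (f t))^T)|].
  move=> mf mg; have hg := mxm_comp (@mxm_id R n p) mg; have hf := mxm_comp mN mf.
  have hA k : mxm (fun t => spikeA k (g t)).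
    by apply: mxm_pmx; apply: mxm_mul => //; exact: mxm_tr.
  have hB k : mxm (fun t => spikeB k (g t)).
    by apply: mxm_pmx; apply: mxm_mul => //; exact: mxm_tr.
  have hT := mxm_tr hf.
  apply: measurableI.
    by apply: mx_ler => //; apply: mxm_trace; do 2! [apply: mxm_mul => //].
  by apply: mx_le_norm; apply: mxm_trace; do 3! [apply: mxm_mul => //].
have eqE w z : (A w)^T *m A w = 1%:M -> (B w)^T *m B w = 1%:M ->
    (\tr (spikeB j (X w) *m ((N z)^T *m N z)) = dot (h z (B w)) (h z (B w))) /\
    (`|\tr (spikeA i (X w) *m N z *m spikeB j (X w) *m (N z)^T)| =
     `|dot (A w *m e_ i) (h z (B w))| ^+ 2).
  move=> hA hB; split; first by rewrite spikeB_E // trace_rank1 -mulmxA dot_mulr trmxK.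
  rewrite spikeA_E // spikeB_E // trace_rank1_2 [X in _ * X]dotC [X in _ * X]dot_mull.
  by rewrite trmxK -expr2 normrX.
apply: (@prob_ae_le _ _ _ _ _ [set w | [set t : @mxBorel R n p * @mxBorel R n p |
   \tr (spikeB j t.2 *m ((N t.1)^T *m N t.1)) <= K /\
   e ^+ 2 <= `|\tr (spikeA i t.2 *m N t.1 *m spikeB j t.2 *m (N t.1)^T)|] (Z w, X w)]).
- by apply: mh.
- exact: mS.
- apply: filterS orthonormal => w [hA hB] /= [h1 h2].
  have [-> ->] := eqE w (Z w) hA hB; split=> //.
  by rewrite lerXn2r ?nnegrE // ltW.
apply: zx_freeze => // [|z].
  by apply: mS; [exact: measurable_fst|exact: measurable_snd].
apply: (@prob_ae_le _ _ _ _ _ [set w | [set t : @mxBorel R p r * @mxBorel R n r |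
   dot (h z t.1) (h z t.1) <= K /\ e <= `|dot (t.2 *m e_ i) (h z t.1)|] (B w, A w)]).
- exact: (mS _ _ (fun=> z) X).
- exact: (mh _ _ (fun=> z)).
- apply: filterS orthonormal => w [hA hB] /= [h1 h2].
  have [E1 E2] := eqE w z hA hB; rewrite -E1; split=> //.
  by move: h2; rewrite E2 ler_pXn2r ?nnegrE // ltW.
apply: (@indep_section R d _ _ T (@mxBorel R n r) (@mxBorel R p r) P B A) => //.
- exact: mxm_random.
- exact: mxm_random.
- apply: (mh _ _ (fun=> z)) => //.
  + exact: (mxm_comp (@mxm_id R n r) measurable_snd).
  + exact: (mxm_comp (@mxm_id R p r) measurable_fst).
move=> b0; set g := h z b0.
have [hK|hK] := lerP (dot g g) K; last first.
  rewrite (_ : [set w | _] = set0) ?measure0 ?lee_fin //.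
  by apply/seteqP; split=> w //= []; rewrite leNgt hK.
have sy : (g *m g^T)^T = g *m g^T by rewrite trmx_mul trmxK.
have u1 : dot (e_ i) (e_ i) = 1 by rewrite dot_delta mxE !eqxx.
apply: (prob_ae_le _ _ _ (le_trans (frame_quad uA n0 u1 sy e2) _)).
- exact: (mh _ _ (fun=> z) A (fun=> b0) _ _ (mxm_cst _)).
- apply: mx_le_norm; apply: measurable_funB => //.
  by apply: mxm_dot => //; apply: mxm_mul => //; exact: mxm_cst.
- apply: aeW => w /= [_ h2].
  rewrite trace_rank1_self -mulmxA dot_mx mul_mx_scalar dotZr [dot g _]dotC -expr2.

  have h3 : e ^+ 2 <= dot (A w *m e_ i) g ^+ 2.
    by rewrite -[leRHS]ger0_norm ?sqr_ge0 // normrX lerXn2r ?nnegrE // ltW.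
  have h4 : dot g g / n%:R <= e ^+ 2 / 2.
    rewrite ler_pdivrMr // mulrAC ler_pdivlMr ?ltr0n // [leRHS]mulrC.
    by apply: le_trans Kn; rewrite [leRHS]mulrC ler_pM2r ?ltr0n.
  by rewrite ler_normr; apply/orP; left; lra.
- rewrite lee_fin trace_rank1_self rank1_exp4 /c.
  rewrite ler_pM2r ?invr_gt0 ?exprn_gt0 // ler_pM2r ?invr_gt0 ?exprn_gt0 //.
  rewrite ler_pM2l ?ltr0n //; apply: lerD.
    rewrite ler_pdivrMr // -[leLHS]mulr1 ler_pM ?exprn_ge0 ?dot_ge0 //.
      by rewrite lerXn2r ?nnegrE ?dot_ge0.
    by rewrite ler1n.
  rewrite lerXn2r ?nnegrE ?divr_ge0 ?dot_ge0 // ler_pdivrMr //.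
  by apply: le_trans hK _; rewrite ler_peMr // ler1n.
Qed.

End FixedSize.

(** * Almost sure concentration along the sequence of sizes *)

Section Countable.
Context {R : realType} {d : measure_display} {T : measurableType d} (P : probability T R).

Lemma ae_forall_count (I : countType) (S : I -> T -> Prop) :
  (forall i, {ae P, forall w, S i w}) -> {ae P, forall w, forall i, S i w}.
Proof.
move=> h; have h' (n : nat) : {ae P, forall w, if unpickle n is Some i then S i w else True}.
  by case: (unpickle n) => [i|]; [exact: h|exact: aeW].
have := ae_foralln h'; apply: filterS => w hw i.
by have := hw (pickle i); rewrite pickleK.
Qed.

(** The form in which Borel-Cantelli is used: events which are only controlled
    at the good sizes, with a dimension growing at least linearly. *)
Lemma borel_cantelli_when (good : nat -> bool) (F : nat -> set T) (C g : R) (q : nat -> R) :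
  (forall n, good n -> measurable (F n)) -> 0 < g -> 0 <= C ->
  (forall n, good n -> (0 < n)%N) -> (forall n, g * n%:R <= q n) ->
  (forall n, good n -> (P (F n) <= (C / q n ^+ 2)%:E)%E) ->
  {ae P, forall w, \forall n \near \oo, good n -> ~ F n w}.
Proof.
move=> mF g0 C0 gn hq hF.
pose G n := if good n then F n else set0.
apply: filterS (@borel_cantelli_sqr _ _ _ P G (4 * C / g ^+ 2) _ _) => [w|n|n].
- by apply: filterS => n; rewrite /G => h gd; rewrite gd in h.
- by rewrite /G; case: ifP => // /mF.
- rewrite /G; case: ifP => [gd|_]; last first.
    by rewrite measure0 lee_fin !divr_ge0 ?exprn_ge0 ?mulr_ge0 // ltW.
  apply: le_trans (hF _ gd) _; rewrite lee_fin.
  have n0 : 0 < n%:R :> R by rewrite ltr0n gn.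
  have q0 : 0 < q n by apply: lt_le_trans (hq n); exact: mulr_gt0.
  rewrite ler_pdivrMr ?exprn_gt0 //.
  rewrite [leRHS](_ : _ = C * (4 * ((g ^+ 2)^-1 * (q n ^+ 2 / n.+1%:R ^+ 2)))); last by ring.
  rewrite -[leLHS]mulr1 ler_wpM2l //.
  have h1 : n.+1%:R <= 2 * n%:R :> R.
    by rewrite -natr1 mulr_natl mulr2n lerD2l ler1n gn.
  have n1 : 0 < n.+1%:R :> R by rewrite ltr0n.
  have h2 : (g * n.+1%:R) ^+ 2 <= 4 * q n ^+ 2.
    have -> : 4 * q n ^+ 2 = (2 * q n) ^+ 2 by rewrite exprMn; congr (_ * _); rewrite -natrX.
    rewrite lerXn2r ?nnegrE ?mulr_ge0 ?(ltW g0) ?(ltW q0) //.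
    apply: le_trans (_ : g * (2 * n%:R) <= _); first by rewrite ler_wpM2l // ltW.
    by rewrite mulrCA ler_pM2l.
  have -> : 4 * ((g ^+ 2)^-1 * (q n ^+ 2 / n.+1%:R ^+ 2)) = 4 * q n ^+ 2 / (g * n.+1%:R) ^+ 2.
    by rewrite exprMn; field; rewrite !gt_eqF.
  by rewrite ler_pdivlMr ?exprn_gt0 ?mulr_gt0 // mul1r.
Qed.

End Countable.

Section Transpose.
Context {R : realType} {d : measure_display} {T : measurableType d} (P : probability T R).

Lemma random_mx_tr m n (Z : T -> 'M[R]_(m, n)) : random_mx Z -> random_mx (fun w => (Z w)^T).
Proof. by move=> rZ; apply: mxm_random; apply: mxm_tr; exact: random_mxm. Qed.

Lemma independent_mx_tr m n m' n' (Z : T -> 'M[R]_(m, n)) (X : T -> 'M[R]_(m', n')) :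
  independent_mx P Z X -> independent_mx P (fun w => (Z w)^T) (fun w => (X w)^T).
Proof.
have mt k l : measurable_fun setT (fun M : @mxBorel R k l => (M : 'M[R]_(k, l))^T : @mxBorel R l k).
  by apply: (@mxm_random R _ (@mxBorel R k l)); apply: mxm_tr; exact: mxm_id.
move=> h E F mE mF; exact: (h _ _ (mpre (mt _ _) mE) (mpre (mt _ _) mF)).
Qed.

End Transpose.

Section Decoupling.
Context {R : realType} {d : measure_display} {T : measurableType d} (P : probability T R).
Variables (r : nat) (x : 'I_r -> R) (dn dp : nat -> nat) (good : nat -> bool) (g : R).
Variables (A : forall n, T -> 'M[R]_(dn n, r)) (B : forall n, T -> 'M[R]_(dp n, r)).
Variables (Z : forall n, T -> 'M[R]_(dn n, dp n)).
Hypotheses (x_neq0 : forall i, x i != 0) (x_sqr_inj : forall i j, x i ^+ 2 = x j ^+ 2 -> i = j).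
Hypotheses (g0 : 0 < g) (good_gt0 : forall n, good n -> (0 < n)%N).
Hypothesis dn_ge : forall n, g * n%:R <= (dn n)%:R.
Hypothesis uA : forall n, good n -> uniform_frame P (A n).
Hypothesis uB : forall n, good n -> uniform_frame P (B n).
Hypothesis AB : forall n, good n -> independent_mx P (A n) (B n).
Hypothesis rZ : forall n, good n -> random_mx (Z n).
Hypothesis ZX : forall n, good n ->
  independent_mx P (Z n) (fun w => A n w *m diag_mx (\row_i x i) *m (B n w)^T).

Let e_ i : 'cV[R]_r := delta_mx i 0.
Let W n w := Z n w *m (Z n w)^T.

Let dn_gt0 n : good n -> (0 < dn n)%N.
Proof.
move=> gd; rewrite -(ltr0n R); apply: lt_le_trans (dn_ge n).
by rewrite mulr_gt0 // ltr0n good_gt0.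
Qed.

(** The constants range over the naturals so that a single almost sure event
    serves all of them. *)
Lemma quad_ae : {ae P, forall w, forall (k K m : nat) (i j : 'I_r), \forall n \near \oo,
  good n -> \tr ((W n w ^+ k) ^+ 4) <= K%:R * (dn n)%:R ->
  `|\tr (W n w ^+ k)| <= K%:R * (dn n)%:R ->
  `|dot (A n w *m e_ i) (W n w ^+ k *m (A n w *m e_ j)) -
     (i == j)%:R * (\tr (W n w ^+ k) / (dn n)%:R)| < m.+1%:R^-1}.
Proof.
pose M k n (z : 'M[R]_(dn n, dp n)) : 'M[R]_(dn n) := (z *m z^T) ^+ k.
pose F (k K m : nat) i j n : set T := [set w | tame (@M k n) K%:R (Z n w) /\
   m.+1%:R^-1 <= `|dot (A n w *m e_ i) (M k n (Z n w) *m (A n w *m e_ j)) -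
     (i == j)%:R * (\tr (M k n (Z n w)) / (dn n)%:R)|].
have mM k n : mxm (@M k n : @mxBorel R (dn n) (dp n) -> 'M[R]_(dn n)).
  by apply: mxmX; apply: mxm_mul; [exact: mxm_id|apply: mxm_tr; exact: mxm_id].
have sM k n z : (@M k n z)^T = @M k n z.
  rewrite /M; elim: k => [|k IH]; first by rewrite !expr0 trmx1.
  by rewrite exprS -mulmxE trmx_mul IH trmx_mul trmxK mulmxE -exprSr -exprS.
have key k K m i j : {ae P, forall w, \forall n \near \oo, good n -> ~ F k K m i j n w}.
  pose c : R := 288 * (K%:R + K%:R ^+ 4) / m.+1%:R^-1 ^+ 4.
  have c0 : 0 <= c.
    rewrite /c; have h : 0 <= 288 :> R by rewrite ler0n.
    move: (288 : R) h => c1 h; rewrite divr_ge0 ?exprn_ge0 ?invr_ge0 //.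
    by rewrite mulr_ge0 // addr_ge0 // exprn_ge0.
  have c20 : 0 <= 2 * c by exact: (mulr_ge0 (ler0n R 2) c0).
  apply: (borel_cantelli_when (C := 2 * c) (g := g) (q := fun n => (dn n)%:R)) => // n gd.
    have mA := random_mxm (let: And3 h _ _ := uA gd in h); have mZ := rZ gd.
    have h := mxm_comp (mM k n) mZ.
    have mu l : mxm (fun w => A n w *m e_ l) by apply: mxm_mul => //; exact: mxm_cst.
    apply: measurableI.
      apply: measurableI; apply: mx_ler => //; first by apply: mxm_trace; exact: mxmX.
      by apply: measurableT_comp => //; exact: mxm_trace.
    apply: mx_le_norm; apply: measurable_funB.
      by apply: mxm_dot => //; exact: mxm_mul.
    by do 2! [apply: measurable_funM => //]; exact: mxm_trace.
  have e0 : 0 < m.+1%:R^-1 :> R by rewrite invr_gt0 ltr0n.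
  have K0 : 0 <= K%:R :> R by rewrite ler0n.
  have [ij|ij] := eqVneq i j.
    rewrite -ij /F eqxx; under eq_set do rewrite mul1r.
    apply: le_trans (diag_event x_neq0 x_sqr_inj (uA gd) (uB gd) (rZ gd) (ZX gd)
      (dn_gt0 gd) (mM k n) (sM k n) K0 e0 i) _.
    rewrite lee_fin [leLHS]mulrAC -/c ler_wpM2r ?invr_ge0 ?exprn_ge0 //.
    by rewrite mulr_natl mulr2n lerDl.
  rewrite /F (negbTE ij); under eq_set do rewrite mul0r subr0.
  apply: le_trans (offdiag_event x_neq0 x_sqr_inj (uA gd) (uB gd) (rZ gd) (ZX gd)
      (dn_gt0 gd) (mM k n) (sM k n) K0 e0 ij) _.
  by rewrite lee_fin -[leRHS]mulrA /c [X in 2 * X]mulrAC.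
have := ae_forall_count (fun t : nat * nat * nat * 'I_r * 'I_r =>
  key t.1.1.1.1 t.1.1.1.2 t.1.1.2 t.1.2 t.2).
apply: filterS => w hw k K m i j; have := hw (k, K, m, i, j) => /=.
apply: filterS => n h gd t4 t1; rewrite ltNge; apply/negP => h2.
by apply: (h gd).
Qed.

Lemma cross_ae : {ae P, forall w, forall (k K m : nat) (i j : 'I_r), \forall n \near \oo,
  good n -> dot (W n w ^+ k *m (Z n w *m (B n w *m e_ j))) (W n w ^+ k *m (Z n w *m (B n w *m e_ j)))
     <= K%:R ->
  `|dot (A n w *m e_ i) (W n w ^+ k *m (Z n w *m (B n w *m e_ j)))| < m.+1%:R^-1}.
Proof.
pose N k n (z : 'M[R]_(dn n, dp n)) := (z *m z^T) ^+ k *m z.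
pose good' (K m n : nat) := good n && (2 * K%:R <= (dn n)%:R * (m.+1%:R^-1 : R) ^+ 2).
pose F (k K m : nat) i j n : set T := [set w |
   dot (N k n (Z n w) *m (B n w *m e_ j)) (N k n (Z n w) *m (B n w *m e_ j)) <= K%:R /\
   m.+1%:R^-1 <= `|dot (A n w *m e_ i) (N k n (Z n w) *m (B n w *m e_ j))|].
have mN k n : mxm (@N k n : @mxBorel R (dn n) (dp n) -> 'M[R]_(dn n, dp n)).
  apply: mxm_mul; last exact: mxm_id.
  by apply: mxmX; apply: mxm_mul; [exact: mxm_id|apply: mxm_tr; exact: mxm_id].
have key k K m i j : {ae P, forall w, \forall n \near \oo, good' K m n -> ~ F k K m i j n w}.
  pose c : R := 288 * (K%:R ^+ 4 + K%:R ^+ 4) / (m.+1%:R^-1 ^+ 2 / 2) ^+ 4.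
  have e0 : 0 < m.+1%:R^-1 :> R by rewrite invr_gt0 ltr0n.
  have K0 : 0 <= K%:R :> R by rewrite ler0n.
  have c0 : 0 <= c.
    rewrite /c; have h : 0 <= 288 :> R by rewrite ler0n.
    have h2 : 0 < m.+1%:R^-1 ^+ 2 / 2 :> R by rewrite divr_gt0 ?exprn_gt0 // ltr0n.
    move: (288 : R) h => c1 h; rewrite divr_ge0 ?exprn_ge0 ?(ltW h2) //.
    by rewrite mulr_ge0 // addr_ge0 // exprn_ge0.
  apply: (borel_cantelli_when (C := c) (g := g) (q := fun n => (dn n)%:R)) => //.
  - move=> n /andP[gd _].
    have mA := random_mxm (let: And3 h _ _ := uA gd in h); have mZ := rZ gd.
    have mB := random_mxm (let: And3 h _ _ := uB gd in h).
    have h := mxm_comp (mN k n) mZ.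
    have mu l : mxm (fun w => A n w *m e_ l) by apply: mxm_mul => //; exact: mxm_cst.
    have mv l : mxm (fun w => B n w *m e_ l) by apply: mxm_mul => //; exact: mxm_cst.
    have mh : mxm (fun w => N k n (Z n w) *m (B n w *m e_ j)) by exact: mxm_mul.
    apply: measurableI; first by apply: mx_ler => //; exact: mxm_dot.
    by apply: mx_le_norm; exact: mxm_dot.
  - by move=> n /andP[/good_gt0].
  - move=> n /andP[gd Kn].
    apply: le_trans (cross_event x_neq0 x_sqr_inj (uA gd) (uB gd) (AB gd) (rZ gd) (ZX gd)
      (dn_gt0 gd) i j (mN k n) K0 e0 Kn) _.
    by rewrite lee_fin [leLHS]mulrAC -/c.
have := ae_forall_count (fun t : nat * nat * nat * 'I_r * 'I_r =>
  key t.1.1.1.1 t.1.1.1.2 t.1.1.2 t.1.2 t.2).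
apply: filterS => w hw k K m i j; have := hw (k, K, m, i, j) => /=.
have e2 : 0 < m.+1%:R^-1 ^+ 2 :> R by rewrite exprn_gt0 // invr_gt0 ltr0n.
have large : \forall n \near \oo, 2 * K%:R <= (dn n)%:R * m.+1%:R^-1 ^+ 2 :> R.
  near=> n; rewrite -ler_pdivrMr //; apply: le_trans (dn_ge n).
  by rewrite [leRHS]mulrC -ler_pdivrMr //; near: n; exact: nbhs_infty_ger.
apply: filterS2 large => n ln h gd hK; rewrite ltNge; apply/negP => h2.
by apply: h; rewrite /good' ?gd ?ln // /F /= /N -!mulmxA.
Unshelve. all: by end_near.
Qed.

End Decoupling.

Lemma measurable_inv (R : realType) : measurable_fun setT (fun x : R => x^-1).
Proof.
rewrite -(setUv [set (0 : R)]); apply/measurable_funU => //; first exact: measurableC.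
split.
  apply: (@eq_measurable_fun _ _ R R [set 0] (fun=> 0)); last exact: measurable_cst.
  by move=> x; rewrite inE /= => ->; rewrite invr0.
apply: open_continuous_measurable_fun.
  by rewrite openC; exact: (@accessible_closed_set1 R (@hausdorff_accessible _ (@norm_hausdorff R R^o)) 0).
by move=> x; rewrite inE /= => x0; apply: inv_continuous; apply/eqP.
Qed.

(** * Stieltjes transforms of a positive functional *)

Definition supp {R : realType} (z : R) : set (measurableTypeR R) := [set t : R | 0 <= t <= z].

(** Expectations for a probability law carried by [supp z], as far as bounded
    functions see them. This treats alike the law of the singular values and its
    mixture with an atom at 0. *)
Record posfun (R : realType) (z : R) (L : (R -> R) -> R) : Prop := PosFun {
  pf_D : forall f g : R -> R, nice (supp z) f -> nice (supp z) g ->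
    L (fun t => f t + g t) = L f + L g;
  pf_Z : forall k (f : R -> R), nice (supp z) f -> L (fun t => k * f t) = k * L f;
  pf_le : forall f g : R -> R, nice (supp z) f -> nice (supp z) g ->
    (forall t : R, supp z t -> f t <= g t) -> L f <= L g;
  pf_1 : forall k, L (fun=> k) = k }.

Section Functional.
Context {R : realType} (z : R).
Hypothesis z_gt0 : 0 < z.
Notation supp := (supp z).
Notation nice f := (@nice R _ (measurableTypeR R) supp (f : R -> R)).

Variable L : (R -> R) -> R.
Hypothesis pf : posfun z L.
Let LD : forall f g : R -> R, nice f -> nice g -> L (fun t => f t + g t) = L f + L g := pf_D pf.
Let LZ : forall k (f : R -> R), nice f -> L (fun t => k * f t) = k * L f := pf_Z pf.
Let Lle : forall f g : R -> R, nice f -> nice g -> (forall t : R, supp t -> f t <= g t) -> L f <= L g := pf_le pf.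
Let L1 : forall k, L (fun=> k) = k := pf_1 pf.

Lemma LB (f g : R -> R) : nice f -> nice g -> L (fun t => f t - g t) = L f - L g.
Proof.
move=> hf hg; have hn : nice (fun t => -1 * g t) by apply: niceM => //; exact: nice_cst.
rewrite -[in RHS]mulN1r -LZ // -LD //; congr L; apply/funext => t.
by rewrite mulN1r.
Qed.

Lemma L_abs (f : R -> R) C : nice f -> (forall t : R, supp t -> `|f t| <= C) -> `|L f| <= C.
Proof.
move=> hf h; rewrite ler_norml; apply/andP; split.
  rewrite -(L1 (- C)); apply: Lle => //; first exact: nice_cst.
  by move=> c Dc; move: (h _ Dc); rewrite ler_norml => /andP[].
rewrite -(L1 C); apply: Lle => //; first exact: nice_cst.
by move=> c Dc; move: (h _ Dc); rewrite ler_norml => /andP[].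
Qed.

Lemma L_lim (f : nat -> R -> R) (g : R -> R) (e : nat -> R) : (forall n, nice (f n)) -> nice g ->
  (forall n (t : R), supp t -> `|f n t - g t| <= e n) -> e n @[n --> \oo] --> (0 : R) ->
  L (f n) @[n --> \oo] --> (L g : R).
Proof.
move=> hf hg h he; apply/cvgrPdist_lt => d d0; near=> n.
rewrite distrC -LB //; apply: le_lt_trans (L_abs (niceB (hf n) hg) (h n)) _.
by apply: le_lt_trans (ler_norm _) _; rewrite -[e n]subr0; near: n; exact: cvgr_distC_lt.
Unshelve. all: by end_near.
Qed.

Lemma supp_sqr t : supp t -> 0 <= t ^+ 2 <= z ^+ 2.
Proof.
by move=> /andP[t0 tz]; rewrite sqr_ge0 lerXn2r ?nnegrE // ltW.
Qed.

Lemma nice_id : nice id.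
Proof.
split; first exact: measurable_id.
by exists z => t /andP[t0 tz]; rewrite ger0_norm.
Qed.

Lemma nice_poly (P : {poly R}) : nice (fun t => P.[t ^+ 2]).
Proof.
rewrite (_ : (fun t => _) = fun t => \sum_(i < size P) P`_i * (t ^+ 2) ^+ i).
  apply: nice_sum => i; apply: niceM; first exact: nice_cst.
  by apply: niceX; apply: niceX; exact: nice_id.
by apply/funext => t; rewrite horner_coef.
Qed.

(** The resolvent kernel. *)
Definition rk (lam t : R) := (lam - t ^+ 2)^-1.

Lemma rk_bound lam t : z ^+ 2 < lam -> supp t ->
  [/\ 0 < rk lam t, lam^-1 <= rk lam t, rk lam t <= (lam - z ^+ 2)^-1 & rk lam t * (lam - t ^+ 2) = 1].
Proof.
move=> hl /supp_sqr /andP[t0 tz].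
have h1 : 0 < lam - z ^+ 2 by rewrite subr_gt0.
have h2 : 0 < lam - t ^+ 2 by rewrite subr_gt0 (le_lt_trans tz).
have h3 : 0 < lam by apply: le_lt_trans hl; exact: sqr_ge0.
split; rewrite /rk ?invr_gt0 // ?lef_pV2 ?posrE ?lerD2l ?lerN2 //.
  by rewrite gerBl.
by rewrite mulVf // gt_eqF.
Qed.

Lemma nice_rk lam : z ^+ 2 < lam -> nice (rk lam).
Proof.
move=> hl; split.
  apply: (measurableT_comp (@measurable_inv R)).
  exact: (niceB (nice_cst _ lam) (niceX 2 nice_id)).1.
exists (lam - z ^+ 2)^-1 => t st; have [h1 _ h2 _] := rk_bound hl st.
by rewrite gtr0_norm.
Qed.

(** The Stieltjes transform of the image of the law by the square. *)
Definition SL lam := L (rk lam).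
(** Minus the derivative of [SL]. *)
Definition QL lam := L (fun t => rk lam t ^+ 2).

Lemma SL_ge lam : z ^+ 2 < lam -> lam^-1 <= SL lam.
Proof.
move=> hl; rewrite -[leLHS]L1; apply: Lle; [exact: nice_cst|exact: nice_rk|].
by move=> t st; have [] := rk_bound hl st.
Qed.

Lemma SL_le lam : z ^+ 2 < lam -> SL lam <= (lam - z ^+ 2)^-1.
Proof.
move=> hl; rewrite -[leRHS]L1; apply: Lle; [exact: nice_rk|exact: nice_cst|].
by move=> t st; have [] := rk_bound hl st.
Qed.

Lemma lam_gt0 lam : z ^+ 2 < lam -> 0 < lam.
Proof. by apply: le_lt_trans; exact: sqr_ge0. Qed.

Lemma SL_gt0 lam : z ^+ 2 < lam -> 0 < SL lam.
Proof. by move=> hl; apply: lt_le_trans (SL_ge hl); rewrite invr_gt0 lam_gt0. Qed.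

(** Jensen's inequality for the square. *)
Lemma QL_ge lam : z ^+ 2 < lam -> SL lam ^+ 2 <= QL lam.
Proof.
move=> hl; have hn := nice_rk hl; set s := SL lam.
have n2 : nice (fun t => 2 * s * rk lam t) by apply: niceM => //; exact: nice_cst.
have : L (fun t => 2 * s * rk lam t - s ^+ 2) <= QL lam.
  apply: Lle; [by apply: niceB => //; exact: nice_cst|exact: niceX|].
  by move=> t _; have := sqr_ge0 (rk lam t - s); lra.
by rewrite LB ?L1 ?LZ -/(SL _) -/s //; [nra|exact: nice_cst].
Qed.

Lemma QL_gt0 lam : z ^+ 2 < lam -> 0 < QL lam.
Proof. by move=> hl; apply: lt_le_trans (QL_ge hl); rewrite exprn_gt0 // SL_gt0. Qed.

Lemma QL_le lam : z ^+ 2 < lam -> QL lam <= (lam - z ^+ 2)^-1 * SL lam.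
Proof.
move=> hl; have hn := nice_rk hl; rewrite -LZ //; apply: Lle; first exact: niceX.
  by apply: niceM => //; exact: nice_cst.
move=> t st; have [h1 _ h2 _] := rk_bound hl st.
by rewrite expr2 ler_pM2r.
Qed.
Lemma rk_diff lam lam' t : z ^+ 2 < lam -> z ^+ 2 < lam' -> supp t ->
  rk lam' t - rk lam t = (lam - lam') * (rk lam t * rk lam' t).
Proof.
move=> hl hl' st; have [_ _ _ e1] := rk_bound hl st; have [_ _ _ e2] := rk_bound hl' st.
rewrite -[X in X - _]mulr1 -e1 -[X in _ - X]mulr1 -e2; ring.
Qed.

Section Local.
Variable c : R.
Hypothesis hc : z ^+ 2 < c.
Let M := (c - z ^+ 2)^-1.

Let M0 : 0 <= M. Proof. by rewrite /M invr_ge0 subr_ge0 ltW. Qed.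

Let rkM lam t : c <= lam -> supp t -> 0 <= rk lam t <= M.
Proof.
move=> cl st; have [h1 _ h2 _] := rk_bound (lt_le_trans hc cl) st.
rewrite ltW //=; apply: le_trans h2 _; rewrite /M lef_pV2 ?posrE ?subr_gt0 ?(lt_le_trans hc) //.
by rewrite lerD2r.
Qed.

(** The second order remainder, uniform on half-lines away from the edge:
    differentiation under the expectation without dominated convergence. *)
Lemma SL_taylor lam lam' : c <= lam -> c <= lam' ->
  `|SL lam' - SL lam + (lam' - lam) * QL lam| <= (lam' - lam) ^+ 2 * M ^+ 3.
Proof.
move=> cl cl'; have hl := lt_le_trans hc cl; have hl' := lt_le_trans hc cl'.
have n1 := nice_rk hl; have n2 := nice_rk hl'; have n3 := niceX 2 n1.
have n4 : nice (fun t => rk lam' t - rk lam t) by exact: niceB.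
have n5 : nice (fun t => (lam' - lam) * rk lam t ^+ 2) by apply: niceM => //; exact: nice_cst.
rewrite /QL -LZ // /SL -LB // -LD //; apply: L_abs; first exact: niceD.
move=> t st; rewrite rk_diff //.
have -> : (lam - lam') * (rk lam t * rk lam' t) + (lam' - lam) * rk lam t ^+ 2 =
  (lam' - lam) * rk lam t * - (rk lam' t - rk lam t) by ring.
rewrite rk_diff //.
have -> : (lam' - lam) * rk lam t * - ((lam - lam') * (rk lam t * rk lam' t)) =
  (lam' - lam) ^+ 2 * (rk lam t * rk lam t * rk lam' t) by ring.
have /andP[h1 h2] := rkM cl st; have /andP[h3 h4] := rkM cl' st.
rewrite ger0_norm; last by rewrite mulr_ge0 ?sqr_ge0 ?mulr_ge0.
rewrite ler_wpM2l ?sqr_ge0 // !exprS expr0 mulr1 mulrA.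
by rewrite ler_pM ?mulr_ge0 // ler_pM.
Qed.

Lemma QL_lip lam lam' : c <= lam -> c <= lam' ->
  `|QL lam' - QL lam| <= `|lam' - lam| * (2 * M ^+ 3).
Proof.
move=> cl cl'; have hl := lt_le_trans hc cl; have hl' := lt_le_trans hc cl'.
have n1 := niceX 2 (nice_rk hl); have n2 := niceX 2 (nice_rk hl').
rewrite /QL -LB //; apply: L_abs; first exact: niceB.
move=> t st; rewrite subr_sqr rk_diff // -mulrA normrM distrC ler_wpM2l //.
have /andP[h1 h2] := rkM cl st; have /andP[h3 h4] := rkM cl' st.
rewrite ger0_norm; last by rewrite !mulr_ge0 // addr_ge0.
have -> : 2 * M ^+ 3 = M * M * (M + M) by ring.
by apply: ler_pM; rewrite ?mulr_ge0 ?addr_ge0 // ?ler_pM // lerD.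
Qed.

End Local.

Lemma SL_derive lam : z ^+ 2 < lam -> is_derive lam 1 SL (- QL lam).
Proof.
move=> hl; set c := (lam + z ^+ 2) / 2.
have hc : z ^+ 2 < c by rewrite /c; lra.
have cl : c < lam by rewrite /c; lra.
set M := (c - z ^+ 2)^-1; have M0 : 0 < M by rewrite /M invr_gt0 subr_gt0.
have lim : h^-1 *: ((SL \o shift lam) (h *: (1 : R)) - SL lam) @[h --> (0 : R)^'] --> - QL lam.
  apply/cvgrPdist_lt => e e0.
  have m0 : 0 < Num.min (lam - c) (e / M ^+ 3).
    by rewrite lt_min subr_gt0 cl divr_gt0 ?exprn_gt0.
  near=> h.
  have h0 : h != 0 by near: h; exact: nbhs_dnbhs_neq.
  have hs : `|h| < Num.min (lam - c) (e / M ^+ 3) by near: h; exact: dnbhs0_lt.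
  move: hs; rewrite lt_min => /andP[h1 h2].
  have cl' : c <= h + lam by move: h1; rewrite ltr_norml => /andP[? _]; lra.
  have := SL_taylor hc (ltW cl) cl'; rewrite addrK => hT.
  rewrite /= [h *: 1]mulr1 -[_ *: _]/(_ * _) distrC opprK.
  have -> : h^-1 * (SL (h + lam) - SL lam) + QL lam =
     h^-1 * (SL (h + lam) - SL lam + h * QL lam).
    by rewrite [RHS]mulrDr mulKf.
  rewrite normrM normfV; have hp : 0 < `|h| by rewrite normr_gt0.
  rewrite ltr_pdivrMl //; apply: le_lt_trans hT _.
  rewrite -real_normK ?num_real // expr2 -mulrA ltr_pM2l //.
  by rewrite -ltr_pdivlMr ?exprn_gt0.
apply: DeriveDef; first by apply/cvg_ex; exists (- QL lam); exact: lim.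
exact: cvg_lim lim.
Unshelve. all: by end_near.
Qed.

Lemma QL_continuous lam : z ^+ 2 < lam -> {for lam, continuous QL}.
Proof.
move=> hl; set c := (lam + z ^+ 2) / 2.
have hc : z ^+ 2 < c by rewrite /c; lra.
have cl : c < lam by rewrite /c; lra.
set M := (c - z ^+ 2)^-1; have M0 : 0 < M by rewrite /M invr_gt0 subr_gt0.
have MM : 0 < 2 * M ^+ 3 by rewrite mulr_gt0 ?exprn_gt0.
apply/cvgrPdist_lt => e e0; near=> l.
have cl' : c <= l by near: l; exact: (cvgr_ge lam cvg_id).
rewrite distrC; apply: le_lt_trans (QL_lip hc (ltW cl) cl') _.
rewrite -ltr_pdivlMr //; near: l.
by apply: cvgr_distC_lt; [exact: cvg_id|exact: divr_gt0].
Unshelve. all: by end_near.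
Qed.

Lemma SL_continuous lam : z ^+ 2 < lam -> {for lam, continuous SL}.
Proof.
move=> hl; apply: differentiable_continuous; apply/derivable1_diffP.
by have [] := SL_derive hl.
Qed.

(** Strict decrease with an explicit gap, in the form needed for the product
    with the level. *)
Lemma SL_decr l l' : z < l -> l < l' -> l^-1 - l'^-1 <= l * SL (l ^+ 2) - l' * SL (l' ^+ 2).
Proof.
move=> zl ll'; have l0 : 0 < l by apply: lt_trans zl.
have l'0 : 0 < l' by apply: lt_trans ll'.
have hs a : z < a -> z ^+ 2 < a ^+ 2.
  by move=> za; rewrite ltrXn2r ?nnegrE ?(ltW z_gt0) // ltW // (lt_trans z_gt0).
have hl := hs _ zl; have hl' := hs _ (lt_trans zl ll').
have n1 : nice (fun t => l * rk (l ^+ 2) t) by apply: niceM; [exact: nice_cst|exact: nice_rk].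
have n2 : nice (fun t => l' * rk (l' ^+ 2) t) by apply: niceM; [exact: nice_cst|exact: nice_rk].
rewrite /SL -(LZ l (nice_rk hl)) -(LZ l' (nice_rk hl')) -LB // -[leLHS]L1; apply: Lle => //; [exact: nice_cst|exact: niceB|].
move=> t st; have [a1 a2 _ a3] := rk_bound hl st; have [b1 b2 _ b3] := rk_bound hl' st.
have -> : l * rk (l ^+ 2) t - l' * rk (l' ^+ 2) t =
  (l' - l) * (l * l' + t ^+ 2) * (rk (l ^+ 2) t * rk (l' ^+ 2) t).
  rewrite -[X in X - _]mulr1 -b3 -[X in _ - X]mulr1 -a3; ring.
have -> : l^-1 - l'^-1 = (l' - l) * (l * l') * ((l ^+ 2)^-1 * (l' ^+ 2)^-1).
  by field; rewrite !gt_eqF.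
have d0 : 0 < l' - l by rewrite subr_gt0.
apply: ler_pM.
- by rewrite !mulr_ge0 // ltW.
- by rewrite mulr_ge0 // invr_ge0 sqr_ge0.
- by rewrite ler_pM2l // lerDl sqr_ge0.
- by apply: ler_pM; rewrite ?invr_ge0 ?sqr_ge0.
Qed.

(** Chebyshev's correlation inequality: [rk lam / rk lam'] is an increasing
    affine function of [rk lam], so that [rk lam - k * rk lam'] has the sign of
    [rk lam - r0] for some [r0], where [k] is chosen to give it mean zero. *)
Lemma kappa_decr lam lam' : z ^+ 2 < lam -> lam <= lam' ->
  lam' * QL lam' * SL lam <= lam * QL lam * SL lam'.
Proof.
move=> hl; rewrite le_eqVlt => /predU1P[<-|ll']; first by [].
have hl' := lt_trans hl ll'.
have l0 := lam_gt0 hl; have l'0 := lam_gt0 hl'.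
have n1 := nice_rk hl; have n2 := nice_rk hl'.
have n12 : nice (fun t => rk lam t * rk lam' t) by exact: niceM.
have d0 : 0 < lam' - lam by rewrite subr_gt0.
have s0 := SL_gt0 hl; have s'0 := SL_gt0 hl'.
set k := SL lam / SL lam'.
have ks : k * SL lam' = SL lam by rewrite /k divfK // gt_eqF.
(* the value of the kernel at which [rk lam = k * rk lam'] *)
set r0 := (k - 1) / (lam' - lam).
have dr : (lam' - lam) * r0 = k - 1 by rewrite /r0 mulrC divfK // gt_eqF.
have corr : k * L (fun t => rk lam t * rk lam' t) <= QL lam.
  have m1 : nice (fun t => k * (rk lam t * rk lam' t) + r0 * rk lam t).
    by apply: niceD; apply: niceM => //; exact: nice_cst.
  have m2 : nice (fun t => rk lam t ^+ 2 + r0 * k * rk lam' t).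
    by apply: niceD; [exact: niceX|apply: niceM => //; exact: nice_cst].
  have : L (fun t => k * (rk lam t * rk lam' t) + r0 * rk lam t) <=
         L (fun t => rk lam t ^+ 2 + r0 * k * rk lam' t).
    apply: Lle => // t st.
    have [a1 _ _ _] := rk_bound hl st; have [b1 _ _ _] := rk_bound hl' st.
    rewrite -subr_ge0.
    have -> : rk lam t ^+ 2 + r0 * k * rk lam' t - (k * (rk lam t * rk lam' t) + r0 * rk lam t) =
       (rk lam t - r0) * (rk lam t - k * rk lam' t) by ring.
    have -> : rk lam t - k * rk lam' t = rk lam' t * ((lam' - lam) * (rk lam t - r0)).
      have := rk_diff hl hl' st; rewrite mulrBr dr => h.
      have {1}-> : rk lam t = rk lam' t - (lam - lam') * (rk lam t * rk lam' t) by rewrite -h; ring.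
      ring.
    rewrite (_ : _ * _ = (rk lam t - r0) ^+ 2 * (rk lam' t * (lam' - lam))); last by ring.
    by rewrite mulr_ge0 ?sqr_ge0 // mulr_ge0 // ltW.
  rewrite !LD ?LZ //; try (by apply: niceM => //; exact: nice_cst); try exact: niceX.
  by rewrite -/(SL lam) -/(SL lam') -mulrA ks lerD2r.
have mono : lam' * QL lam' <= lam * L (fun t => rk lam t * rk lam' t).
  rewrite /QL -!LZ //; last exact: niceX.
  apply: Lle; try (by apply: niceM => //; first exact: nice_cst; exact: niceX).
  move=> t st; have [a1 _ _ a2] := rk_bound hl st; have [b1 _ _ b2] := rk_bound hl' st.
  rewrite expr2 !mulrA ler_pM2r //.
  have -> : lam' * rk lam' t = lam' * (lam - t ^+ 2) * (rk lam t * rk lam' t).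
    by rewrite -[LHS]mulr1 -a2; ring.
  have -> : lam * rk lam t = lam * (lam' - t ^+ 2) * (rk lam t * rk lam' t).
    by rewrite -[LHS]mulr1 -b2; ring.
  rewrite ler_pM2r ?mulr_gt0 // !mulrBr [lam' * lam]mulrC lerD2l lerN2.
  by rewrite ler_wpM2r ?sqr_ge0 // ltW.
apply: le_trans (_ : lam * L (fun t => rk lam t * rk lam' t) * SL lam <= _).
  by rewrite ler_pM2r.
by rewrite -ks mulrA ler_pM2r // -!mulrA ler_pM2l // mulrC.
Qed.

Definition LP (P : {poly R}) := L (fun t => P.[t ^+ 2]).

Lemma neumann_horner l N t : z < l -> supp t ->
  (neumann l N).[t ^+ 2] = rk (l ^+ 2) t * (1 - (l ^- 2 * t ^+ 2) ^+ N).
Proof.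
move=> zl st; have l0 : l != 0 by rewrite gt_eqF // (lt_trans z_gt0).
have hl : z ^+ 2 < l ^+ 2.
  by rewrite ltrXn2r ?nnegrE ?(ltW z_gt0) // ltW // (lt_trans z_gt0).
have [_ _ _ e] := rk_bound hl st.
have E : (neumann l N).[t ^+ 2] * (l ^+ 2 - t ^+ 2) = 1 - (l ^- 2 * t ^+ 2) ^+ N.
  have := congr1 (fun P => P.[t ^+ 2]) (neumannE N l0).
  by rewrite hornerM hornerD hornerN hornerX hornerC hornerD hornerN hornerZ hornerXn hornerC -exprMn.
by rewrite -E mulrC -mulrA [X in _ * X]mulrC e mulr1.
Qed.

Section NeumannLimits.
Variable l : R.
Hypothesis zl : z < l.
Let rho := l ^- 2 * z ^+ 2.
Let M := (l ^+ 2 - z ^+ 2)^-1.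

Let hl : z ^+ 2 < l ^+ 2.
Proof. by rewrite ltrXn2r ?nnegrE ?(ltW z_gt0) // ltW // (lt_trans z_gt0). Qed.

Let l2 : 0 < l ^+ 2. Proof. exact: lam_gt0 hl. Qed.

Let rho_lim c : c * rho ^+ n @[n --> \oo] --> (0 : R).
Proof.
rewrite -(mulr0 c); apply: cvgM; first exact: cvg_cst.
apply: cvg_expr; rewrite ger0_norm; last by rewrite mulr_ge0 ?sqr_ge0 // invr_ge0 ltW.
by rewrite /rho mulrC ltr_pdivrMr // mul1r.
Qed.

Let delta t N : supp t -> 0 <= (l ^- 2 * t ^+ 2) ^+ N <= rho ^+ N /\ (l ^- 2 * t ^+ 2) ^+ N <= 1.
Proof.
move=> /supp_sqr /andP[t0 tz].
have l20 : 0 <= l ^- 2 by rewrite invr_ge0 ltW.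
have h : 0 <= l ^- 2 * t ^+ 2 by exact: mulr_ge0.
have h' : l ^- 2 * t ^+ 2 <= rho by exact: ler_wpM2l.
split; first by rewrite exprn_ge0 //= lerXn2r ?nnegrE // (le_trans h).
rewrite exprn_ile1 // mulrC ler_pdivrMr // mul1r.
by apply: le_trans tz _; exact: ltW.
Qed.

Lemma neumann_lim : LP (neumann l N) @[N --> \oo] --> (SL (l ^+ 2) : R).
Proof.
apply: (L_lim (fun N => nice_poly (neumann l N)) (nice_rk hl) _ (rho_lim M)) => N t st.
rewrite neumann_horner // mulrBr mulr1 addrAC subrr add0r normrN.
have [/andP[d0 d1] _] := delta N st; have [h1 _ h2 _] := rk_bound hl st.
by rewrite ger0_norm ?mulr_ge0 ?(ltW h1) // ler_pM // ltW.
Qed.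

Let err t N : supp t -> `|(neumann l N).[t ^+ 2] ^+ 2 - rk (l ^+ 2) t ^+ 2| <= M ^+ 2 * 2 * rho ^+ N.
Proof.
move=> st; rewrite neumann_horner // exprMn -[X in _ - X]mulr1 -mulrBr.
have [/andP[d0 d1] d2] := delta N st; have [h1 _ h2 _] := rk_bound hl st.
move: d0 d1 d2; set dl := (_ ^+ N) => d0 d1 d2.
rewrite (_ : (1 - dl) ^+ 2 - 1 = - (dl * (2 - dl))); last by ring.
have hd : 0 <= dl * (2 - dl) by apply: mulr_ge0 => //; lra.
have hr : 0 <= rk (l ^+ 2) t ^+ 2 by exact: sqr_ge0.
rewrite mulrN normrN (ger0_norm (mulr_ge0 hr hd)) -[leRHS]mulrA; apply: ler_pM => //.
  by rewrite lerXn2r ?nnegrE ?(ltW h1) // (le_trans (ltW h1)).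
by rewrite [leRHS]mulrC; apply: ler_pM => //; lra.
Qed.

Lemma neumann_sqr_lim : LP (neumann l N ^+ 2) @[N --> \oo] --> (QL (l ^+ 2) : R).
Proof.
apply: (L_lim (fun N => nice_poly (neumann l N ^+ 2)) (niceX 2 (nice_rk hl)) _ (rho_lim (M ^+ 2 * 2))).
by move=> N t st; rewrite horner_exp; exact: err.
Qed.

Lemma neumann_X_lim : LP ('X * neumann l N ^+ 2) @[N --> \oo] -->
  (l ^+ 2 * QL (l ^+ 2) - SL (l ^+ 2) : R).
Proof.
have n1 := nice_rk hl; have n2 := niceX 2 n1.
have n3 : nice (fun t => l ^+ 2 * rk (l ^+ 2) t ^+ 2) by apply: niceM => //; exact: nice_cst.
rewrite /QL /SL -LZ // -LB //.
apply: (L_lim (fun N => nice_poly ('X * neumann l N ^+ 2)) (niceB n3 n1) _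
  (rho_lim (z ^+ 2 * (M ^+ 2 * 2)))).
move=> N t st; rewrite hornerM hornerX horner_exp.
have [h1 _ _ e] := rk_bound hl st.
have -> : l ^+ 2 * rk (l ^+ 2) t ^+ 2 - rk (l ^+ 2) t = t ^+ 2 * rk (l ^+ 2) t ^+ 2.
  by rewrite -[X in _ - X]mulr1 -e; ring.
have /andP[t0 tz] := supp_sqr st.
rewrite -mulrBr normrM ger0_norm // -[leRHS]mulrA; apply: ler_pM => //.
exact: err.
Qed.

End NeumannLimits.

Section Edge.
Let Lz := z ^+ 2.
Let Lz0 : 0 < Lz. Proof. by rewrite exprn_gt0. Qed.
Let Lzn : Lz != 0. Proof. by rewrite gt_eqF. Qed.

Let sc t := Lz^-1 * (z ^+ 2 - t ^+ 2).

Let sc01 t : supp t -> 0 <= 1 - sc t ^+ 2 <= 1.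
Proof.
move=> /supp_sqr /andP[t0 tz].
have s0 : 0 <= sc t by rewrite mulr_ge0 ?invr_ge0 ?(ltW Lz0) // subr_ge0.
have s1 : sc t <= 1 by rewrite /sc mulrC ler_pdivrMr // mul1r gerBl.
by rewrite gerBl sqr_ge0 andbT subr_ge0 exprn_ile1.
Qed.

Let edgep_horner N t : (edgep z Lz N).[t ^+ 2] = Lz ^- 2 * \sum_(k < N) (1 - sc t ^+ 2) ^+ k.
Proof.
rewrite /edgep hornerZ horner_sum; congr (_ * _); apply: eq_bigr => k _.
by rewrite horner_exp !hornerE.
Qed.

Let edgep_ge0 N t : supp t -> 0 <= (edgep z Lz N).[t ^+ 2].
Proof.
move=> /sc01 /andP[h _]; rewrite edgep_horner mulr_ge0 ?invr_ge0 ?sqr_ge0 //.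
by apply: sumr_ge0 => k _; exact: exprn_ge0.
Qed.

Lemma edgep_X_ge0 N : 0 <= LP ('X * edgep z Lz N).
Proof.
rewrite -(L1 0); apply: Lle => [||t st]; [exact: nice_cst|exact: nice_poly|].
by rewrite hornerM hornerX mulr_ge0 ?sqr_ge0 ?edgep_ge0.
Qed.

(** Where [z ^+ 2 - t ^+ 2] is at least [lam - z ^+ 2] the geometric sum has
    almost converged; closer to the edge it is larger than at that distance. *)
Lemma edgep_big : (forall K, exists lam, [/\ z ^+ 2 < lam, lam <= 2 * z ^+ 2 & K <= QL lam]) ->
  forall K, exists M, K <= LP (edgep z Lz M.*2).
Proof.
move=> div K; have [lam [hl l2 hK]] := div (2 * K).
(* the distance to the edge in the scale of the polynomial approximation *)
pose de := Lz^-1 * (lam - z ^+ 2).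
have de0 : 0 < de by rewrite mulr_gt0 ?invr_gt0 // subr_gt0.
have de1 : de <= 1 by rewrite /de mulrC ler_pdivrMr // /Lz; lra.
have q0 : 0 <= 1 - de ^+ 2 by rewrite subr_ge0 exprn_ile1 // ltW.
have q1 : `|1 - de ^+ 2| < 1 by rewrite ger0_norm // gtrBl exprn_gt0.
have [M hM] : exists M, (1 - de ^+ 2) ^+ M.*2 <= 2^-1.
  have := @cvg_expr R _ q1 => /cvgrPdist_le /(_ 2^-1); rewrite invr_gt0 ltr0n => /(_ isT) [M _ h].
  exists M; have := h M.*2; rewrite /= -addnn leq_addr => /(_ isT).
  by rewrite sub0r normrN; apply: le_trans; exact: ler_norm.
exists M; rewrite -(ler_pM2l (_ : 0 < 2)) //; apply: le_trans hK _.
rewrite /LP -LZ; last exact: nice_poly.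
apply: Lle; [by apply: niceX; exact: nice_rk|by apply: niceM; [exact: nice_cst|exact: nice_poly]|].
move=> t st; have [h1 _ h2 e] := rk_bound hl st; rewrite edgep_horner.
have /andP[c0 c1] := sc01 st; have /andP[t0 tz] := supp_sqr st.
have s0 : 0 <= sc t by rewrite mulr_ge0 ?invr_ge0 ?(ltW Lz0) // subr_ge0.
have geom : 1 <= 2 * (de ^+ 2 * \sum_(k < M.*2) (1 - de ^+ 2) ^+ k).
  have := subrX1 (1 - de ^+ 2) M.*2; move: (\sum_(k < _) _) => S hS.
  have -> : de ^+ 2 * S = 1 - (1 - de ^+ 2) ^+ M.*2 by rewrite -[RHS]opprB hS; ring.
  lra.
have geom' (s : R) : de <= s -> s <= 1 -> 1 <= 2 * (s ^+ 2 * \sum_(k < M.*2) (1 - s ^+ 2) ^+ k).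
  move=> ds s1'; have := subrX1 (1 - s ^+ 2) M.*2; move: (\sum_(k < _) _) => S hS.
  have -> : s ^+ 2 * S = 1 - (1 - s ^+ 2) ^+ M.*2 by rewrite -[RHS]opprB hS; ring.
  have : (1 - s ^+ 2) ^+ M.*2 <= (1 - de ^+ 2) ^+ M.*2.
    rewrite lerXn2r ?nnegrE ?subr_ge0 ?exprn_ile1 ?(le_trans (ltW de0)) //.
    by rewrite lerD2l lerN2 lerXn2r ?nnegrE ?(ltW de0) // (le_trans (ltW de0)).
  lra.
have Ll : lam - t ^+ 2 = Lz * (de + sc t).
  by rewrite /de /sc; field.
have rE : rk lam t = Lz^-1 * (de + sc t)^-1 by rewrite /rk Ll invfM.
rewrite rE exprMn !exprVn [leRHS]mulrCA; apply: ler_wpM2l; first by rewrite invr_ge0 sqr_ge0.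
have ds0 : 0 < de + sc t by apply: ltr_wpDr.
rewrite -[leLHS]mul1r ler_pdivrMr ?exprn_gt0 //.
have S0 (s : R) : 0 <= 1 - s ^+ 2 -> 0 <= \sum_(k < M.*2) (1 - s ^+ 2) ^+ k.
  by move=> h; apply: sumr_ge0 => k _; exact: exprn_ge0.
have [sd|ds] := lerP (sc t) de.
  apply: le_trans geom _; rewrite -[leRHS]mulrA ler_pM2l // [leRHS]mulrC.
  apply: ler_pM; rewrite ?sqr_ge0 ?S0 //.
    by rewrite lerXn2r ?nnegrE ?(ltW de0) ?(ltW ds0) // lerDl.
  apply: ler_sum => k _; rewrite lerXn2r ?nnegrE // lerD2l lerN2.
  by rewrite lerXn2r ?nnegrE ?(ltW de0).
have s1 : sc t <= 1 by rewrite /sc mulrC ler_pdivrMr // mul1r gerBl.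
apply: le_trans (geom' _ (ltW ds) s1) _; rewrite -[leRHS]mulrA ler_pM2l // [leRHS]mulrC.
apply: ler_pM; rewrite ?sqr_ge0 ?S0 //.
by rewrite lerXn2r ?nnegrE ?(ltW ds0) // lerDr ltW.
Qed.

End Edge.
End Functional.

(** * The limiting spectral functionals *)

Section NoiseLaw.
Context {R : realType} (F : cumulativeBounded (0 : R) (1 : R)).
Let zp := upper_edge F.
Let mu : probability (measurableTypeR R) R := lebesgue_stieltjes_measure F.
Hypotheses (cmp : compactly_supported_cdf F) (zp_gt0 : 0 < zp)
  (F_neg : forall t, t < 0 -> F t = 0).

Lemma cdf_above t : zp <= t -> F t = 1.
Proof.
have [K [_ FK]] := cmp.
have nd : nondecreasing F := cumulative_is_nondecreasing F.
have le1 s : F s <= 1.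
  have c := @cumulativey _ _ _ F.
  apply: (@ler_cvg_to _ _ _ _ (fun=> F s) F (F s) 1 (@cvg_cst _ _ _ _ _) c).
  by near=> a; apply: nd; near: a; exact: nbhs_pinfty_ge.
have hs : has_sup [set t | F t < 1].
  split; first by exists (-1); rewrite /= F_neg ?ltrN10.
  exists K => s /= Fs; rewrite leNgt; apply/negP => Kt.
  by have := nd _ _ (ltW Kt); rewrite FK leNgt Fs.
have above s : zp < s -> F s = 1.
  move=> zt; apply/le_anti; rewrite le1 /= leNgt; apply/negP => Ft.
  by have := ub_le_sup (proj2 hs) Ft; rewrite leNgt zt.
rewrite le_eqVlt => /predU1P[<-|/above//].
have rc := cumulative_is_right_continuous F zp.
have : F s @[s --> zp^'+] --> (1 : R).
  by apply: cvg_near_cst; near=> s; rewrite above.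
by move/(cvg_unique (@norm_hausdorff R R^o) rc).
Unshelve. all: by end_near.
Qed.

Lemma mu_le r : mu `]-oo, r]%classic = (F r)%:E.
Proof. by rewrite -cdf_lebesgue_stieltjes_id /cdf /distribution /pushforward /= preimage_id. Qed.

Lemma mu_off_supp : mu (~` supp zp) = 0%E.
Proof.
have itvm r : measurable (`]-oo, r]%classic : set (measurableTypeR R)) by exact: measurable_itv.
have m1 : mu.-negligible (`]-oo, 0[%classic : set (measurableTypeR R)).
  have -> : `]-oo, 0[%classic = \bigcup_n `]-oo, - n.+1%:R^-1]%classic :> set R.
    apply/seteqP; split=> t /=; rewrite in_itv /=.
      move=> t0; have nt : 0 < - t by rewrite oppr_gt0.
      have [n _ hn] := near_infty_natSinv_lt (PosNum nt).
      exists n => //=; rewrite in_itv /= lerNr ltW //.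
      by have := hn n; rewrite /= leqnn => /(_ isT).
    move=> [n _ /=]; rewrite in_itv /= => h; apply: le_lt_trans h _.
    by rewrite oppr_lt0 invr_gt0.
  apply: negligible_bigcup => n; apply/negligibleP; first exact: itvm.
  by apply: (etrans (mu_le _)); rewrite F_neg // oppr_lt0 invr_gt0.
have m2 : mu.-negligible (~` `]-oo, zp]%classic : set (measurableTypeR R)).
  apply/negligibleP; first by apply: measurableC; exact: itvm.
  apply: (etrans (probability_setC mu (itvm zp))).
  by rewrite [X in (_ - X)%E](_ : _ = 1%E) ?subee //; apply: (etrans (mu_le _)); rewrite cdf_above.
apply/negligibleP; last first.
  apply: negligibleS (negligibleU m1 m2) => t /= /negP.
  rewrite negb_and -!ltNge => /orP[h|h]; [left|right]; first by rewrite /= in_itv.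
  by rewrite /= in_itv /= leNgt h.
apply: measurableC; rewrite (_ : supp zp = `[0, zp]%classic); first exact: measurable_itv.
by apply/seteqP; split=> t; rewrite /= in_itv.
Qed.

Lemma measurable_supp : measurable (supp zp).
Proof.
rewrite (_ : supp zp = `[0, zp]%classic); first exact: measurable_itv.
by apply/seteqP; split=> t; rewrite /= in_itv.
Qed.

Lemma mu_supp : mu (supp zp) = 1%E.
Proof.
have := probability_setC mu (measurableC measurable_supp).
by rewrite setCK mu_off_supp sube0.
Qed.

Lemma ge0_int_supp (f : R -> R) : measurable_fun setT f -> (forall t, 0 <= f t) ->
  nice (supp zp) f -> (\int[mu]_t (f t)%:E = (Ex mu (supp zp) f)%:E)%E.
Proof.
move=> mf f0 nf.
rewrite (@ge0_negligible_integral _ _ _ mu setT (~` supp zp)) //.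
- rewrite setTD setCK /Ex /Rintegral fineK //.
  by have /integrable_fin_num := nice_int mu measurable_supp nf; apply; exact: measurable_supp.
- by apply: measurableC; exact: measurable_supp.
- by apply/measurable_EFinP.
- by move=> t _; rewrite lee_fin.
- exact: mu_off_supp.
Qed.

Lemma int_supp (f : R -> R) : nice (supp zp) f -> (\int[mu]_t f t)%R = Ex mu (supp zp) f.
Proof.
move=> nf; rewrite /Ex /Rintegral; congr fine.
have mC : measurable (~` supp zp) by apply: measurableC; exact: measurable_supp.
rewrite (@negligible_integral _ _ _ mu setT (~` supp zp)) ?setTD ?setCK //; last exact: mu_off_supp.
apply/integrableP; split; first by apply/measurable_EFinP; exact: nf.1.
have na : nice (supp zp) (fun t => `|f t|).
  split; first by apply: measurableT_comp => //; exact: nf.1.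
  by have [_ [C hC]] := nf; exists C => c Dc; rewrite normr_id; exact: hC.
by rewrite (ge0_int_supp na.1 _ na) ?ltry // => t.
Qed.

(** The limiting spectral mean of [Z Z^T] when [g] is the aspect ratio, the atom
    at 0 accounting for its kernel; that of [Z^T Z] when [g = 1]. *)
Definition EE (g : R) (f : R -> R) : R := g * Ex mu (supp zp) f + (1 - g) * f 0.

Section Mixture.
Variable g : R.
Hypothesis (g0 : 0 <= g) (g1 : g <= 1).

Lemma EE_D (f h : R -> R) : nice (supp zp) f -> nice (supp zp) h ->
  EE g (fun t => f t + h t) = EE g f + EE g h.
Proof. by move=> hf hh; rewrite /EE ExD //; [ring|exact: measurable_supp]. Qed.

Lemma EE_Z k (f : R -> R) : nice (supp zp) f -> EE g (fun t => k * f t) = k * EE g f.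
Proof. by move=> hf; rewrite /EE ExZ //; [ring|exact: measurable_supp]. Qed.

Lemma EE_le (f h : R -> R) : nice (supp zp) f -> nice (supp zp) h ->
  (forall t : R, supp zp t -> f t <= h t) -> EE g f <= EE g h.
Proof.
move=> hf hh le; apply: lerD; apply: ler_wpM2l => //.
- by apply: Ex_le => //; exact: measurable_supp.
- by rewrite subr_ge0.
- by apply: le; rewrite /supp /= lexx ltW.
Qed.

Lemma EE_1 k : EE g (fun=> k) = k.
Proof. by rewrite /EE Ex_cst; [ring|exact: measurable_supp|exact: mu_supp]. Qed.

Lemma EE_posfun : posfun zp (EE g).
Proof. by split; [exact: EE_D|exact: EE_Z|exact: EE_le|exact: EE_1]. Qed.

End Mixture.

Section Derivative.
Variable gamma : R.
Hypotheses (gamma_gt0 : 0 < gamma) (gamma_le1 : gamma <= 1).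

Notation pf1 := (EE_posfun (@ler01 R) (lexx (1 : R))).
Notation pfg := (EE_posfun (ltW gamma_gt0) gamma_le1).
Notation S1 := (SL (EE 1)).
Notation Sg := (SL (EE gamma)).
Notation Q1 := (QL (EE 1)).
Notation Qg := (QL (EE gamma)).

Lemma edge_sqr y : zp < y -> zp ^+ 2 < y ^+ 2.
Proof.
by move=> zy; rewrite ltrXn2r ?nnegrE ?(ltW zp_gt0) // ltW // (lt_trans zp_gt0).
Qed.

Lemma phiE y : zp < y -> phi F y = y * S1 (y ^+ 2).
Proof.
move=> zy; have n := nice_rk zp_gt0 (edge_sqr zy).
rewrite /SL /EE mul1r subrr mul0r addr0 /phi -ExZ //; last exact: measurable_supp.
by rewrite int_supp //; apply: niceM => //; exact: nice_cst.
Qed.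

Lemma phitE y : zp < y -> phit gamma F y = y * Sg (y ^+ 2).
Proof.
move=> zy; have y0 : 0 < y by apply: lt_trans zy.
rewrite /phit phiE // /SL /EE mul1r subrr mul0r addr0 /rk expr0n subr0.
by field; rewrite gt_eqF.
Qed.

(** [Dfun] as a function of the square of the level. *)
Definition Glam lam := lam * (S1 lam * Sg lam).

Lemma DfunE y : zp < y -> Dfun gamma F y = Glam (y ^+ 2).
Proof. by move=> zy; rewrite /Dfun phiE // phitE // /Glam; ring. Qed.

(** The sum of the logarithmic derivatives of the two Stieltjes transforms, up
    to sign; [Psi] is an affine function of it. *)
Definition kap lam := lam * Q1 lam / S1 lam + lam * Qg lam / Sg lam.

Lemma Dfun_derive y : zp < y ->
  is_derive y 1 (Dfun gamma F) (2 * Dfun gamma F y * (1 - kap (y ^+ 2)) / y).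
Proof.
move=> zy; have hl := edge_sqr zy; have y0 : 0 < y by apply: lt_trans zy.
have d1 := SL_derive zp_gt0 pf1 hl; have d2 := SL_derive zp_gt0 pfg hl.
have s1 := SL_gt0 zp_gt0 pf1 hl; have s2 := SL_gt0 zp_gt0 pfg hl.
have dG : is_derive (y ^+ 2) 1 Glam (S1 (y ^+ 2) * Sg (y ^+ 2) -
    y ^+ 2 * (S1 (y ^+ 2) * Qg (y ^+ 2) + Sg (y ^+ 2) * Q1 (y ^+ 2))).
  apply: (is_derive_eq (is_deriveM (is_derive_id _ _) (is_deriveM d1 d2))).
  have sc (a b : R) : a *: b = a * b by [].
  rewrite !sc mulr1 -[(S1 * Sg) _]/(S1 (y ^+ 2) * Sg (y ^+ 2)); ring.
have dy : is_derive y 1 (fun y : R => y ^+ 2) (2 * y).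
  apply: (is_derive_eq (is_deriveX 2 (is_derive_id y 1))).
  by rewrite /GRing.scale /= expr1 mulr1.
have dc := @is_derive1_comp _ Glam (fun y : R => y ^+ 2) y _ _ dG dy.
have E : {near y, Glam \o (fun y : R => y ^+ 2) =1 Dfun gamma F}.
  near=> u; rewrite DfunE //; near: u; exact: lt_nbhsr.
apply: (near_eq_is_derive E); apply: (is_derive_eq dc).
rewrite DfunE // /Glam /kap; field; rewrite !gt_eqF //.
Unshelve. all: by end_near.
Qed.

(** The condition [-4 <= Psi] thus reads [kap <= 3]. *)
Lemma PsiE y : zp < y -> Psi gamma F y = 2 * (1 - kap (y ^+ 2)).
Proof.
move=> zy; have hl := edge_sqr zy; have y0 : 0 < y by apply: lt_trans zy.
rewrite /Psi derive1E (@derive_val _ _ _ _ _ _ _ (Dfun_derive zy)).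
have : 0 < Dfun gamma F y.
  by rewrite DfunE // /Glam !mulr_gt0 ?exprn_gt0 //; apply: SL_gt0 hl => //; [exact: pf1|exact: pfg].
by move: (Dfun gamma F y) => D D0; field; rewrite !gt_eqF.
Qed.

Let S1_gt0 lam : zp ^+ 2 < lam -> 0 < S1 lam := SL_gt0 zp_gt0 pf1 (lam := lam).
Let Sg_gt0 lam : zp ^+ 2 < lam -> 0 < Sg lam := SL_gt0 zp_gt0 pfg (lam := lam).

Lemma kap_decr lam lam' : zp ^+ 2 < lam -> lam <= lam' -> kap lam' <= kap lam.
Proof.
move=> hl ll'; have hl' := lt_le_trans hl ll'.
apply: lerD; rewrite ler_pdivrMr ?S1_gt0 ?Sg_gt0 // mulrAC ler_pdivlMr ?S1_gt0 ?Sg_gt0 //.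
  exact: (kappa_decr zp_gt0 pf1).
exact: (kappa_decr zp_gt0 pfg).
Qed.

Lemma kap_le lam : zp ^+ 2 < lam -> kap lam <= 2 * (lam / (lam - zp ^+ 2)).
Proof.
move=> hl; have l0 := lam_gt0 hl.
rewrite mulr_natl mulr2n; apply: lerD.
  rewrite ler_pdivrMr ?S1_gt0 // -!mulrA ler_pM2l //; exact: (QL_le zp_gt0 pf1).
rewrite ler_pdivrMr ?Sg_gt0 // -!mulrA ler_pM2l //; exact: (QL_le zp_gt0 pfg).
Qed.

Lemma kap_continuous lam : zp ^+ 2 < lam -> {for lam, continuous kap}.
Proof.
move=> hl; rewrite /kap; apply: cvgD.
  apply: cvgM; first by apply: cvgM; [exact: cvg_id|exact: (QL_continuous zp_gt0 pf1)].
  by apply: cvgV; [rewrite gt_eqF ?S1_gt0|exact: (SL_continuous zp_gt0 pf1)].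
apply: cvgM; first by apply: cvgM; [exact: cvg_id|exact: (QL_continuous zp_gt0 pfg)].
by apply: cvgV; [rewrite gt_eqF ?Sg_gt0|exact: (SL_continuous zp_gt0 pfg)].
Qed.

(** Each of the two terms is at least 1, by Jensen's inequality. *)
Lemma kap_gt2 lam : zp ^+ 2 < lam -> 2 <= kap lam.
Proof.
move=> hl; have l0 := lam_gt0 hl.
have key g (g0 : 0 <= g) (g1 : g <= 1) : 1 <= lam * QL (EE g) lam / SL (EE g) lam.
  have pf := EE_posfun g0 g1; have s0 := SL_gt0 zp_gt0 pf hl.
  rewrite ler_pdivlMr // mul1r.
  apply: le_trans (ler_wpM2l (ltW l0) (QL_ge zp_gt0 pf hl)).
  rewrite expr2 mulrA -[leLHS]mul1r ler_pM2r // -ler_pdivrMl // mulr1.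
  exact: (SL_ge zp_gt0 pf).
have := lerD (key _ ler01 (lexx _)) (key _ (ltW gamma_gt0) gamma_le1).
by rewrite /kap; lra.
Qed.

Section Edge.
Hypothesis div : (\int[lebesgue_stieltjes_measure F]_t ((y - t) ^- 2)%:E)%E
        @[y --> (upper_edge F)^'+] --> +oo%E.

(** On the support [y + t] lies between two multiples of the edge, so that
    [(y - t) ^- 2] and [(y ^+ 2 - t ^+ 2) ^- 2] diverge together. *)
Lemma QL_div K : exists lam, [/\ zp ^+ 2 < lam, lam <= 2 * zp ^+ 2 & K <= Q1 lam].
Proof.
have [y [zy y2 hy]] : exists y, [/\ zp < y, y <= 5 / 4 * zp &
    ((8 * zp ^+ 2 * K)%:E <= \int[mu]_t ((y - t) ^- 2)%:E)%E].
  have h1 : \forall y \near zp^'+, zp < y by exact: nbhs_right_gt.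
  have h2 : \forall y \near zp^'+, y <= 5 / 4 * zp.
    by apply: nbhs_right_le; rewrite mulrC ltr_pMr // ltr_pdivlMr // mul1r ltr_nat.
  have h3 := cvgey_ge div (8 * zp ^+ 2 * K).
  have [y [? [? ?]]] := filter_ex (filterI h1 (filterI h2 (h3 _))).
  by exists y.
have hl := edge_sqr zy; have y0 : 0 < y by apply: lt_trans zy.
have l2 : y ^+ 2 <= 2 * zp ^+ 2.
  apply: (@le_trans _ _ ((5 / 4 * zp) ^+ 2)).
    by rewrite lerXn2r ?nnegrE ?(ltW y0) // (le_trans (ltW y0)).
  by rewrite exprMn ler_pM2r ?exprn_gt0 //; lra.
exists (y ^+ 2); split=> //.
(* [(y + t) ^+ 2 <= 4 * y ^+ 2 <= 8 * zp ^+ 2] on the support *)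
have bd t : supp zp t -> (y - t) ^- 2 <= 8 * zp ^+ 2 * rk (y ^+ 2) t ^+ 2.
  move=> /andP[t0 tz]; have d0 : 0 < y - t by rewrite subr_gt0 (le_lt_trans tz).
  have s0 : 0 < y + t by rewrite ltr_wpDr.
  have -> : 8 * zp ^+ 2 * rk (y ^+ 2) t ^+ 2 = (y - t) ^- 2 * (8 * zp ^+ 2 / (y + t) ^+ 2).
    by rewrite /rk subr_sqr; field; rewrite !gt_eqF.
  rewrite -[leLHS]mulr1.
  rewrite ler_pM2l ?invr_gt0 ?exprn_gt0 // ler_pdivlMr ?exprn_gt0 // mul1r.
  apply: (@le_trans _ _ ((2 * y) ^+ 2)).
    by rewrite lerXn2r ?nnegrE ?(ltW s0) ?mulr_ge0 ?(ltW y0) //; lra.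
  rewrite exprMn; apply: (@le_trans _ _ (2 ^+ 2 * (2 * zp ^+ 2))); first by rewrite ler_pM2l.
  by rewrite mulrA ler_pM2r ?exprn_gt0 //; lra.
have nr := niceX 2 (nice_rk zp_gt0 hl).
have nd : nice (supp zp) (fun t : R => (y - t) ^- 2).
  split.
    under eq_fun do rewrite -exprVn.
    apply: (@measurable_funX _ (measurableTypeR R)); apply: (measurableT_comp (@measurable_inv R)).
    by have [] := niceB (nice_cst (supp zp) y) (nice_id zp).
  have [_ [C hC]] := niceM (nice_cst (supp zp) (8 * zp ^+ 2)) nr.
  exists C => t st; apply: le_trans (hC t st); rewrite ger0_norm ?invr_ge0 ?sqr_ge0 //.
  by apply: le_trans (bd t st) (ler_norm _).
rewrite ge0_int_supp // in hy; last 2 first.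
- exact: nd.1.
- by move=> t; rewrite invr_ge0 sqr_ge0.
move: hy; rewrite lee_fin => hy.
rewrite /QL /EE mul1r subrr mul0r addr0.
rewrite -(ler_pM2l (_ : 0 < 8 * zp ^+ 2)) ?mulr_gt0 ?exprn_gt0 //.
apply: le_trans hy _; rewrite -ExZ //; last exact: measurable_supp.
apply: Ex_le => //; first exact: measurable_supp.
by apply: niceM => //; exact: nice_cst.
Qed.

(** [QL] dominates [SL ^+ 2], so that [QL / SL] diverges with [QL]. *)
Lemma kap_edge : exists2 y, zp < y & 3 < kap (y ^+ 2).
Proof.
have [lam [hl l2 hQ]] := QL_div (10 / zp ^+ 4).
have l0 := lam_gt0 hl; have s1 := S1_gt0 hl.
have z4 : 0 < zp ^+ 4 by rewrite exprn_gt0.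
exists (Num.sqrt lam).
  by rewrite -[ltLHS]ger0_norm ?(ltW zp_gt0) // -sqrtr_sqr ltr_sqrt.
rewrite sqr_sqrtr ?(ltW l0) //.
have p2 : 0 <= lam * Qg lam / Sg lam.
  rewrite divr_ge0 ?(ltW (Sg_gt0 hl)) // mulr_ge0 ?(ltW l0) //.
  exact: ltW (QL_gt0 zp_gt0 pfg hl).
rewrite /kap; apply: ltr_wpDr => //.
rewrite ltr_pdivlMr // ltNge; apply/negP => h.
have q0 := QL_gt0 zp_gt0 pf1 hl.
have : lam ^+ 2 * Q1 lam ^+ 2 <= 9 * Q1 lam.
  apply: (@le_trans _ _ ((3 * S1 lam) ^+ 2)).
    by rewrite -exprMn lerXn2r ?nnegrE ?mulr_ge0 ?(ltW l0) ?(ltW q0) ?(ltW s1).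
  by rewrite exprMn; have := QL_ge zp_gt0 pf1 hl; lra.
rewrite [Q1 lam ^+ 2]expr2 mulrA ler_pM2r // => h9.
have : 10 <= lam ^+ 2 * Q1 lam.
  apply: (@le_trans _ _ (zp ^+ 4 * (10 / zp ^+ 4))); first by rewrite mulrC divfK ?gt_eqF.
  apply: ler_pM => //; first exact: ltW.
    by rewrite divr_ge0 // ltW.
  by rewrite (exprM _ 2 2) lerXn2r ?nnegrE ?sqr_ge0 ?(ltW l0) // ltW.
by lra.
Qed.

Lemma Psi_ge y : zp < y -> (-4 <= Psi gamma F y) = (kap (y ^+ 2) <= 3).
Proof. by move=> zy; rewrite PsiE //; apply/idP/idP; lra. Qed.

Notation T := (Tgamma gamma F).

Let Tset_inf : has_inf [set y | zp < y /\ -4 <= Psi gamma F y].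
Proof.
split; last by exists zp => y [/ltW].
exists (2 * zp); have z2 : zp < 2 * zp by rewrite ltr_pMl // ltr1n.
split=> //; rewrite Psi_ge //; apply: le_trans (kap_le (edge_sqr z2)) _.
have z20 : 0 < zp ^+ 2 by rewrite exprn_gt0.
have -> : (2 * zp) ^+ 2 / ((2 * zp) ^+ 2 - zp ^+ 2) = 4 / 3.
  have -> : (2 * zp) ^+ 2 = 4 * zp ^+ 2 by ring.
  by move: (zp ^+ 2) z20 => w w0; field; apply: lt0r_neq0; lra.
by lra.
Qed.

(** [kap] exceeds 3 near the edge and is monotone. *)
Lemma Tgamma_gt : zp < T.
Proof.
have [y zy ky] := kap_edge; apply: (lt_le_trans zy).
apply: lb_le_inf; first by case: Tset_inf.
move=> t [zt]; rewrite Psi_ge // => kt; rewrite leNgt; apply/negP => ty.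
have := kap_decr (edge_sqr zt) (_ : t ^+ 2 <= y ^+ 2).
rewrite lerXn2r ?nnegrE ?(ltW (lt_trans zp_gt0 zt)) ?(ltW (lt_trans zp_gt0 zy)) ?(ltW ty) //.
by move=> /(_ isT); lra.
Qed.

Lemma kap_below y : zp < y -> y < T -> 3 < kap (y ^+ 2).
Proof.
move=> zy yT; rewrite ltNge -Psi_ge //; apply/negP => h.
have : T <= y by apply: ge_inf => //; case: Tset_inf.
by rewrite leNgt yT.
Qed.

Lemma kap_above y : T < y -> kap (y ^+ 2) <= 3.
Proof.
move=> /(inf_lt (proj1 Tset_inf))[t [zt]]; rewrite Psi_ge // => kt ty.
apply: le_trans (kap_decr (edge_sqr zt) _) kt.
by rewrite lerXn2r ?nnegrE ?(ltW ty) // ltW ?(lt_trans zp_gt0 zt) // (lt_trans zp_gt0) // (lt_trans zt).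
Qed.

(** Continuity of [kap] at the infimum of the levels where it is at most 3. *)
Lemma kap_T : kap (T ^+ 2) = 3.
Proof.
have zT := Tgamma_gt.
have kc : kap (y ^+ 2) @[y --> T] --> kap (T ^+ 2).
  have c2 : (fun y : R => y ^+ 2) y @[y --> T] --> T ^+ 2 by exact: exprn_continuous.
  exact: (cvg_comp _ _ c2 (kap_continuous (edge_sqr zT))).
apply/le_anti/andP; split; rewrite leNgt; apply/negP => h.
  have h1 : \forall y \near T^'+, 3 < kap (y ^+ 2) := cvgr_gt _ (cvg_at_right_filter kc) _ h.
  have [y [Ty ky]] := filter_ex (filterI (nbhs_right_gt T) (h1 _)).
  by have := kap_above Ty; rewrite leNgt ky.
have h1 : \forall y \near T^'-, kap (y ^+ 2) < 3 := cvgr_lt _ (cvg_at_left_filter kc) _ h.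
have [y [[zy yT] ky]] := filter_ex (filterI (filterI (nbhs_left_gt zT) (nbhs_left_lt T)) (h1 _)).
by have := kap_below zy yT; rewrite ltNge (ltW ky).
Qed.

End Edge.

Notation D := (Dfun gamma F).

Lemma Dfun_gt0 y : zp < y -> 0 < D y.
Proof.
move=> zy; have hl := edge_sqr zy.
by rewrite DfunE //; apply: (mulr_gt0 (lam_gt0 hl)); apply: mulr_gt0; [exact: S1_gt0|exact: Sg_gt0].
Qed.

Lemma Dfun_decr y y' : zp < y -> y < y' -> D y' < D y.
Proof.
move=> zy yy'; have zy' := lt_trans zy yy'.
have y0 : 0 < y by apply: lt_trans zy.
have y'0 : 0 < y' by apply: lt_trans yy'.
have inv : 0 < y^-1 - y'^-1 by rewrite subr_gt0 ltf_pV2.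
rewrite /Dfun !phiE // !phitE //.
have h1 := SL_decr zp_gt0 pf1 zy yy'; have h2 := SL_decr zp_gt0 pfg zy yy'.
apply: ltr_pM; rewrite ?mulr_ge0 ?(ltW y'0) ?(ltW (S1_gt0 (edge_sqr zy'))) ?(ltW (Sg_gt0 (edge_sqr zy'))) //.
  by rewrite -subr_gt0; apply: lt_le_trans h1.
by rewrite -subr_gt0; apply: lt_le_trans h2.
Qed.

Lemma Dfun_inj y y' : zp < y -> zp < y' -> D y = D y' -> y = y'.
Proof.
move=> zy zy' e; apply/eqP; case: ltgtP => // h.
  by have := Dfun_decr zy h; rewrite e ltxx.
by have := Dfun_decr zy' h; rewrite e ltxx.
Qed.

Lemma Dfun_continuous y : zp < y -> {for y, continuous D}.
Proof.
move=> zy; apply: differentiable_continuous; apply/derivable1_diffP.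
by have [] := Dfun_derive zy.
Qed.

Lemma Dfun_small y e : zp < y -> 0 < e -> exists2 y', y < y' & D y' < e.
Proof.
move=> zy e0; have y0 : 0 < y by apply: lt_trans zy.
pose b := Num.max (2 * zp) (Num.max (y + 1) (4 / e + 1)).
have b1 : 2 * zp <= b by rewrite le_max lexx.
have b2 : y + 1 <= b by rewrite !le_max lexx orbT.
have b3 : 4 / e + 1 <= b by rewrite !le_max lexx !orbT.
have zb : zp < b by apply: lt_le_trans b1; rewrite ltr_pMl // ltr1n.
have b0 : 0 < b by apply: lt_trans zb.
have b4 : 1 <= b by apply: le_trans b3; rewrite lerDr divr_ge0 // ltW.
exists b; first by apply: lt_le_trans b2; rewrite ltrDl.
have hl := edge_sqr zb.
have z4 : 4 * zp ^+ 2 <= b ^+ 2.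
  have -> : 4 * zp ^+ 2 = (2 * zp) ^+ 2 by ring.
  by rewrite lerXn2r ?nnegrE ?(ltW b0) // mulr_ge0 // ltW.
have hd : 0 < b ^+ 2 - zp ^+ 2 by rewrite subr_gt0.
have z20 : 0 < zp ^+ 2 by rewrite exprn_gt0.
have hb : b ^+ 2 - zp ^+ 2 >= b ^+ 2 / 2 by lra.
rewrite DfunE // /Glam.
have u1 : S1 (b ^+ 2) <= 2 / b ^+ 2.
  apply: le_trans (SL_le zp_gt0 pf1 hl) _.
  by rewrite -[2 / _]invf_div lef_pV2 // posrE divr_gt0 ?exprn_gt0.
have u2 : Sg (b ^+ 2) <= 2 / b ^+ 2.
  apply: le_trans (SL_le zp_gt0 pfg hl) _.
  by rewrite -[2 / _]invf_div lef_pV2 // posrE divr_gt0 ?exprn_gt0.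
apply: (@le_lt_trans _ _ (b ^+ 2 * (2 / b ^+ 2 * (2 / b ^+ 2)))).
  by rewrite ler_pM2l ?exprn_gt0 //; apply: ler_pM => //; apply: ltW; [exact: S1_gt0|exact: Sg_gt0].
have -> : b ^+ 2 * (2 / b ^+ 2 * (2 / b ^+ 2)) = 4 / b ^+ 2 by field; rewrite gt_eqF.
rewrite ltr_pdivrMr ?exprn_gt0 //.
have h4 : 4 < e * b.
  rewrite mulrC -ltr_pdivrMr //; apply: lt_le_trans b3; by rewrite ltrDl.
by apply: lt_le_trans h4 _; rewrite ler_pM2l // expr2 ler_peMl // ltW.
Qed.

(** Monotonicity of [Dfun] turns the limit at the edge into an infimum. *)
Lemma x_plusP x : 0 < x -> (x_plus gamma F < x) <-> exists2 y, zp < y & 1 / x ^+ 2 < D y.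
Proof.
move=> x0; pose s y := (Num.sqrt (D y))^-1.
have s_lt y y' : zp < y -> y < y' -> s y < s y'.
  move=> zy yy'; have zy' := lt_trans zy yy'.
  by rewrite /s ltf_pV2 ?posrE ?sqrtr_gt0 ?Dfun_gt0 // ltr_sqrt ?Dfun_gt0 // Dfun_decr.
pose I := [set` Interval (BRight zp) (BInfty R false)].
have Ilb : has_lbound (s @` I).
  by exists 0 => _ [y _ <-]; rewrite /s invr_ge0 sqrtr_ge0.
have cv : s y @[y --> zp^'+] --> inf (s @` I).
  apply: nondecreasing_at_right_cvgr => //.
  move=> y y'; rewrite !in_itv /= !andbT => zy zy'.
  by rewrite le_eqVlt => /predU1P[->//|h]; exact: ltW (s_lt _ _ zy h).
have -> : x_plus gamma F = inf (s @` I).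
  exact: (@cvg_lim _ (@norm_hausdorff R R^o) _ _ _ s _ cv).
have sx y : zp < y -> (s y < x) = (1 / x ^+ 2 < D y).
  move=> zy; have D0 := Dfun_gt0 zy.
  rewrite /s -[X in _ < X]invrK ltf_pV2 ?posrE ?sqrtr_gt0 ?invr_gt0 //.
  have xi : 0 <= x^-1 by rewrite invr_ge0 ltW.
  by rewrite -[X in X < _](ger0_norm xi) -sqrtr_sqr ltr_sqrt // exprVn div1r.
split.
  have hi : s @` I !=set0.
    by exists (s (zp + 1)), (zp + 1) => //; rewrite /I /= in_itv /= andbT ltrDl.
  move=> /(inf_lt hi)[_ [y zy <-]]; rewrite /I /= in_itv /= andbT in zy.
  by rewrite sx //; exists y.
move=> [y zy]; rewrite -sx // => h; apply: le_lt_trans h.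
by apply: ge_inf => //; exists y => //; rewrite /I /= in_itv /= andbT.
Qed.

(** The intermediate value theorem for [Dfun], which tends to 0 at infinity. *)
Lemma YfunP x : 0 < x -> x_plus gamma F < x -> zp < Yfun gamma F x /\ D (Yfun gamma F x) = 1 / x ^+ 2.
Proof.
move=> x0 /(x_plusP x0)[y zy hy].
have v0 : 0 < 1 / x ^+ 2 by rewrite div1r invr_gt0 exprn_gt0.
have [y' yy' hy'] := Dfun_small zy v0.
have [c cab Dc] : exists2 c, c \in `[y, y'] & D c = 1 / x ^+ 2.
  apply: IVT; first exact: ltW.
    apply: continuous_in_subspaceT => t; rewrite inE /= in_itv /= => /andP[yt _].
    by apply: Dfun_continuous; apply: lt_le_trans zy yt.
  by rewrite ge_min le_max (ltW hy) (ltW hy') orbT.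
have : [set y | zp < y /\ D y = 1 / x ^+ 2] (Yfun gamma F x).
  apply: getPex; exists c; split=> //; apply: lt_le_trans zy _.
  by move: cab; rewrite in_itv /= => /andP[].
by [].
Qed.

Lemma no_outlier x y : 0 < x -> x <= x_plus gamma F -> zp < y -> x ^+ 2 * D y != 1.
Proof.
move=> x0 xp zy; rewrite lt_eqF // -ltr_pdivlMl ?exprn_gt0 // mulr1.
have D0 := Dfun_gt0 zy.
have zh : zp < (zp + y) / 2 by rewrite midf_lt.
have h : (zp + y) / 2 < y by rewrite midf_lt.
apply: lt_le_trans (Dfun_decr zh h) _; rewrite leNgt; apply/negP => hD.
by move: xp; rewrite leNgt => /negP; apply; apply/(x_plusP x0); exists ((zp + y) / 2); rewrite ?div1r.
Qed.

Lemma noise_edge_data l : zp < l ->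
  edge_data (LP (EE gamma)) (LP (EE 1)) l (phit gamma F l) (phi F l)
    (Qg (l ^+ 2)) (l ^+ 2 * Qg (l ^+ 2) - Sg (l ^+ 2))
    (Q1 (l ^+ 2)) (l ^+ 2 * Q1 (l ^+ 2) - S1 (l ^+ 2)).
Proof.
move=> zl; have hl := edge_sqr zl; have l0 : 0 < l by apply: lt_trans zl.
rewrite phiE // phitE //.
have hpos g (g0 : 0 <= g) (g1 : g <= 1) :
    0 <= l ^+ 2 * QL (EE g) (l ^+ 2) - SL (EE g) (l ^+ 2).
  have pf := EE_posfun g0 g1; have s0 := SL_gt0 zp_gt0 pf hl.
  rewrite subr_ge0; apply: le_trans (ler_wpM2l (ltW (lam_gt0 hl)) (QL_ge zp_gt0 pf hl)).
  rewrite expr2 [leRHS]mulrA -[leLHS]mul1r ler_pM2r // -ler_pdivrMl ?(lam_gt0 hl) // mulr1.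
  exact: (SL_ge zp_gt0 pf).
split.
- by apply: cvgM; [exact: cvg_cst|exact: (neumann_lim zp_gt0 pfg)].
- by apply: cvgM; [exact: cvg_cst|exact: (neumann_lim zp_gt0 pf1)].
- exact: (neumann_sqr_lim zp_gt0 pfg).
- exact: (neumann_X_lim zp_gt0 pfg).
- exact: (neumann_sqr_lim zp_gt0 pf1).
- exact: (neumann_X_lim zp_gt0 pf1).
split.
- by rewrite mulr_gt0 // Sg_gt0.
- by rewrite mulr_gt0 // S1_gt0.
- exact: (QL_gt0 zp_gt0 pfg).
- exact: (QL_gt0 zp_gt0 pf1).
- by rewrite !hpos // ltW.
Qed.

(** The divergence passes from the law of the singular values to its mixture
    with an atom at 0, as [gamma] is positive. *)
Lemma edge_blowup : (\int[lebesgue_stieltjes_measure F]_t ((y - t) ^- 2)%:E)%E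
        @[y --> (upper_edge F)^'+] --> +oo%E ->
  exists2 L : R, L != 0 &
    (forall K, exists M, K <= LP (EE gamma) (edgep zp L M.*2)) /\
    forall M, 0 <= LP (EE 1) ('X * edgep zp L M.*2).
Proof.
move=> div; exists (zp ^+ 2); first by rewrite gt_eqF // exprn_gt0.
split; last by move=> M; exact: (edgep_X_ge0 zp_gt0 pf1).
apply: (edgep_big zp_gt0 pfg) => K.
have [lam [hl l2 hK]] := QL_div div (K / gamma).
exists lam; split=> //; move: hK; rewrite ler_pdivrMr // => hK; apply: le_trans hK _.
rewrite /QL /EE mul1r subrr mul0r addr0 mulrC lerDl mulr_ge0 ?subr_ge0 //.
exact: sqr_ge0.
Qed.

Section Outlier.
Variable x : R.
Hypothesis (x_gt0 : 0 < x) (x_out : x_plus gamma F < x).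
Let l := Yfun gamma F x.
Let zl : zp < l := (YfunP x_gt0 x_out).1.
Let Dl : D l = 1 / x ^+ 2 := (YfunP x_gt0 x_out).2.
Let k1 : 0 < kap (l ^+ 2) - 1.
Proof. by have := kap_gt2 (edge_sqr zl); lra. Qed.

(** Eliminating [x] by the equation for its level expresses the overlap through
    [kap] alone. *)
Lemma outlier_signalE :
  phi F l / (l ^+ 2 * x ^+ 2 * phi F l ^+ 2 * Qg (l ^+ 2) + (l ^+ 2 * Q1 (l ^+ 2) - S1 (l ^+ 2)))
  = l / (kap (l ^+ 2) - 1).
Proof.
have hl := edge_sqr zl; have s1 := S1_gt0 hl; have sg := Sg_gt0 hl.
have l0 : 0 < l by apply: lt_trans zl.
have x2 : x ^+ 2 = (l ^+ 2 * (S1 (l ^+ 2) * Sg (l ^+ 2)))^-1.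
  by rewrite -/(Glam _) -DfunE // Dl div1r invrK.
have E : l ^+ 2 * x ^+ 2 * phi F l ^+ 2 * Qg (l ^+ 2) + (l ^+ 2 * Q1 (l ^+ 2) - S1 (l ^+ 2)) =
   S1 (l ^+ 2) * (kap (l ^+ 2) - 1).
  by rewrite x2 phiE // /kap; field; rewrite !gt_eqF.
by rewrite E phiE //; field; rewrite !gt_eqF.
Qed.

Lemma R1_outlier : R1 gamma F x = x ^+ 2 + (l ^+ 2 - 2 * l * (l / (kap (l ^+ 2) - 1))).
Proof.
rewrite /R1 x_out -/l /Cfun -/l derive1E (@derive_val _ _ _ _ _ _ _ (Dfun_derive zl)) Dl.
have l0 : 0 < l by apply: lt_trans zl.
have k2 : 1 - kap (l ^+ 2) != 0 by rewrite lt_eqF // -opprB oppr_lt0.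
rewrite -[kap _ - 1]opprB; move: (kap (l ^+ 2)) k2 => k k2.
by field; rewrite k2 !gt_eqF.
Qed.

End Outlier.
End Derivative.
End NoiseLaw.

(** * Moments from the convergence of distribution functions *)

Section ContinuityPoints.
Context {R : realType} (F : R -> R).
Hypotheses (F_nd : nondecreasing F) (F_rc : forall x, F y @[y --> x^'+] --> F x).

Lemma continuous_not_disc x : ~ discontinuity F x -> {for x, continuous F}.
Proof.
move=> nd; apply/left_right_continuousP; split; last exact: F_rc.
have cl : cvg (F y @[y --> x^'-]).
  apply: nondecreasing_at_left_is_cvgr.
    by near=> a => y y' _ _; exact: F_nd.
  near=> a; exists (F x) => _ [y /= + <-]; rewrite in_itv /= => /andP[_ yx].
  by apply: F_nd; exact: ltW.
have cr : cvg (F y @[y --> x^'+]) by apply/cvg_ex; exists (F x); exact: F_rc.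
have -> : F x = lim (F y @[y --> x^'-]).
  rewrite -(cvg_lim (@norm_hausdorff R R) (F_rc (x := x))).
  by apply/eqP; apply: contrapT => /negP h; apply: nd; split=> //; rewrite eq_sym.
exact: cl.
Unshelve. all: by end_near.
Qed.

(** Almost every translate of a grid avoids the countably many discontinuities. *)
Lemma continuity_grid (d B : R) : 0 < d -> exists2 c, - d < c < 0 &
  forall j : nat, c + j%:R * d < B -> {for c + j%:R * d, continuous F}.
Proof.
move=> d0.
pose bad := \bigcup_(j in [set: nat]) [set c | (c + j%:R * d \in `]- d, B[) /\ discontinuity F (c + j%:R * d)].
have cb : countable bad.
  apply: bigcup_countable => // j _.
  have nd : {in `[- d, B] &, nondecreasing_fun F} by move=> y y' _ _; exact: F_nd.
  apply: sub_countable (discontinuity_countable nd).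
  apply: card_le_trans (card_image_le (fun y => y - j%:R * d) _).
  apply: subset_card_le => c [h1 h2].
  by exists (c + j%:R * d); [split|rewrite addrK].
have [c cd nc] : exists2 c, - d < c < 0 & ~ bad c.
  apply: contrapT => /forall2NP h.
  have sb : `]- d, 0[%classic `<=` bad.
    by move=> c /=; rewrite in_itv /= => hc; have [/(_ hc)|/contrapT] := h c.
  have := countable_lebesgue_measure0 (sub_countable (subset_card_le sb) cb).
  rewrite lebesgue_measure_itv /= lte_fin oppr_lt0 d0 -EFinB sub0r opprK.
  by move=> [] /eqP; rewrite gt_eqF.
exists c => // j cj; apply: continuous_not_disc => dj; apply: nc; exists j => //; split=> //.
move: cd => /andP[c1 c2]; rewrite in_itv /= cj andbT; apply: lt_le_trans c1 _.
by rewrite lerDl mulr_ge0 // ltW.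
Qed.

End ContinuityPoints.

Lemma lip_exp (R : realType) (B a b : R) m : `|a| <= B -> `|b| <= B ->
  `|a ^+ m - b ^+ m| <= `|a - b| * (m%:R * B ^+ m.-1).
Proof.
move=> ha hb; have B0 : 0 <= B by apply: le_trans ha.
rewrite subrXX normrM ler_wpM2l //.
apply: le_trans (ler_norm_sum _ _ _) _.
apply: (@le_trans _ _ (\sum_(i < m) B ^+ m.-1)); last by rewrite sumr_const card_ord mulr_natl.
apply: ler_sum => i _; rewrite normrM !normrX.
have -> : B ^+ m.-1 = B ^+ (m.-1 - i) * B ^+ i.
  by rewrite -exprD subnK // -ltnS prednK // (leq_ltn_trans _ (ltn_ord i)).
by apply: ler_pM; rewrite ?exprn_ge0 // lerXn2r ?nnegrE.
Qed.

Section Moments.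
Context {R : realType} (F : cumulativeBounded (0 : R) (1 : R)).
Let zp := upper_edge F.
Let mu : probability (measurableTypeR R) R := lebesgue_stieltjes_measure F.
Hypotheses (cmp : compactly_supported_cdf F) (zp_gt0 : 0 < zp)
  (F_neg : forall t, t < 0 -> F t = 0).
Variable s : nat -> seq R.
Hypothesis s_ge0 : forall n t, t \in s n -> 0 <= t.
Hypothesis s_le : \forall n \near \oo, forall t, t \in s n -> t <= zp + 1.
Hypothesis s_size : \forall n \near \oo, (0 < size (s n))%N.
Hypothesis s_cdf : forall t : R, {for t, continuous F} ->
  empirical_cdf (s n) t @[n --> \oo] --> F t.

Definition mean (l : seq R) (f : R -> R) : R := (\sum_(t <- l) f t) / (size l)%:R.

Lemma mean_cst l k : (0 < size l)%N -> mean l (fun=> k) = k.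
Proof.
move=> l0; rewrite /mean big_const_seq count_predT iter_addr addr0.
by rewrite -[k *+ _]mulr_natr mulfK // pnatr_eq0 -lt0n.
Qed.

Lemma meanD l f g : mean l (fun t => f t + g t) = mean l f + mean l g.
Proof. by rewrite /mean big_split mulrDl. Qed.

Lemma meanZ l k f : mean l (fun t => k * f t) = k * mean l f.
Proof. by rewrite /mean -mulr_sumr mulrA. Qed.

Lemma mean_sum l (N : nat) (f : 'I_N -> R -> R) :
  mean l (fun t => \sum_(j < N) f j t) = \sum_(j < N) mean l (f j).
Proof. by rewrite /mean exchange_big mulr_suml. Qed.

Lemma mean_close l f g e : (0 < size l)%N -> (forall t, t \in l -> `|f t - g t| <= e) ->
  `|mean l f - mean l g| <= e.
Proof.
move=> l0 h; rewrite /mean -mulrBl -sumrB normrM normfV [`|_%:R|]ger0_norm //.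
rewrite ler_pdivrMr ?ltr0n //; apply: le_trans (ler_norm_sum _ _ _) _.
rewrite big_seq; apply: (@le_trans _ _ (\sum_(t <- l | t \in l) e)); first exact: ler_sum.
by rewrite -big_seq big_const_seq count_predT iter_addr addr0 mulr_natr.
Qed.

Lemma mean_le l a : mean l (fun t => (t <= a)%R%:R) = empirical_cdf l a.
Proof.
rewrite /mean /empirical_cdf; congr (_ / _).
by rewrite -sum1_count natr_sum [RHS]big_mkcond; apply: eq_bigr => t _; case: (t <= a).
Qed.

Let E := Ex mu (supp zp).
Notation nice f := (@nice R _ (measurableTypeR R) (supp zp) (f : R -> R)).

Lemma nice_le a : nice (fun t : R => (t <= a)%R%:R).
Proof.
split; last by exists 1 => t _; case: (_ <= a); rewrite ?normr1 ?normr0.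
rewrite (_ : (fun t : R => _) = \1_(`]-oo, a]%classic)).
  by apply: measurable_indic; exact: measurable_itv.
by apply/funext => t; rewrite indicE; congr (_%:R); congr nat_of_bool; apply/idP/idP; rewrite inE /= in_itv.
Qed.

Lemma E_le a : E (fun t : R => (t <= a)%R%:R) = F a.
Proof.
rewrite /E -int_supp //; last exact: nice_le.
rewrite /Rintegral (_ : (\int[_]_t _)%E = mu `]-oo, a]%classic); first by rewrite mu_le.
have := @integral_indic _ _ _ mu setT measurableT `]-oo, a]%classic (measurable_itv _).
rewrite setIT => <-.
by apply: eq_integral => t _; rewrite indicE; congr (_%:R%:E); congr nat_of_bool;
  apply/idP/idP; rewrite inE /= in_itv.
Qed.

(** Powers are approximated uniformly by step functions with jumps at continuity
    points of [F], whose means converge by hypothesis. *)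
Lemma moment_cvg m : mean (s n) (fun t => t ^+ m) @[n --> \oo] --> (E (fun t => t ^+ m) : R).
Proof.
have z0 : 0 < zp := zp_gt0.
pose B := zp + 2; have B0 : 0 < B by rewrite /B addr_gt0.
pose K := m%:R * B ^+ m.-1 + 1; have K0 : 0 < K.
  by rewrite ltr_wpDl // mulr_ge0 // exprn_ge0 // ltW.
apply/cvgrPdist_lt => e e0.
pose d := Num.min 1 (e / (4 * K)).
have d0 : 0 < d by rewrite lt_min ltr01 divr_gt0 // mulr_gt0.
have d1 : d <= 1 by rewrite ge_min lexx.
have dK : K * d <= e / 4.
  have : d <= e / (4 * K) by rewrite ge_min lexx orbT.
  rewrite -(ler_pM2l K0) => /le_trans; apply.
  by rewrite invfM mulrCA [K * _]mulrCA divff ?mulr1 // gt_eqF.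
have [c /andP[c1 c2] hc] := continuity_grid (cumulative_is_nondecreasing F)
  (cumulative_is_right_continuous F) B d0.
pose a j : R := c + j%:R * d.
have aS j : a j.+1 = a j + d by rewrite /a -natr1 mulrDl mul1r addrA.
have a_mono i j : (i <= j)%N -> a i <= a j.
  by move=> ij; rewrite /a lerD2l ler_wpM2r ?ler_nat // ltW.
have [N aN aN1] : exists2 N, zp + 1 <= a N & forall j, (j < N)%N -> a j <= zp + 1.
  have ex : exists N, zp + 1 <= a N.
    exists (Num.bound ((zp + 1 - c) / d)); rewrite /a -lerBlDl -ler_pdivrMr //.
    have cz : c <= zp + 1 by apply: (le_trans (ltW c2)); rewrite addr_ge0 // ltW.
    by rewrite ltW // archi_boundP // divr_ge0 ?(ltW d0) // subr_ge0.
  have [N hN min] := ex_minnP ex; exists N => // j jN; rewrite ltW // ltNge.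
  by apply/negP => /min; rewrite leqNgt jN.
have a_abs j : (j <= N)%N -> `|a j| <= B.
  move=> jN; have a0 : c <= a j by rewrite /a lerDl mulr_ge0 // ltW.
  rewrite ler_norml /B; apply/andP; split; first by lra.
  by case: j jN a0 => [|j] jN a0; [rewrite /a mul0r; lra|have := aN1 j jN; rewrite aS; lra].
pose g (j : 'I_N) := a j.+1 ^+ m - a j ^+ m.
(* takes the value [a i ^+ m] on the cell [(a i.-1, a i]] *)
pose step t : R := a 0%N ^+ m + \sum_(j < N) g j * (1 + -1 * (t <= a j)%R%:R).
have step_close t : 0 <= t <= zp + 1 -> `|t ^+ m - step t| <= K * d.
  move=> /andP[t0 tz].
  have ex : exists i, t <= a i by exists N; exact: le_trans aN.
  have [i hi min] := ex_minnP ex.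
  have iN : (i <= N)%N by apply: min; exact: le_trans aN.
  have stepE : step t = a i ^+ m.
    rewrite /step (eq_bigr (fun j : 'I_N => if (j < i)%N then g j else 0)); last first.
      move=> j _; case: ltnP => ji.
        rewrite leNgt (_ : a j < t) /= ?mulr0 ?addr0 ?mulr1 // ltNge.
        by apply/negP => /min; rewrite leqNgt ji.
      by rewrite (le_trans hi (a_mono _ _ ji)) mulr1 subrr mulr0.
    rewrite -big_mkcond /g -(big_ord_widen _ (fun j => a j.+1 ^+ m - a j ^+ m) iN).
    by rewrite -(big_mkord xpredT (fun j => a j.+1 ^+ m - a j ^+ m)) telescope_sumr // addrC subrK.
  have i0 : (0 < i)%N.
    by rewrite lt0n; apply/eqP => i0; move: hi; rewrite i0 /a mul0r addr0; lra.
  have hp : a i.-1 < t by rewrite ltNge; apply/negP => /min; rewrite leqNgt prednK // leqnn.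
  have ai : a i = a i.-1 + d by rewrite -aS prednK.
  rewrite stepE; apply: le_trans (@lip_exp _ B _ _ m _ (a_abs i iN)) _.
    by rewrite ger0_norm // /B; lra.
  rewrite mulrC; apply: ler_pM => //.
  - by rewrite mulr_ge0 // exprn_ge0 // ltW.
  - by rewrite /K lerDl.
  - by rewrite ler_norml; apply/andP; split; lra.
have nle j : nice (fun t : R => 1 + -1 * (t <= a j)%R%:R).
  apply: niceD; first exact: nice_cst.
  by apply: niceM; [exact: nice_cst|exact: nice_le].
have nterm (j : 'I_N) : nice (fun t : R => g j * (1 + -1 * (t <= a j)%R%:R)).
  by apply: niceM; [exact: nice_cst|exact: nle].
have nstep : nice step.
  by apply: niceD; [exact: nice_cst|exact: nice_sum].
have mS := @measurable_supp _ F.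
have E_step : E step = a 0%N ^+ m + \sum_(j < N) g j * (1 + -1 * F (a j)).
  rewrite /E /step ExD //; [|exact: nice_cst|exact: nice_sum].
  rewrite Ex_cst //; last exact: mu_supp.
  congr (_ + _); rewrite (Ex_sum mS (mu_supp cmp F_neg) _ nterm); apply: eq_bigr => j _.
  rewrite ExZ // ExD //; [|exact: nice_cst|by apply: niceM; [exact: nice_cst|exact: nice_le]].
  rewrite Ex_cst //; last exact: mu_supp.
  by rewrite ExZ //; [rewrite -/E E_le|exact: nice_le].
have mean_step : mean (s n) step @[n --> \oo] --> E step.
  rewrite E_step.
  have h : a 0%N ^+ m + \sum_(j < N) g j * (1 + -1 * empirical_cdf (s n) (a j)) @[n --> \oo] -->
    a 0%N ^+ m + \sum_(j < N) g j * (1 + -1 * F (a j)).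
    apply: cvgD; first exact: cvg_cst.
    apply: cvg_sumf => j _; apply: cvgM; first exact: cvg_cst.
    apply: cvgD; first exact: cvg_cst.
    apply: cvgM; first exact: cvg_cst.
    apply: s_cdf; apply: hc; rewrite -/(a j) /B; have := aN1 j (ltn_ord j); lra.
  apply: cvg_trans h; apply: near_eq_cvg; near=> n.
  have l0 : (0 < size (s n))%N by near: n.
  rewrite /step meanD mean_cst // mean_sum; congr (_ + _); apply: eq_bigr => j _.
  by rewrite meanZ meanD mean_cst // meanZ mean_le.
have e4 : 0 < e / 4 by rewrite divr_gt0.
near=> n.
have l0 : (0 < size (s n))%N by near: n.
have h1 : `|mean (s n) (fun t => t ^+ m) - mean (s n) step| <= K * d.
  apply: mean_close => // t ts; apply: step_close; rewrite (s_ge0 ts) /=.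
  by move: t ts; near: n.
have h2 : `|E (fun t => t ^+ m) - E step| <= K * d.
  rewrite /E -ExB //; [|by apply: niceX; exact: nice_id].
  apply: Ex_abs_le => //; [exact: mu_supp|by apply: niceB => //; apply: niceX; exact: nice_id|].
  by move=> t /andP[t0 tz]; apply: step_close; rewrite t0 /=; apply: le_trans tz _; lra.
have h3 : `|E step - mean (s n) step| < e / 4.
  by near: n; move/cvgrPdist_lt : mean_step; apply.
have := ler_normB (E (fun t => t ^+ m) - E step) (mean (s n) (fun t => t ^+ m) - mean (s n) step).
move: h1 h2 h3; set e1 := E _; set e2 := E step; set m1 := mean _ _; set m2 := mean _ _ => h1 h2 h3 h4.
have := ler_normD (e2 - m2) (e1 - e2 - (m1 - m2)).
have -> : e2 - m2 + (e1 - e2 - (m1 - m2)) = e1 - m1 by ring.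
lra.
Unshelve. all: by end_near.
Qed.
End Moments.


Section SvdTrace.
Context {R : realType} (n p : nat) (Z U : 'M[R]_(n, p)) (s : seq R) (V : 'M[R]_p).
Hypothesis svd : is_svd Z U s V.

Lemma svd_trace (P : {poly R}) : \tr (pmx P (Z^T *m Z)) = \sum_(t <- s) P.[t ^+ 2].
Proof.
have VV : V *m V^T = 1%:M by apply: mulmx1C; case: svd.
pose v : 'rV[R]_p := \row_i s`_i ^+ 2.
have ZV : Z^T *m Z *m V = V *m diag_mx v.
  apply/matrixP => i j.
  have -> : (Z^T *m Z *m V) i j = (col j (Z^T *m Z *m V)) i 0 by rewrite [RHS]mxE.
  rewrite colE -mulmxA -colE -mulmxA (svd_right svd) linearZ /= (svd_left svd) scalerA.
  by rewrite mul_mx_diag !mxE -expr2 mulrC.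
have -> : pmx P (Z^T *m Z) = V *m pmx P (diag_mx v) *m V^T.
  by rewrite -(pmx_conj P ZV) -mulmxA VV mulmx1.
rewrite mxtrace_mulC mulmxA (_ : V^T *m V = 1%:M) ?mul1mx; last by case: svd.
rewrite pmx_diag mxtrace_diag (big_nth 0) (svd_size svd) big_mkord.
by apply: eq_bigr => k _; rewrite !mxE.
Qed.

(** The nonzero spectra of [Z Z^T] and [Z^T Z] agree. *)
Lemma svd_trace_left (P : {poly R}) : \tr (pmx P (Z *m Z^T)) =
  \sum_(t <- s) P.[t ^+ 2] + P.[0] * (n%:R - p%:R).
Proof.
rewrite -svd_trace; elim/poly_ind: P => [|P c IH].
  by rewrite !pmx0 !mxtrace0 horner0 mul0r addr0.
rewrite !pmxD !pmxC !mxtraceD !mxtrace_scalar hornerMXaddC mulr0 add0r.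
have -> : \tr (pmx (P * 'X) (Z *m Z^T)) = \tr (pmx (P * 'X) (Z^T *m Z)).
  rewrite [P * 'X]mulrC !pmxM !pmxX -!mulmxA mxtrace_mulC -!mulmxA; congr (\tr (_ *m _)); clear IH.
  exact: pmx_intertwine.
by rewrite -addrA; congr (_ + _); rewrite mulrBr !mulr_natr addrC subrK.
Qed.

End SvdTrace.


Section Columns.
Context {R : realType} (gamma : R).
Hypotheses (gamma_gt0 : 0 < gamma) (gamma_le1 : gamma <= 1).

Let ncolsE n : (ncols gamma n)%:R = (Num.ceil (gamma * n%:R))%:~R :> R.
Proof.
have h : (0 <= Num.ceil (gamma * n%:R))%R.
  by rewrite ceil_ge0; apply: lt_le_trans (ltrN10 R) _; rewrite mulr_ge0 // ltW.
by rewrite /ncols natr_absz ger0_norm.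
Qed.

Lemma ncols_ge n : gamma * n%:R <= (ncols gamma n)%:R.
Proof. by rewrite ncolsE; exact: ceil_ge. Qed.

Lemma ncols_lt n : (ncols gamma n)%:R < gamma * n%:R + 1.
Proof. by rewrite ncolsE -ltrBlDr -[1]/(1%:~R) -intrB; exact: ceilB1_lt. Qed.

Lemma ncols_le n : (ncols gamma n <= n)%N.
Proof.
rewrite -ltnS -(ltr_nat R); apply: lt_le_trans (ncols_lt n) _.
by rewrite -natr1 lerD2r ler_piMl.
Qed.

Lemma ncols_oo k : \forall n \near \oo, (k < ncols gamma n)%N.
Proof.
near=> n; rewrite -(ltr_nat R); apply: lt_le_trans (ncols_ge n).
rewrite -ltr_pdivrMl //; near: n; exact: nbhs_infty_gtr.
Unshelve. all: by end_near.
Qed.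

Lemma ncols_lim : ((ncols gamma n)%:R / n%:R) @[n --> \oo] --> (gamma : R).
Proof.
apply/cvgrPdist_lt => e e0; near=> n.
have n0 : 0 < n%:R :> R by rewrite ltr0n; near: n; exact: nbhs_infty_gt.
have ne : e^-1 < n%:R by near: n; exact: nbhs_infty_gtr.
have h1 := ncols_ge n; have h2 := ncols_lt n.
rewrite distrC ger0_norm; last by rewrite subr_ge0 ler_pdivlMr.
rewrite ltrBlDr ltr_pdivrMr // mulrDl addrC; apply: lt_le_trans h2 _.
rewrite lerD2l -ler_pdivrMl // mulr1; exact: ltW.
Unshelve. all: by end_near.
Qed.

End Columns.

Section NoiseTraces.
Context {R : realType} (F : cumulativeBounded (0 : R) (1 : R)) (gamma : R).
Let zp := upper_edge F.
Hypotheses (gamma_gt0 : 0 < gamma) (gamma_le1 : gamma <= 1).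
Hypotheses (cmp : compactly_supported_cdf F) (zp_gt0 : 0 < zp)
  (F_neg : forall t, t < 0 -> F t = 0).
Variables (Z : forall n, 'M[R]_(n, ncols gamma n)) (s : nat -> seq R).
Hypothesis s_sv : forall n, singular_values (Z n) (s n).
Hypothesis s_cdf : forall t : R, {for t, continuous F} ->
  empirical_cdf (s n) t @[n --> \oo] --> F t.
Hypothesis s_top : (s n)`_0 @[n --> \oo] --> zp.

Let s_size n : size (s n) = ncols gamma n.
Proof. by have [U [V h]] := s_sv n; exact: svd_size h. Qed.

Let s_near : \forall n \near \oo, (0 < size (s n))%N.
Proof. by near=> n; rewrite s_size; near: n; exact: ncols_oo. Unshelve. all: by end_near. Qed.

Let s_ge0 n t : t \in s n -> 0 <= t.
Proof. by have [U [V [_ _ [_ _ /allP h] _]]] := s_sv n; exact: h. Qed.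

Let s_le : \forall n \near \oo, forall t, t \in s n -> t <= zp + 1.
Proof.
near=> n => t /(nthP 0)[i _ <-].
have [U [V h]] := s_sv n; apply: le_trans (svd_sorted h (leq0n i)) _.
by near: n; apply: (cvgr_le zp s_top); rewrite ltrDl.
Unshelve. all: by end_near.
Qed.

Lemma noise_opb c : zp < c -> \forall n \near \oo, opb (Z n) c.
Proof.
move=> zc; near=> n; have [U [V h]] := s_sv n.
move=> u; apply: le_trans (svd_opb h u) _.
by rewrite ler_wpM2r ?nrm_ge0 //; near: n; apply: (cvgr_le zp s_top).
Unshelve. all: by end_near.
Qed.

Lemma noise_trace_right (P : {poly R}) :
  \tr (pmx P ((Z n)^T *m Z n)) / (ncols gamma n)%:R @[n --> \oo] --> LP (EE F 1) P.
Proof.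
have h : \sum_(i < size P) P`_i * mean (s n) (fun t => t ^+ (2 * i)) @[n --> \oo] -->
   \sum_(i < size P) P`_i * Ex (lebesgue_stieltjes_measure F) (supp zp) (fun t => t ^+ (2 * i)).
  apply: cvg_sumf => i _; apply: cvgM; first exact: cvg_cst.
  exact: (moment_cvg cmp zp_gt0 F_neg s_ge0 s_le s_near s_cdf).
have -> : LP (EE F 1) P = \sum_(i < size P) P`_i *
    Ex (lebesgue_stieltjes_measure F) (supp zp) (fun t => t ^+ (2 * i)).
  rewrite /LP /EE mul1r subrr mul0r addr0.
  have nx (i : 'I_(size P)) : nice (supp zp) (fun t : R => P`_i * t ^+ (2 * i)).
    by apply: niceM; [exact: nice_cst|apply: niceX; exact: nice_id].
  rewrite (_ : (fun t => _) = fun t => \sum_(i < size P) P`_i * t ^+ (2 * i)); last first.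
    by apply/funext => t; rewrite horner_coef; apply: eq_bigr => i _; rewrite exprM.
  rewrite (Ex_sum (@measurable_supp _ F) (mu_supp cmp F_neg) _ nx); apply: eq_bigr => i _.
  by rewrite ExZ //; [exact: measurable_supp|apply: niceX; exact: nice_id].
apply: cvg_trans h; apply: near_eq_cvg; near=> n.
have [U [V h]] := s_sv n.
rewrite (svd_trace h) -s_size -/(mean (s n) (fun t => P.[t ^+ 2])).
rewrite (_ : (fun t => _) = fun t => \sum_(i < size P) P`_i * t ^+ (2 * i)); last first.
  by apply/funext => t; rewrite horner_coef; apply: eq_bigr => i _; rewrite exprM.
by rewrite mean_sum; apply: eq_bigr => i _; rewrite meanZ.
Unshelve. all: by end_near.
Qed.

Lemma noise_trace_left (P : {poly R}) :
  \tr (pmx P (Z n *m (Z n)^T)) / n%:R @[n --> \oo] --> LP (EE F gamma) P.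
Proof.
have h : (ncols gamma n)%:R / n%:R * (\tr (pmx P ((Z n)^T *m Z n)) / (ncols gamma n)%:R) +
   (1 - (ncols gamma n)%:R / n%:R) * P.[0] @[n --> \oo] -->
   gamma * LP (EE F 1) P + (1 - gamma) * P.[0].
  apply: cvgD; first by apply: cvgM; [exact: ncols_lim|exact: noise_trace_right].
  by apply: cvgM; [apply: cvgB; [exact: cvg_cst|exact: ncols_lim]|exact: cvg_cst].
have -> : LP (EE F gamma) P = gamma * LP (EE F 1) P + (1 - gamma) * P.[0].
  by rewrite /LP /EE mul1r subrr mul0r addr0 expr0n.
apply: cvg_trans h; apply: near_eq_cvg; near=> n.
have [U [V h]] := s_sv n; rewrite (svd_trace_left h) (svd_trace h).
have n0 : n%:R != 0 :> R by rewrite pnatr_eq0 -lt0n; near: n; exact: nbhs_infty_gt.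
have p0 : (ncols gamma n)%:R != 0 :> R.
  by rewrite pnatr_eq0 -lt0n; near: n; exact: ncols_oo.
by field; rewrite n0 p0.
Unshelve. all: by end_near.
Qed.

End NoiseTraces.

(** * The spiked model along almost every sample *)

Lemma spiked_finer (R : realType) (G U : set_system nat) {FG : Filter G} {FU : Filter U} (r : nat)
    (dn dp : nat -> nat) (A : forall n, 'M[R]_(dn n, r)) (B : forall n, 'M[R]_(dp n, r))
    (Z : forall n, 'M[R]_(dn n, dp n)) (zp : R) (MA MB : {poly R} -> R) :
  G `<=` U -> spiked G A B Z zp MA MB -> spiked U A B Z zp MA MB.
Proof.
move=> GU [h1 h2 h3 h4 h5 h6]; split.
- exact: GU.
- exact: GU.
- by move=> c zc; apply: GU; exact: h3.
- by move=> P b c; apply: cvg_trans (h4 P b c); exact: cvg_app.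
- by move=> P b c; apply: cvg_trans (h5 P b c); exact: cvg_app.
- by move=> P b c; apply: cvg_trans (h6 P b c); exact: cvg_app.
Qed.

Section Forms.
Context {R : realType} (r : nat) (dn : nat -> nat).
Variables (A C : forall n, 'M[R]_(dn n, r)) (W : forall n, 'M[R]_(dn n)).

Lemma cV_delta (b : 'cV[R]_r) : b = \sum_i b i 0 *: delta_mx i 0.
Proof.
apply/colP => j; rewrite summxE (bigD1 j) //= big1 => [|i ij].
  by rewrite !mxE !eqxx mulr1 addr0.
by rewrite !mxE eq_sym (negbTE ij) mulr0.
Qed.

Lemma form_lim (L : nat -> 'I_r -> 'I_r -> R) :
  (forall k i j, dot (A n *m delta_mx i 0) (W n ^+ k *m (C n *m delta_mx j 0))
     @[n --> \oo] --> L k i j) ->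
  forall (P : {poly R}) (b c : 'cV[R]_r),
    dot (A n *m b) (pmx P (W n) *m (C n *m c)) @[n --> \oo] -->
    \sum_(k < size P) P`_k * \sum_i \sum_j b i 0 * (c j 0 * L k i j).
Proof.
move=> h P b c.
have E n : dot (A n *m b) (pmx P (W n) *m (C n *m c)) =
    \sum_(k < size P) P`_k * \sum_i \sum_j b i 0 * (c j 0 *
      dot (A n *m delta_mx i 0) (W n ^+ k *m (C n *m delta_mx j 0))).
  rewrite /pmx mulmx_suml dot_sumr; apply: eq_bigr => k _.
  rewrite -scalemxAl dotZr; congr (_ * _).
  rewrite {1}(cV_delta b) mulmx_sumr dot_suml; apply: eq_bigr => i _.
  rewrite -scalemxAr dotZl {1}(cV_delta c) !mulmx_sumr dot_sumr mulr_sumr.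
  by apply: eq_bigr => j _; rewrite -!scalemxAr dotZr.
under eq_fun do rewrite E.
apply: cvg_sumf => k _; apply: cvgM; first exact: cvg_cst.
apply: cvg_sumf => i _; apply: cvg_sumf => j _.
by do 2! [apply: cvgM; first exact: cvg_cst]; exact: h.
Qed.

End Forms.

Lemma natinv_cvg0 (R : realType) (f : nat -> R) :
  (forall m : nat, \forall n \near \oo, `|f n| < m.+1%:R^-1) -> f n @[n --> \oo] --> (0 : R).
Proof.
move=> h; apply/cvgrPdist_lt => e e0.
have [m _ hm] := near_infty_natSinv_lt (PosNum e0).
near=> n; rewrite sub0r normrN; apply: (@lt_trans _ _ m.+1%:R^-1); last by apply: (hm m) => /=.
by near: n.
Unshelve. all: by end_near.
Qed.

Lemma LP_sum (R : realType) (F : cumulativeBounded (0 : R) (1 : R)) (g : R) (P : {poly R}) :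
  compactly_supported_cdf F -> (forall t, t < 0 -> F t = 0) ->
  LP (EE F g) P = \sum_(k < size P) P`_k * LP (EE F g) 'X^k.
Proof.
move=> cmp F_neg.
have nx (i : 'I_(size P)) : nice (supp (upper_edge F)) (fun t : R => P`_i * ('X^i).[t ^+ 2]).
  by apply: niceM; [exact: nice_cst|]; apply: nice_poly.
have hP (u : R) : P.[u] = \sum_(i < size P) P`_i * ('X^i).[u].
  by rewrite horner_coef; apply: eq_bigr => i _; rewrite hornerXn.
rewrite /LP /EE hP.
rewrite (_ : (fun t => _) = fun t : R => \sum_(i < size P) P`_i * ('X^i).[t ^+ 2]); last first.
  by apply/funext => t; exact: hP.
rewrite (Ex_sum (@measurable_supp _ F) (mu_supp cmp F_neg) _ nx) !mulr_sumr -big_split.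
apply: eq_bigr => k _; rewrite /= ExZ; [ring|exact: measurable_supp|exact: nice_poly].
Qed.

Section SpikedSample.
Context {R : realType} (F : cumulativeBounded (0 : R) (1 : R)) (gamma : R).
Let zp := upper_edge F.
Hypotheses (gamma_gt0 : 0 < gamma) (gamma_le1 : gamma <= 1).
Hypotheses (cmp : compactly_supported_cdf F) (zp_gt0 : 0 < zp)
  (F_neg : forall t, t < 0 -> F t = 0).

(** A trace of bounded order lets the concentration statement be used. *)
Lemma quad_form_lim r (d : nat -> nat) (good : nat -> bool) (A : forall n, 'M[R]_(d n, r))
    (W : forall n, 'M[R]_(d n)) g :
  (\forall n \near \oo, good n) -> (\forall n \near \oo, (0 < d n)%N) ->
  (forall P : {poly R}, \tr (pmx P (W n)) / (d n)%:R @[n --> \oo] --> LP (EE F g) P) ->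
  (forall (k K m : nat) (i j : 'I_r), \forall n \near \oo,
    good n -> \tr ((W n ^+ k) ^+ 4) <= K%:R * (d n)%:R ->
    `|\tr (W n ^+ k)| <= K%:R * (d n)%:R ->
    `|dot (A n *m delta_mx i 0) (W n ^+ k *m (A n *m delta_mx j 0)) -
       (i == j)%:R * (\tr (W n ^+ k) / (d n)%:R)| < m.+1%:R^-1) ->
  forall P (b c : 'cV[R]_r), dot (A n *m b) (pmx P (W n) *m (A n *m c)) @[n --> \oo]
        --> LP (EE F g) P * dot b c.
Proof.
move=> gd d0 tl h P b c.
have trX k n : \tr (pmx 'X^k (W n)) = \tr (W n ^+ k) by rewrite pmxXn pmxX.
pose L k (i j : 'I_r) := (i == j)%:R * LP (EE F g) 'X^k.
have hL k i j : dot (A n *m delta_mx i 0) (W n ^+ k *m (A n *m delta_mx j 0)) @[n --> \oo] --> (L k i j : R).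
  have l1 := tl ('X^k); have l4 := tl ('X^(k * 4)).
  have [K hK1 hK4] : exists2 K : nat, `|LP (EE F g) 'X^k| < K%:R & LP (EE F g) 'X^(k * 4) < K%:R.
    exists (Num.bound (`|LP (EE F g) 'X^k| + `|LP (EE F g) 'X^(k * 4)|)).
      by apply: le_lt_trans (archi_boundP _); rewrite ?lerDl ?addr_ge0.
    apply: le_lt_trans (ler_norm _) _.
    by apply: le_lt_trans (archi_boundP _); rewrite ?lerDr ?addr_ge0.
  have dl : (dot (A n *m delta_mx i 0) (W n ^+ k *m (A n *m delta_mx j 0)) -
       (i == j)%:R * (\tr (W n ^+ k) / (d n)%:R)) @[n --> \oo] --> (0 : R).
    apply: natinv_cvg0 => m; have hm := h k K m i j.
    have n1 : \forall n \near \oo, `|\tr (pmx 'X^k (W n)) / (d n)%:R| < K%:R.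
      exact: (cvgr_lt _ (cvg_norm l1)).
    have n4 : \forall n \near \oo, \tr (pmx 'X^(k * 4) (W n)) / (d n)%:R < K%:R.
      exact: (cvgr_lt _ l4).
    near=> n; have dn0 : 0 < (d n)%:R :> R by rewrite ltr0n; near: n.
    move: (near hm n) => hn; apply: hn => //.
    - by near: n.
    - rewrite -exprM -trX -ler_pdivrMr // ltW //; near: n; exact: n4.
    - rewrite -trX -ler_pdivrMr //.
      have : `|\tr (pmx 'X^k (W n)) / (d n)%:R| < K%:R by near: n.
      by rewrite normrM normfV [`|_%:R|]ger0_norm // => /ltW.
  have l1' : (i == j)%:R * (\tr (W n ^+ k) / (d n)%:R) @[n --> \oo] --> (L k i j : R).
    apply: cvgM; first exact: cvg_cst.
    by under eq_fun do rewrite -trX.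
  rewrite [X in X @ _ --> _](_ : _ = fun n => (dot (A n *m delta_mx i 0)
      (W n ^+ k *m (A n *m delta_mx j 0)) - (i == j)%:R * (\tr (W n ^+ k) / (d n)%:R)) +
      (i == j)%:R * (\tr (W n ^+ k) / (d n)%:R)); last first.
    by apply/funext => n; rewrite subrK.
  by rewrite -[L k i j]add0r; exact: cvgD.
have := @form_lim _ _ _ _ _ _ _ hL P b c.
have -> : \sum_(k < size P) P`_k * \sum_i \sum_j b i 0 * (c j 0 * L k i j) = LP (EE F g) P * dot b c.
  rewrite LP_sum // mulr_suml; apply: eq_bigr => k _; rewrite -mulrA; congr (_ * _).
  rewrite /dot mulr_sumr; apply: eq_bigr => i _.
  rewrite (bigD1 i) //= big1 ?addr0 => [|j ji]; last first.
    by rewrite /L eq_sym (negbTE ji) mul0r !mulr0.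
  by rewrite /L eqxx mul1r; ring.
by [].
Unshelve. all: by end_near.
Qed.

Variables (r : nat) (A : forall n, 'M[R]_(n, r)) (B : forall n, 'M[R]_(ncols gamma n, r)).
Variables (Z : forall n, 'M[R]_(n, ncols gamma n)) (s : nat -> seq R).
Hypothesis s_sv : forall n, singular_values (Z n) (s n).
Hypothesis s_cdf : forall t : R, {for t, continuous F} ->
  empirical_cdf (s n) t @[n --> \oo] --> F t.
Hypothesis s_top : (s n)`_0 @[n --> \oo] --> zp.
Let good n := (r <= ncols gamma n)%N.
Let W n := Z n *m (Z n)^T.
Let W' n := (Z n)^T *m Z n.
Hypothesis iso : forall n, good n -> (A n)^T *m A n = 1%:M /\ (B n)^T *m B n = 1%:M.
Hypothesis quadA : forall (k K m : nat) (i j : 'I_r), \forall n \near \oo,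
    good n -> \tr ((W n ^+ k) ^+ 4) <= K%:R * n%:R -> `|\tr (W n ^+ k)| <= K%:R * n%:R ->
    `|dot (A n *m delta_mx i 0) (W n ^+ k *m (A n *m delta_mx j 0)) -
       (i == j)%:R * (\tr (W n ^+ k) / n%:R)| < m.+1%:R^-1.
Hypothesis quadB : forall (k K m : nat) (i j : 'I_r), \forall n \near \oo,
    good n -> \tr ((W' n ^+ k) ^+ 4) <= K%:R * (ncols gamma n)%:R ->
    `|\tr (W' n ^+ k)| <= K%:R * (ncols gamma n)%:R ->
    `|dot (B n *m delta_mx i 0) (W' n ^+ k *m (B n *m delta_mx j 0)) -
       (i == j)%:R * (\tr (W' n ^+ k) / (ncols gamma n)%:R)| < m.+1%:R^-1.
Hypothesis cross : forall (k K m : nat) (i j : 'I_r), \forall n \near \oo,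
  good n -> dot (W n ^+ k *m (Z n *m (B n *m delta_mx j 0))) (W n ^+ k *m (Z n *m (B n *m delta_mx j 0)))
     <= K%:R ->
  `|dot (A n *m delta_mx i 0) (W n ^+ k *m (Z n *m (B n *m delta_mx j 0)))| < m.+1%:R^-1.

Lemma sample_good : \forall n \near \oo, good n.
Proof. by case: r @good => [|r' g]; [near=> n|apply: ncols_oo]. Unshelve. all: by end_near. Qed.

(** The concentration statements and the convergence of the traces give the
    quadratic forms of monomials, and linearity those of polynomials. *)
Lemma sample_spiked : spiked \oo A B Z zp (LP (EE F gamma)) (LP (EE F 1)).
Proof.
have gd := sample_good; split.
- by apply: filterS gd => n /iso[].
- by apply: filterS gd => n /iso[].
- exact: noise_opb s_sv s_top.
- apply: (quad_form_lim gd _ _ quadA); first exact: nbhs_infty_gt.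
  by apply: noise_trace_left s_top.
- apply: (quad_form_lim gd _ _ quadB); first exact: ncols_oo.
  by apply: noise_trace_right s_top.
move=> P b c.
have h k i j : dot (A n *m delta_mx i 0) (W n ^+ k *m ((Z n *m B n) *m delta_mx j 0)) @[n --> \oo] --> (0 : R).
  have [K hK] : exists K : nat, ((zp + 1) ^+ 2) ^+ k * (zp + 1) < K%:R.
    by eexists; apply: archi_boundP; rewrite mulr_ge0 ?exprn_ge0 ?addr_ge0 // ltW.
  apply: natinv_cvg0 => m; have hm := cross k (K ^ 2) m i j.
  have op := noise_opb s_sv s_top (_ : zp < zp + 1); rewrite ltrDl in op.
  have {}op := op ltr01.
  near=> n; rewrite -mulmxA; move: (near hm n) => hn; apply: hn => //; first by near: n.
  have opn : opb (Z n) (zp + 1) by near: n.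
  have z1 : 0 <= zp + 1 by rewrite addr_ge0 // ltW.
  have gn : good n by near: n.
  have [_ BB] := iso gn.
  have := opbX k (exprn_ge0 2 z1) (opb_gram z1 opn).
  move=> /(_ (Z n *m (B n *m delta_mx j 0))) h1.
  rewrite -nrm_sqr natrX lerXn2r ?nnegrE ?nrm_ge0 //; apply: le_trans h1 _.
  apply: le_trans (ltW hK); rewrite ler_wpM2l ?exprn_ge0 //.
  apply: le_trans (opn _) _; rewrite (nrm_isom _ BB).
  by rewrite /nrm dot_delta mxE !eqxx sqrtr1 mulr1.
have := @form_lim _ _ _ _ _ _ _ h P b c.
rewrite big1 => [|k _]; last by rewrite big1 ?mulr0 // => i _; rewrite big1 // => j _; rewrite !mulr0.
by under eq_fun do rewrite -mulmxA.
Unshelve. all: by end_near.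
Qed.

End SpikedSample.

(** * Limits of the singular values and of the overlaps with the signal *)

Lemma sum_rank1 (R : realType) n p r (c : 'I_r -> R) (a : 'M[R]_(n, r)) (b : 'M[R]_(p, r)) :
  \sum_i c i *: (col i a *m (col i b)^T) = a *m diag_mx (\row_i c i) *m b^T.
Proof.
apply/matrixP => i j; rewrite summxE !mxE; apply: eq_bigr => k _.
by rewrite mul_mx_diag !mxE big_ord1 !mxE mulrA [_ * a i k]mulrC.
Qed.

Section SampleLimits.
Context {R : realType} (F : cumulativeBounded (0 : R) (1 : R)) (gamma : R).
Let zp := upper_edge F.
Hypotheses (gamma_gt0 : 0 < gamma) (gamma_le1 : gamma <= 1).
Hypotheses (cmp : compactly_supported_cdf F) (zp_gt0 : 0 < zp)
  (F_neg : forall t, t < 0 -> F t = 0).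
Hypothesis div : (\int[lebesgue_stieltjes_measure F]_t ((y - t) ^- 2)%:E)%E
        @[y --> (upper_edge F)^'+] --> +oo%E.
Variables (r : nat) (x : r.-tuple R).
Hypothesis x_signal : is_signal x.
Variables (A : forall n, 'M[R]_(n, r)) (B : forall n, 'M[R]_(ncols gamma n, r)).
Variables (Z : forall n, 'M[R]_(n, ncols gamma n)) (s : nat -> seq R).
Hypothesis s_sv : forall n, singular_values (Z n) (s n).
Hypothesis s_cdf : forall t : R, {for t, continuous F} ->
  empirical_cdf (s n) t @[n --> \oo] --> F t.
Hypothesis sp : spiked \oo A B Z zp (LP (EE F gamma)) (LP (EE F 1)).
Let X n := signal_mx x (A n) (B n).
Variables (u : forall n, 'M[R]_(n, ncols gamma n)) (y : nat -> seq R)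
  (v : forall n, 'M[R]_(ncols gamma n)).
Hypothesis Y_svd : forall n, is_svd (X n + Z n) (u n) (y n) (v n).

Let xs (i : 'I_r) : R := x`_i.

Lemma signal_mxE n p (a : 'M[R]_(n, r)) (b : 'M[R]_(p, r)) :
  signal_mx x a b = a *m diag_mx (\row_i xs i) *m b^T.
Proof. exact: sum_rank1. Qed.

Lemma signal_gt0 i : (i < r)%N -> 0 < x`_i.
Proof. by move=> ir; case: x_signal => _ _ /allP; apply; rewrite mem_nth // size_tuple. Qed.

Lemma signal_decr i j : (i < j)%N -> (j < r)%N -> x`_j < x`_i.
Proof.
move=> ij jr; case: x_signal => _ so _.
apply: (sorted_ltn_nth (leT := fun s t : R => t < s) _ 0 so) => //.
- by move=> a b c ab bc; exact: lt_trans ab.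
- by rewrite inE size_tuple (ltn_trans ij).
- by rewrite inE size_tuple.
Qed.

(** As the spikes are decreasing, the outliers come first and are counted by the
    position of the first spike which is not above [x_plus]. *)
Definition n_out := find (fun t => ~~ (x_plus gamma F < t)) x.

Lemma n_outP i : (i < r)%N -> (i < n_out)%N = (x_plus gamma F < x`_i).
Proof.
move=> ir; apply/idP/idP => [/(before_find 0)/negbT|h]; first by rewrite negbK.
rewrite ltnNge; apply/negP => mi.
have hh : has (fun t => ~~ (x_plus gamma F < t)) x.
  by rewrite has_find size_tuple; exact: leq_ltn_trans mi ir.
have /negP := nth_find 0 hh; apply; rewrite -/n_out; move: mi.
rewrite leq_eqVlt => /predU1P[->//|mi]; apply: lt_trans h _.
exact: signal_decr.
Qed.

Lemma y_inftyE k : y_infty gamma F x k = if (k < r)%N && (k < n_out)%N then Yfun gamma F x`_k else zp.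
Proof. by rewrite /y_infty; case: ltnP => //= kr; rewrite n_outP. Qed.

Lemma y_infty_ge k : zp <= y_infty gamma F x k.
Proof.
rewrite /y_infty; case: ifP => // /andP[kr xk].
by have [/ltW] := YfunP cmp zp_gt0 F_neg gamma_gt0 gamma_le1 (signal_gt0 kr) xk.
Qed.

Let dp_oo k : \forall n \near \oo, (k < ncols gamma n)%N.
Proof. exact: ncols_oo. Qed.

(** The mass of the limiting law just below the edge holds back any fixed number
    of singular values of the noise. *)
Lemma noise_sv_ge j e : 0 < e -> \forall n \near \oo, zp - e <= (s n)`_j.
Proof.
move=> e0.
have [c /andP[c1 c2] hc] := continuity_grid (cumulative_is_nondecreasing F)
  (cumulative_is_right_continuous F) (zp + 1) e0.
have [t [tz zt ct]] : exists t, [/\ t < zp, zp - e <= t & {for t, continuous F}].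
  have ex : exists N : nat, zp <= c + N.+1%:R * e.
    exists (Num.bound ((zp - c) / e)); rewrite -lerBlDl -ler_pdivrMr //.
    have cz : c <= zp by apply: (le_trans (ltW c2)); exact: ltW.
    have h : 0 <= (zp - c) / e by rewrite divr_ge0 ?subr_ge0 // ltW.
    by apply: le_trans (ltW (archi_boundP h)) _; rewrite ler_nat.
  have [N hN min] := ex_minnP ex.
  have tz : c + N%:R * e < zp.
    case: N hN min => [|N] hN min; first by rewrite mul0r addr0 (lt_trans c2).
    by rewrite ltNge; apply/negP => /min; rewrite ltnn.
  exists (c + N%:R * e); split=> //.
    by rewrite lerBlDr -addrA -[X in _ + (_ + X)]mul1r -mulrDl natr1.
  by apply: hc; apply: lt_trans tz _; rewrite ltrDl.
have Ft : F t < 1.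
  rewrite ltNge; apply/negP => Ft; move: tz; rewrite ltNge => /negP; apply.
  apply: ge_sup; first by exists (-1); rewrite /= F_neg ?ltrN10.
  move=> a /= Fa; rewrite leNgt; apply/negP => ta.
  by have := le_trans Ft (cumulative_is_nondecreasing F _ _ (ltW ta)); rewrite leNgt Fa.
pose eta := (1 - F t) / 2; have eta0 : 0 < eta by rewrite divr_gt0 // subr_gt0.
have cdf : \forall n \near \oo, empirical_cdf (s n) t < 1 - eta.
  by apply: (cvgr_lt _ (s_cdf ct)); rewrite /eta; lra.
near=> n.
have sz : size (s n) = ncols gamma n by have [U [V h]] := s_sv n; exact: svd_size h.
apply: le_trans zt _; rewrite leNgt; apply/negP => sj.
have cn : empirical_cdf (s n) t < 1 - eta by near: n.
have pj : (j < ncols gamma n)%N by near: n; exact: dp_oo.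
have p0 : 0 < (ncols gamma n)%:R :> R by rewrite ltr0n (leq_ltn_trans _ pj).
have pe : j%:R / eta < (ncols gamma n)%:R.
  apply: lt_le_trans (ncols_ge gamma_gt0 n); rewrite [gamma * _]mulrC -ltr_pdivrMr //.
  by near: n; exact: nbhs_infty_gtr.
have big : (ncols gamma n - j <= count (fun a : R => (a <= t)%R) (s n))%N.
  rewrite -[X in count _ X](cat_take_drop j) count_cat; apply: leq_trans (leq_addl _ _).
  rewrite -sz -size_drop.
  have : all (fun a : R => (a <= t)%R) (drop j (s n)); last by rewrite all_count => /eqP ->.
  apply/(all_nthP 0) => i; rewrite size_drop => ij; rewrite nth_drop.
  have [U [V h]] := s_sv n.
  by apply: le_trans (svd_sorted h (leq_addr i j)) (ltW sj).
move: cn; rewrite /empirical_cdf sz ltr_pdivrMr // ltNge => /negP; apply.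
apply: (@le_trans _ _ (ncols gamma n - j)%:R); last by rewrite ler_nat.
rewrite natrB ?(ltnW pj) // mulrBl mul1r lerD2l lerN2.
by rewrite mulrC -ler_pdivrMr // ltW.
Unshelve. all: by end_near.
Qed.

Section Ultra.
Variables (U : set_system nat) (UU : UltraFilter U) (ooU : \oo `<=` U).

Let spU : spiked U A B Z zp (LP (EE F gamma)) (LP (EE F 1)) := spiked_finer ooU sp.
Let dpU k : \forall n \near U, (k < ncols gamma n)%N := ooU (dp_oo k).
Let x0 j : 0 < xs j. Proof. exact: signal_gt0. Qed.
Let xd (i j : 'I_r) : (i < j)%N -> xs j < xs i.
Proof. by move=> ij; exact: signal_decr. Qed.
Let Yd n : is_svd (A n *m diag_mx (\row_i xs i) *m (B n)^T + Z n) (u n) (y n) (v n).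
Proof. by rewrite -signal_mxE; exact: Y_svd. Qed.
Let dat l := noise_edge_data cmp zp_gt0 F_neg gamma_gt0 gamma_le1 (l := l).
Let inj l l' : zp < l -> zp < l' -> phit gamma F l * phi F l = phit gamma F l' * phi F l' -> l = l'.
Proof.
rewrite ![phit _ _ _ * _]mulrC.
exact: (Dfun_inj cmp zp_gt0 F_neg gamma_gt0 gamma_le1).
Qed.
Let Yf (j : 'I_r) := Yfun gamma F (xs j).
Let out (j : 'I_r) : (j < n_out)%N -> x_plus gamma F < xs j.
Proof. by rewrite n_outP. Qed.
Let Yg (j : 'I_r) : (j < n_out)%N -> zp < Yf j.
Proof. by move=> /out h; have [] := YfunP cmp zp_gt0 F_neg gamma_gt0 gamma_le1 (x0 j) h. Qed.
Let Ye (j : 'I_r) : (j < n_out)%N -> xs j ^+ 2 * (phit gamma F (Yf j) * phi F (Yf j)) = 1.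
Proof.
move=> /out h; have [_] := YfunP cmp zp_gt0 F_neg gamma_gt0 gamma_le1 (x0 j) h.
rewrite -/(Yf j) /Dfun [phi _ _ * _]mulrC => ->.
by rewrite mulrC div1r mulVf // gt_eqF // exprn_gt0.
Qed.
Let ns (j : 'I_r) : (n_out <= j)%N -> forall l, zp < l -> xs j ^+ 2 * (phit gamma F l * phi F l) != 1.
Proof.
move=> jm l zl; rewrite [phit _ _ _ * _]mulrC.
apply: (no_outlier cmp zp_gt0 F_neg gamma_gt0 gamma_le1) => //.
by rewrite leNgt -n_outP // -leqNgt.
Qed.
Let Yde (i j : 'I_r) : (i < j)%N -> (j < n_out)%N -> Yf j < Yf i.
Proof.
move=> ij jm; have im := ltn_trans ij jm.
have [z1 e1] := YfunP cmp zp_gt0 F_neg gamma_gt0 gamma_le1 (x0 i) (out im).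
have [z2 e2] := YfunP cmp zp_gt0 F_neg gamma_gt0 gamma_le1 (x0 j) (out jm).
rewrite -/(Yf j) -/(Yf i) in z1 z2 e1 e2.
have lt : Dfun gamma F (Yf i) < Dfun gamma F (Yf j).
  rewrite e1 e2 !div1r ltf_pV2 ?posrE ?exprn_gt0 //.
  by rewrite ltrXn2r ?nnegrE ?(ltW (x0 _)) // xd.
rewrite ltNge; apply/negP; rewrite le_eqVlt => /predU1P[e|h]; first by rewrite e ltxx in lt.
have := Dfun_decr cmp zp_gt0 F_neg gamma_gt0 gamma_le1 z1 h.
by rewrite ltNge (ltW lt).
Qed.

Lemma n_out_le : (n_out <= r)%N.
Proof. by rewrite -[X in (_ <= X)%N](size_tuple x); exact: find_size. Qed.

(** Outside the outliers the limit is at most the edge, and Weyl's inequality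
    with the noise gives the converse. *)
Lemma ultra_sv k : (y n)`_k @[n --> U] --> y_infty gamma F x k.
Proof.
rewrite y_inftyE; case: ifP => [/andP[kr km]|h].
  exact: (@outlier_lim _ _ _ _ _ _ _ _ _ _ _ _ _ zp_gt0 spU dpU x0 xd _ _ _ Yd _ _ _ _ _ _ dat inj
    _ _ Yg Ye ns Yde k kr km).
have mk : (n_out <= k)%N.
  move/negbT: h; rewrite negb_and -!leqNgt => /orP[rk|//].
  exact: leq_trans n_out_le rk.
have [l hl] := sing_lim_ex spU dpU x0 Yd k.
(* the index [k] is past the outliers *)
have le : l <= zp.
  exact: (@bulk_le _ _ _ _ _ _ _ _ _ _ _ _ _ zp_gt0 spU dpU x0 xd _ _ _ Yd _ _ _ _ _ _ dat inj
    _ _ Yg Ye ns Yde k l mk hl).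
have ge : zp <= l.
  apply/ler_addgt0Pr => e e0; rewrite -lerBlDr; apply: (cvg_ge_const hl).
  apply: ooU; near=> n; apply: (@le_trans _ _ (s n)`_(k + r)).
    by near: n; exact: noise_sv_ge.
  have [U' [V' h']] := s_sv n.
  by apply: (svd_weyl (Yd n) h' erefl); near: n; exact: dp_oo.
by rewrite (_ : zp = l) //; apply/le_anti; rewrite le ge.
Unshelve. all: by end_near.
Qed.

(** The value [Yfun / (kap - 1)] is the overlap [x * Cfun] of an outlier. *)
Definition overlap_infty k : R := if (k < r)%N && (k < n_out)%N
  then Yfun gamma F x`_k / (kap F gamma (Yfun gamma F x`_k ^+ 2) - 1) else 0.

Lemma ultra_signal k : dot (lvec u k n) (X n *m rvec v k n) @[n --> U] --> overlap_infty k.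
Proof.
under eq_fun do rewrite /X signal_mxE.
rewrite /overlap_infty; case: ifP => [/andP[kr km]|h].
  have := @outlier_signal _ _ UU _ _ _ _ _ _ _ _ _ _ zp_gt0 spU dpU x0 xd _ _ _ Yd _ _ _ _ _ _ dat inj
    _ _ Yg Ye ns Yde (Ordinal kr) km.
  rewrite (outlier_signalE cmp zp_gt0 F_neg gamma_gt0 gamma_le1 (signal_gt0 kr)) //.
  by rewrite -n_outP.
have yk : (y n)`_k @[n --> U] --> zp by have := y_inftyE k; rewrite h => <-; exact: ultra_sv.
exact: (edge_signal zp_gt0 spU dpU Yd yk (edge_blowup cmp zp_gt0 F_neg gamma_gt0 gamma_le1 div)).
Qed.

End Ultra.

Lemma sample_sv k : (y n)`_k @[n --> \oo] --> y_infty gamma F x k.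
Proof. by apply: cvg_ultra => U UU ooU; exact: ultra_sv. Qed.

Lemma sample_signal k : dot (lvec u k n) (X n *m rvec v k n) @[n --> \oo] --> overlap_infty k.
Proof. by apply: cvg_ultra => U UU ooU; exact: ultra_signal. Qed.

End SampleLimits.

(** * The loss as a sum over the retained singular values *)

Section Loss.
Context {R : realType} (n p r : nat) (x : 'I_r -> R).
Variables (A : 'M[R]_(n, r)) (B : 'M[R]_(p, r)).
Hypotheses (AA : A^T *m A = 1%:M) (BB : B^T *m B = 1%:M) (x_ge0 : forall i, 0 <= x i).
Let X := A *m diag_mx (\row_i x i) *m B^T.
Variables (Y U : 'M[R]_(n, p)) (s : seq R) (V : 'M[R]_p).
Hypothesis svd : is_svd Y U s V.

Lemma frobenius_tr m q (M : 'M[R]_(m, q)) : frobenius_sq M = \tr (M^T *m M).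
Proof.
rewrite /frobenius_sq exchange_big; apply: eq_bigr => j _.
by rewrite mxE; apply: eq_bigr => i _; rewrite mxE expr2.
Qed.

Lemma tr_isom_diag m q k (a : 'M[R]_(m, k)) (b : 'M[R]_(q, k)) (d : 'rV[R]_k) :
  a^T *m a = 1%:M -> b^T *m b = 1%:M ->
  \tr ((a *m diag_mx d *m b^T)^T *m (a *m diag_mx d *m b^T)) = \sum_i d 0 i ^+ 2.
Proof.
move=> ha hb; rewrite !trmx_mul trmxK tr_diag_mx -!mulmxA mxtrace_mulC -!mulmxA hb mulmx1.
rewrite [a^T *m _]mulmxA ha mul1mx mulmx_diag mxtrace_diag.
by apply: eq_bigr => i _; rewrite mxE expr2.
Qed.

Lemma SE_gain theta : SE X U s V theta =
  \sum_i x i ^+ 2 + \sum_(k < p) (theta < s`_k)%R%:R * (s`_k ^+ 2 - 2 * s`_k * dot (col k U) (X *m col k V)).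
Proof.
pose h (k : 'I_p) := s`_k * (theta < s`_k)%R%:R.
have HE : hard_threshold U s V theta = U *m diag_mx (\row_k h k) *m V^T by exact: sum_rank1.
have [UU VV _ _] := svd.
rewrite /SE HE frobenius_tr; set H := _ *m V^T.
have -> : (X - H)^T = X^T - H^T by exact: linearB.
rewrite mulmxBl !mulmxBr !linearB /=.
have c1 : \tr (X^T *m H) = \tr (H^T *m X).
  by rewrite -mxtrace_tr trmx_mul trmxK.
have c2 (M : 'M[R]_(n, p)) : \tr (H^T *m M) = \sum_k h k * dot (col k U) (M *m col k V).
  rewrite /H !trmx_mul trmxK tr_diag_mx -!mulmxA mxtrace_mulC -!mulmxA.
  rewrite /mxtrace; apply: eq_bigr => k _; rewrite mul_diag_mx mxE [X in X * _]mxE; congr (_ * _).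
  have -> : M *m col k V = col k (M *m V) by rewrite !colE mulmxA.
  by rewrite mxE /dot; apply: eq_bigr => i _; rewrite !mxE.
rewrite c1 c2 /X !tr_isom_diag //.
have e1 : \sum_i (\row_i x i) 0 i ^+ 2 = \sum_i x i ^+ 2 :> R by apply: eq_bigr => i _; rewrite mxE.
have e2 : \sum_k (\row_k h k) 0 k ^+ 2 = \sum_k h k ^+ 2 by apply: eq_bigr => i _; rewrite mxE.
rewrite e1 e2 -/X -addrA; congr (_ + _).
rewrite opprK addrA -!sumrN -!big_split /=; apply: eq_bigr => k _; rewrite /h.
by case: (theta < s`_k); rewrite ?mulr1 ?mulr0 ?mul1r ?mul0r; ring.
Qed.

(** Bessel's inequality on both sides bounds all the overlaps together. *)
Lemma overlap_sum_le : \sum_(k < p) `|dot (col k U) (X *m col k V)| <= \sum_i x i.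
Proof.
have e k : dot (col k U) (X *m col k V) =
    \sum_i x i * (dot (col k U) (A *m delta_mx i 0) * dot (col k V) (B *m delta_mx i 0)).
  rewrite /X -!mulmxA dot_mulr /dot; apply: eq_bigr => i _.
  rewrite diag_mulE mulrCA; congr (_ * (_ * _)).
    by rewrite -dot_delta dot_mulr trmxK dotC.
  by rewrite -dot_delta dot_mulr trmxK dotC.
apply: (@le_trans _ _ (\sum_(k < p) \sum_i x i * `|dot (col k U) (A *m delta_mx i 0) * dot (col k V) (B *m delta_mx i 0)|)).
  apply: ler_sum => k _; rewrite e; apply: le_trans (ler_norm_sum _ _ _) _.
  by apply: ler_sum => i _; rewrite normrM ger0_norm.
rewrite exchange_big /=; apply: ler_sum => i _; rewrite -mulr_sumr -[leRHS]mulr1 ler_wpM2l //.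
have h (a b : R) : `|a * b| <= (a ^+ 2 + b ^+ 2) / 2.
  rewrite normrM -[a ^+ 2]real_normK ?num_real // -[b ^+ 2]real_normK ?num_real //.
  by have := sqr_ge0 (`|a| - `|b|); lra.
apply: (@le_trans _ _ (\sum_(k < p) (dot (col k U) (A *m delta_mx i 0) ^+ 2 + dot (col k V) (B *m delta_mx i 0) ^+ 2) / 2)).
  by apply: ler_sum => k _; exact: h.
rewrite -mulr_suml big_split /= ler_pdivrMr // mul1r.
have -> : 2 = 1 + 1 :> R by [].
apply: lerD.
  apply: le_trans (svd_bessel svd _) _.
  by rewrite dot_mull mulmxA AA mul1mx dot_delta mxE !eqxx.
by rewrite -(svd_parseval svd) dot_mull mulmxA BB mul1mx dot_delta mxE !eqxx.
Qed.

End Loss.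


(** * Thresholding with converging gains *)

Section Thresholding.
Context {R : realType} (r : nat) (T zp base S : R) (p : nat -> nat).
Variables (y g : nat -> nat -> R) (yoo goo : nat -> R) (SE : nat -> R -> R).
Hypothesis zp_gt0 : 0 < zp.
Hypothesis (zp_T : zp < T) (S_ge0 : 0 <= S).
Hypothesis p_oo : forall k, \forall n \near \oo, (k < p n)%N.
Hypothesis SE_sum : \forall n \near \oo, forall th,
  SE n th = base + \sum_(k < p n) (th < y n k)%R%:R * g n k.
Hypothesis y_dec : forall n i j, (i <= j)%N -> y n j <= y n i.
Hypothesis y_lim : forall k, y n k @[n --> \oo] --> yoo k.
Hypothesis g_lim : forall k, g n k @[n --> \oo] --> goo k.
Hypothesis yoo_ge : forall k, zp <= yoo k.
Hypothesis yoo_bulk : forall k, (r <= k)%N -> yoo k = zp.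
Hypothesis goo_below : forall k, yoo k < T -> 0 <= goo k.
Hypothesis goo_above : forall k, T < yoo k -> goo k <= 0.
Hypothesis goo_at : forall k, yoo k = T -> goo k = 0.
Hypothesis g_low : \forall n \near \oo, forall th,
  \sum_(k < p n) (th < y n k)%R%:R * y n k ^+ 2 - 2 * y n 0%N * S <=
  \sum_(k < p n) (th < y n k)%R%:R * g n k.

(** The limit of the loss when exactly the components with a negative limiting
    gain are retained. *)
Definition best : R := base + \sum_(k < r) Num.min 0 (goo k).

Lemma min_goo k : Num.min 0 (goo k) = if T < yoo k then goo k else 0.
Proof.
have [h|h|h] := ltgtP T (yoo k).
- by rewrite min_r // goo_above.
- by rewrite min_l // goo_below.
- by rewrite goo_at // minxx.
Qed.

Lemma min0E (t : R) : Num.min 0 t = (t - `|t|) / 2.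
Proof.
case: (lerP 0 t) => t0; first by rewrite ger0_norm // subrr mul0r.
by rewrite ltr0_norm //; field.
Qed.

(** Components whose level tends to a limit other than [T] are eventually
    retained exactly when their limiting gain is negative; at the limit [T] the
    selection may oscillate, but the gain vanishes. *)
Lemma threshold_lim (th : nat -> R) (th0 : R) : th n @[n --> \oo] --> th0 -> zp < th0 ->
  (forall k, (k < r)%N -> yoo k < T -> yoo k < th0) ->
  (forall k, (k < r)%N -> T < yoo k -> th0 < yoo k) ->
  SE n (th n) @[n --> \oo] --> best.
Proof.
move=> hth zth low up.
have lt k : yoo k < th0 -> \forall n \near \oo, y n k <= th n.
  rewrite -subr_gt0 => h.
  have d : (th n - y n k) @[n --> \oo] --> th0 - yoo k by apply: cvgB => //; exact: y_lim.
  by apply: filterS (cvgr_gt _ d _ h) => n; rewrite subr_gt0 => /ltW.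
have gt k : th0 < yoo k -> \forall n \near \oo, th n < y n k.
  rewrite -subr_gt0 => h.
  have d : (y n k - th n) @[n --> \oo] --> yoo k - th0 by apply: cvgB => //; exact: y_lim.
  by apply: filterS (cvgr_gt _ d _ h) => n; rewrite subr_gt0.
have term (k : 'I_r) : (th n < y n k)%R%:R * g n k @[n --> \oo] --> (Num.min 0 (goo k) : R).
  rewrite min_goo; have [h|h|h] := ltgtP (yoo k) T.
  - apply: cvg_near_cst; have hl := lt k (low k (ltn_ord k) h).
    by apply: filterS hl => n hn; rewrite ltNge hn mul0r.
  - apply: cvg_trans (@g_lim k); apply: near_eq_cvg; have hl := gt k (up k (ltn_ord k) h).
    by apply: filterS hl => n hn; rewrite hn mul1r.
  - have := @g_lim k; rewrite goo_at // => /cvgr0Pnorm_lt h0.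
    apply/cvgr0Pnorm_lt => e e0; apply: filterS (h0 e e0) => n; apply: le_lt_trans.
    by case: (_ < _); rewrite ?mul1r ?mul0r ?normr0.
have h : base + \sum_(k < r) (th n < y n k)%R%:R * g n k @[n --> \oo] --> best.
  by apply: cvgD; [exact: cvg_cst|apply: cvg_sumf => k _; exact: term].
have lr : \forall n \near \oo, y n r <= th n by apply: lt; rewrite yoo_bulk.
apply: cvg_trans h; apply: near_eq_cvg; near=> n.
have -> : SE n (th n) = base + \sum_(k < p n) (th n < y n k)%R%:R * g n k.
  by move: (th n); near: n.
congr (_ + _).
have rp : (r <= p n)%N by apply: ltnW; near: n.
rewrite (big_ord_widen _ (fun k => (th n < y n k)%R%:R * g n k) rp) big_mkcond.
apply: eq_bigr => k _; case: ltnP => // rk.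
have yr : y n r <= th n by near: n.
by rewrite ltNge (le_trans (y_dec n rk) yr) mul0r.
Unshelve. all: by end_near.
Qed.

(** Keeping many components costs a fixed amount for each of them, so that only
    boundedly many components matter to the oracle. The negative parts of their
    gains bound the loss from below, and the threshold [T] attains the limit of
    this bound. *)
Lemma oracle_lim : inf [set SE n th | th in [set th : R | 0 <= th]] @[n --> \oo] --> best.
Proof.
(* beyond [K] retained components their total cost exceeds any possible gain *)
pose C := yoo 0%N + 1.
pose K := maxn r (Num.bound (8 * C * S / zp ^+ 2)).
have C0 : 0 <= C by rewrite addr_ge0 // (le_trans (ltW zp_gt0)).
have z2 : 0 < zp ^+ 2 by rewrite exprn_gt0.
have KS : 2 * C * S <= K%:R * (zp / 2) ^+ 2.
  have h : 0 <= 8 * C * S / zp ^+ 2 by rewrite divr_ge0 ?(ltW z2) // !mulr_ge0.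
  have h2 : 8 * C * S / zp ^+ 2 <= K%:R.
    apply: le_trans (ltW (archi_boundP h)) _; rewrite ler_nat; exact: leq_maxr.
  rewrite ler_pdivrMr // in h2.
  have -> : K%:R * (zp / 2) ^+ 2 = K%:R * zp ^+ 2 / 4 by field.
  by rewrite ler_pdivlMr //; apply: le_trans h2; lra.
pose lowb n := base + \sum_(k < K) Num.min 0 (g n k).
have lowb_lim : lowb n @[n --> \oo] --> best.
  have -> : best = base + \sum_(k < K) Num.min 0 (goo k).
    rewrite /best; congr (_ + _).
    rewrite (big_ord_widen K (fun k => Num.min 0 (goo k)) (leq_maxl _ _)) big_mkcond.
    apply: eq_bigr => k _; case: ltnP => // rk.
    by rewrite min_l // goo_below // yoo_bulk.
  apply: cvgD; first exact: cvg_cst.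
  apply: cvg_sumf => k _; rewrite min0E; under eq_fun do rewrite min0E.
  apply: cvgM; last exact: cvg_cst.
  by apply: cvgB; [exact: g_lim|apply: cvg_norm; exact: g_lim].
have up : SE n T @[n --> \oo] --> best.
  by apply: (@threshold_lim (fun=> T) T) => //; exact: cvg_cst.
have bound : \forall n \near \oo, lowb n <= inf [set SE n th | th in [set th : R | 0 <= th]] <= SE n T.
  have yK : \forall n \near \oo, zp / 2 < y n K.
    apply: (cvgr_gt _ (@y_lim K)); apply: lt_le_trans (yoo_ge K).
    by rewrite ltr_pdivrMr // ltr_pMr // ltr1n.
  have yC : \forall n \near \oo, y n 0%N <= C.
    by apply: (cvgr_le _ (@y_lim 0%N)); rewrite ltrDl.
  near=> n.
  have lb th : 0 <= th -> lowb n <= SE n th.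
    move=> th0; have -> : SE n th = base + \sum_(k < p n) (th < y n k)%R%:R * g n k.
      by move: th {th0}; near: n.
    rewrite lerD2l.
    have Kp : (K <= p n)%N by apply: ltnW; near: n.
    have min0 : \sum_(k < K) Num.min 0 (g n k) <= 0 by apply: sumr_le0 => k _; rewrite ge_min lexx.
    have [yth|thy] := lerP (y n K) th.
      have -> : \sum_(k < p n) (th < y n k)%R%:R * g n k = \sum_(k < K) (th < y n k)%R%:R * g n k.
        rewrite (big_ord_widen _ (fun k => (th < y n k)%R%:R * g n k) Kp) [RHS]big_mkcond.
        apply: eq_bigr => k _; case: ltnP => // rk.
        by rewrite ltNge (le_trans (y_dec n rk) yth) mul0r.
      apply: ler_sum => k _; case: (_ < _); rewrite ?mul1r ?mul0r ge_min lexx ?orbT //.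
    apply: le_trans min0 _.
    have low : \sum_(k < p n) (th < y n k)%R%:R * y n k ^+ 2 - 2 * y n 0%N * S <=
        \sum_(k < p n) (th < y n k)%R%:R * g n k by move: th {th0 thy}; near: n.
    apply: le_trans low; rewrite subr_ge0.
    have hK : zp / 2 < y n K by near: n.
    have hC : y n 0%N <= C by near: n.
    have zh : 0 < zp / 2 by rewrite divr_gt0.
    have y00 : 0 <= y n 0%N by apply: le_trans (y_dec n (leq0n K)); rewrite ltW // (lt_trans zh).
    apply: (@le_trans _ _ (2 * C * S)).
      by rewrite ler_wpM2r // ler_wpM2l.
    apply: le_trans KS _.
    apply: (@le_trans _ _ (\sum_(k < K) (zp / 2) ^+ 2)).
      by rewrite sumr_const card_ord mulr_natl.
    rewrite (big_ord_widen (p n) (fun=> (zp / 2) ^+ 2) Kp) big_mkcond; apply: ler_sum => k _.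
    case: ltnP => [kK|_]; last by rewrite mulr_ge0 ?sqr_ge0.
    have hk : y n K <= y n k by apply: y_dec; exact: ltnW.
    rewrite (lt_le_trans thy hk) mul1r lerXn2r ?nnegrE ?(ltW zh) //.
      by rewrite (le_trans (ltW zh)) // (le_trans (ltW hK)).
    by rewrite (le_trans (ltW hK)).
  apply/andP; split.
    apply: lb_le_inf; first by exists (SE n 0), 0 => //=.
    by move=> _ [th th0 <-]; exact: lb.
  apply: ge_inf; first by exists (lowb n) => _ [th th0 <-]; exact: lb.
  by exists T => //=; rewrite ltW // (lt_trans zp_gt0).
exact: (squeeze_cvgr bound lowb_lim up).
Unshelve. all: by end_near.
Qed.

End Thresholding.

(** * The loss along a sample *)

Section SampleLoss.
Context {R : realType} (F : cumulativeBounded (0 : R) (1 : R)) (gamma : R).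
Let zp := upper_edge F.
Hypotheses (gamma_gt0 : 0 < gamma) (gamma_le1 : gamma <= 1).
Hypotheses (cmp : compactly_supported_cdf F) (zp_gt0 : 0 < zp)
  (F_neg : forall t, t < 0 -> F t = 0).
Hypothesis div : (\int[lebesgue_stieltjes_measure F]_t ((y - t) ^- 2)%:E)%E
        @[y --> (upper_edge F)^'+] --> +oo%E.
Variables (r : nat) (x : r.-tuple R).
Hypothesis x_signal : is_signal x.
Variables (A : forall n, 'M[R]_(n, r)) (B : forall n, 'M[R]_(ncols gamma n, r)).
Variables (Z : forall n, 'M[R]_(n, ncols gamma n)) (s : nat -> seq R).
Hypothesis s_sv : forall n, singular_values (Z n) (s n).
Hypothesis s_cdf : forall t : R, {for t, continuous F} ->
  empirical_cdf (s n) t @[n --> \oo] --> F t.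
Hypothesis sp : spiked \oo A B Z zp (LP (EE F gamma)) (LP (EE F 1)).
Let X n := signal_mx x (A n) (B n).
Variables (u : forall n, 'M[R]_(n, ncols gamma n)) (y : nat -> seq R)
  (v : forall n, 'M[R]_(ncols gamma n)).
Hypothesis Y_svd : forall n, is_svd (X n + Z n) (u n) (y n) (v n).

Let T := Tgamma gamma F.
Let yoo k := y_infty gamma F x k.
Let goo k := yoo k ^+ 2 - 2 * yoo k * overlap_infty F gamma x k.
Let g n k := (y n)`_k ^+ 2 - 2 * (y n)`_k * dot (lvec u k n) (X n *m rvec v k n).

Let zp_T : zp < T. Proof. exact: Tgamma_gt. Qed.

Let goo_bulk k : (k < r)%N && (k < n_out F gamma x)%N = false -> yoo k = zp /\ goo k = zp ^+ 2.
Proof.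
by move=> h; rewrite /goo /yoo /overlap_infty y_inftyE // h mulr0 subr0.
Qed.

Let goo_out k (l := Yfun gamma F x`_k) : (k < r)%N -> (k < n_out F gamma x)%N ->
  [/\ zp < l, yoo k = l & goo k * (kap F gamma (l ^+ 2) - 1) = l ^+ 2 * (kap F gamma (l ^+ 2) - 3)
     /\ 0 < kap F gamma (l ^+ 2) - 1].
Proof.
move=> kr km; have x0 := signal_gt0 x_signal kr.
have out : x_plus gamma F < x`_k by rewrite -n_outP.
have [zl _] := YfunP cmp zp_gt0 F_neg gamma_gt0 gamma_le1 x0 out.
have k1 : 0 < kap F gamma (l ^+ 2) - 1.
  by have := kap_gt2 cmp zp_gt0 F_neg gamma_gt0 gamma_le1 (edge_sqr zp_gt0 zl); rewrite -/l; lra.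
split; rewrite /goo /yoo /overlap_infty ?y_inftyE // kr km //= -/l; split=> //.
by field; rewrite gt_eqF.
Qed.

(** The gain of an outlier at the level [l] is [l ^+ 2 * (kap - 3) / (kap - 1)],
    and [kap] exceeds 3 below [Tgamma]; outside the outliers the gain is a
    square. *)
Lemma goo_below k : yoo k < T -> 0 <= goo k.
Proof.
case h : ((k < r)%N && (k < n_out F gamma x)%N); last first.
  by have [_ ->] := goo_bulk h; rewrite sqr_ge0.
have /andP[kr km] := h; have [zl -> [e k1]] := goo_out kr km => lT.
rewrite -(pmulr_lge0 _ k1) e mulr_ge0 ?sqr_ge0 // subr_ge0 ltW //.
by apply: kap_below.
Qed.

Lemma goo_above k : T < yoo k -> goo k <= 0.
Proof.
case h : ((k < r)%N && (k < n_out F gamma x)%N); last first.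
  by have [-> _] := goo_bulk h; rewrite ltNge (ltW zp_T).
have /andP[kr km] := h; have [zl -> [e k1]] := goo_out kr km => lT.
rewrite -(pmulr_lle0 _ k1) e mulr_ge0_le0 ?sqr_ge0 // subr_le0.
exact: (kap_above cmp zp_gt0 F_neg gamma_gt0 gamma_le1).
Qed.

Lemma goo_at k : yoo k = T -> goo k = 0.
Proof.
case h : ((k < r)%N && (k < n_out F gamma x)%N); last first.
  by have [-> _] := goo_bulk h => e; have := zp_T; rewrite e ltxx.
have /andP[kr km] := h; have [zl -> [e k1]] := goo_out kr km => lT.
apply: (mulIf (lt0r_neq0 k1)); rewrite e lT mul0r.
by rewrite (kap_T cmp zp_gt0 F_neg gamma_gt0 gamma_le1 div) subrr mulr0.
Qed.

Lemma best_ASE : best r (\sum_(i < r) x`_i ^+ 2) goo = ASE gamma F x.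
Proof.
rewrite /best /ASE -big_split /=; apply: eq_bigr => i _.
have -> : R1 gamma F x`_i = x`_i ^+ 2 + goo i.
  have x0 := signal_gt0 x_signal (ltn_ord i).
  case h : ((i < r)%N && (i < n_out F gamma x)%N).
    have /andP[kr km] := h; rewrite /goo /yoo /overlap_infty y_inftyE // h.
    by rewrite (R1_outlier cmp zp_gt0 F_neg gamma_gt0 gamma_le1 x0) // -n_outP.
  have [_ ->] := goo_bulk h; move: h; rewrite ltn_ord /= n_outP // => h.
  by rewrite /R1 h.
by rewrite /R0 -{2}[x`_i ^+ 2]addr0 -addr_minr.
Qed.

Let good_iso : \forall n \near \oo, [/\ (A n)^T *m A n = 1%:M, (B n)^T *m B n = 1%:M & (0 < ncols gamma n)%N].
Proof.
near=> n; split; [near: n; exact: (sp_A sp)|near: n; exact: (sp_B sp)|near: n; exact: ncols_oo].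
Unshelve. all: by end_near.
Qed.

Let SEn n th := SE (X n) (u n) (y n) (v n) th.

Let lvec_ord n (k : 'I_(ncols gamma n)) : lvec u k n = col k (u n).
Proof. by rewrite (lvecE _ (ltn_ord k)); congr (col _ _); exact: val_inj. Qed.

Let rvec_ord n (k : 'I_(ncols gamma n)) : rvec v k n = col k (v n).
Proof. by rewrite (rvecE _ (ltn_ord k)); congr (col _ _); exact: val_inj. Qed.

Let SE_sum : \forall n \near \oo, forall th, SEn n th =
  \sum_(i < r) x`_i ^+ 2 + \sum_(k < ncols gamma n) (th < (y n)`_k)%R%:R * g n k.
Proof.
apply: filterS good_iso => n [AA BB _] th.
have sv := Y_svd n; rewrite /SEn /X signal_mxE in sv *.
rewrite (SE_gain _ AA BB sv); congr (_ + _); apply: eq_bigr => k _.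
by rewrite /g lvec_ord rvec_ord /X signal_mxE.
Qed.

Let xsum : R := \sum_(i < r) x`_i.

Let xsum_ge0 : 0 <= xsum.
Proof. by apply: sumr_ge0 => i _; apply: ltW; exact: signal_gt0. Qed.

Let g_low : \forall n \near \oo, forall th,
  \sum_(k < ncols gamma n) (th < (y n)`_k)%R%:R * (y n)`_k ^+ 2 - 2 * (y n)`_0 * xsum <=
  \sum_(k < ncols gamma n) (th < (y n)`_k)%R%:R * g n k.
Proof.
apply: filterS good_iso => n [AA BB _] th.
have sv := Y_svd n; have y0 k := svd_ge0 sv k; have yd k := svd_sorted sv (leq0n k).
rewrite /X signal_mxE in sv.
have x0 (i : 'I_r) : 0 <= x`_i by apply: ltW; exact: signal_gt0.
have ov := overlap_sum_le AA BB x0 sv.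
rewrite lerBlDr -lerBlDl -sumrB.
apply: (@le_trans _ _ (\sum_(k < ncols gamma n) 2 * (y n)`_0 * `|dot (lvec u k n) (X n *m rvec v k n)|)); last first.
  rewrite -mulr_sumr ler_wpM2l ?mulr_ge0 //; apply: le_trans ov.
  rewrite le_eqVlt; apply/orP; left; apply/eqP; apply: eq_bigr => k _.
  by rewrite lvec_ord rvec_ord /X signal_mxE.
apply: ler_sum => k _; rewrite /g -mulrBr opprB addrC subrK.
move: (dot _ _) => t; have h : 2 * (y n)`_k * t <= 2 * (y n)`_0 * `|t|.
  rewrite -!mulrA ler_pM2l //; apply: le_trans (_ : (y n)`_k * `|t| <= _).
    by rewrite ler_wpM2l // ler_norm.
  by rewrite ler_wpM2r.
case: (_ < _); rewrite ?mul1r // mul0r.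
by rewrite !mulr_ge0.
Qed.

Let y_dec n i j : (i <= j)%N -> (y n)`_j <= (y n)`_i.
Proof. by move=> ij; exact: (svd_sorted (Y_svd n) ij). Qed.

Let y_lim k : (y n)`_k @[n --> \oo] --> yoo k.
Proof. exact: (sample_sv gamma_gt0 gamma_le1 cmp zp_gt0 F_neg x_signal s_sv s_cdf sp Y_svd). Qed.

Let g_lim k : g n k @[n --> \oo] --> goo k.
Proof.
have yl := @y_lim k.
have tl := @sample_signal _ F gamma gamma_gt0 gamma_le1 cmp zp_gt0 F_neg div r x x_signal A B Z s s_sv s_cdf sp u y v Y_svd k.
apply: cvgB; first by rewrite expr2; under eq_fun do rewrite expr2; apply: cvgM.
by apply: cvgM => //; apply: cvgM => //; exact: cvg_cst.
Qed.

Let yoo_bulk k : (r <= k)%N -> yoo k = zp.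
Proof. by move=> rk; rewrite /yoo /y_infty ltnNge rk. Qed.

Lemma sample_oracle : oracle_SE (X n) (u n) (y n) (v n) @[n --> \oo] --> ASE gamma F x.
Proof.
rewrite -best_ASE.
apply: (@oracle_lim _ r T zp _ xsum (ncols gamma) (fun n k => (y n)`_k) g yoo goo SEn) => //.
- exact: ncols_oo.
- by move=> k; apply: y_infty_ge.
- exact: goo_below.
- exact: goo_above.
- exact: goo_at.
Qed.

Lemma sample_threshold (th : nat -> R) (theta : R) : th n @[n --> \oo] --> theta ->
  (Theta_lower gamma F x < theta%:E)%E -> (theta%:E < Theta_upper gamma F x)%E ->
  SE (X n) (u n) (y n) (v n) (th n) @[n --> \oo] --> ASE gamma F x.
Proof.
move=> hth low up; rewrite -best_ASE.
have lowk k : (k < r.+1)%N -> yoo k < T -> yoo k < theta.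
  move=> kr kT; rewrite -lte_fin; apply: le_lt_trans low.
  exact: (@le_bigmax_cond _ _ _ _ (Ordinal kr)).
have upk k : (k < r)%N -> T < yoo k -> theta < yoo k.
  move=> kr kT; rewrite -lte_fin; apply: lt_le_trans up _.
  exact: (@bigmin_le_cond _ _ _ _ (Ordinal (leqW kr))).
apply: (@threshold_lim _ r T zp _ (ncols gamma) (fun n k => (y n)`_k) g yoo goo SEn) hth _ _ _ => //.
- exact: ncols_oo.
- exact: goo_below.
- exact: goo_above.
- exact: goo_at.
- by have := lowk r (ltnSn r); rewrite yoo_bulk //; apply.
- by move=> k kr; apply: lowk; exact: ltnW.
Qed.

End SampleLoss.

(** * Almost sure convergence of the loss *)

(** Singular values are nonnegative, and there are continuity points just below
    0. *)
Lemma limit_cdf_neg (R : realType) (F : cumulativeBounded (0 : R) (1 : R)) (n p : nat -> nat)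
    (Z : forall k, 'M[R]_(n k, p k)) (s : nat -> seq R) :
  (forall k, singular_values (Z k) (s k)) ->
  (forall t : R, {for t, continuous F} -> empirical_cdf (s k) t @[k --> \oo] --> F t) ->
  forall t, t < 0 -> F t = 0.
Proof.
move=> s_sv s_cdf t t0; apply/le_anti/andP; split; last first.
  have h := @cumulativeNy _ _ _ F.
  apply: (@ler_cvg_to _ _ _ _ F (fun=> F t) 0 (F t) h); first exact: cvg_cst.
  by near=> u; apply: cumulative_is_nondecreasing; near: u; exact: nbhs_ninfty_le.
have nt : 0 < - t by rewrite oppr_gt0.
have [c /andP[tc c0] hc] := continuity_grid (cumulative_is_nondecreasing F)
  (cumulative_is_right_continuous F) 0 nt.
rewrite opprK in tc; move: (hc 0%N); rewrite mul0r addr0 => /(_ c0) cc.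
have e k : empirical_cdf (s k) c = 0.
  have [U [V [_ _ [_ _ /allP s0] _]]] := s_sv k.
  rewrite /empirical_cdf (_ : count _ _ = 0%N) ?mul0r //.
  apply/eqP; rewrite -leqn0 leqNgt -has_count -all_predC; apply/allP => a /s0 a0 /=.
  by rewrite -ltNge (lt_le_trans c0).
have Fc : F c = 0.
  apply: (@cvg_unique _ (@norm_hausdorff R R) (empirical_cdf (s k) c @[k --> \oo])) => //.
    exact: s_cdf.
  by rewrite /= (_ : (fun k => _) = fun=> 0); [exact: cvg_cst|apply/funext].
apply: (@le_trans _ _ (F c)); last by rewrite Fc.
by apply: cumulative_is_nondecreasing; exact: ltW.
Unshelve. all: by end_near.
Qed.

Section Model.
Context {R : realType} {d : measure_display} {T : measurableType d} (P : probability T R).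
Variables (gamma : R) (gamma_gt0 : 0 < gamma) (gamma_le1 : gamma <= 1).
Variables (r : nat) (x : r.-tuple R) (x_signal : is_signal x).
Variables (a : forall n : nat, T -> 'M[R]_(n, r)) (b : forall n : nat, T -> 'M[R]_(ncols gamma n, r)).
Variables (Z : forall n : nat, T -> 'M[R]_(n, ncols gamma n)).
Variables (model : signal_plus_noise P x a b Z) (F : cumulativeBounded (0 : R) (1 : R)).
Variables (z : forall n : nat, T -> seq R)
  (z_sv : forall (n : nat) (w : T), singular_values (Z n w) (z n w))
  (noise : noise_limits P F z).

Let good n := (r <= ncols gamma n)%N.
Let xs (i : 'I_r) : R := x`_i.

Let xs_neq0 i : xs i != 0.
Proof. by rewrite gt_eqF // signal_gt0. Qed.

Let xs_sqr_inj i j : xs i ^+ 2 = xs j ^+ 2 -> i = j.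
Proof.
move=> /eqP; rewrite eqrXn2 ?(ltW (signal_gt0 x_signal (ltn_ord _))) // => /eqP e.
have [h|h|] := ltngtP (i : nat) (j : nat); last exact: val_inj.
  by have := signal_decr x_signal h (ltn_ord j); rewrite -/(xs i) -/(xs j) e ltxx.
by have := signal_decr x_signal h (ltn_ord i); rewrite -/(xs i) -/(xs j) e ltxx.
Qed.

Let good_gt0 n : good n -> (0 < n)%N.
Proof.
have [r0 _ _] := x_signal => gd; apply: (leq_trans r0); apply: leq_trans gd _.
exact: ncols_le.
Qed.

Let ZX n : good n ->
  independent_mx P (Z n) (fun w => a n w *m diag_mx (\row_i xs i) *m (b n w)^T).
Proof.
move=> gd; have [_ _ _ _] := model gd.
by under [X in independent_mx _ _ X]eq_fun do rewrite signal_mxE.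
Qed.

(** The statements for [Z Z^T] and [Z^T Z] come from the same concentration
    result, applied to the model and to its transpose. *)
Lemma model_spiked : {ae P, forall w,
  [/\ spiked \oo (a ^~ w) (b ^~ w) (Z ^~ w) (upper_edge F) (LP (EE F gamma)) (LP (EE F 1)),
      forall t, t < 0 -> F t = 0 &
      forall t : R, {for t, continuous F} -> empirical_cdf (z n w) t @[n --> \oo] --> F t]}.
Proof.
have [cmp zp0 cdf top _] := noise.
have uA n (gd : good n) : uniform_frame P (a n) by have [] := model gd.
have uB n (gd : good n) : uniform_frame P (b n) by have [] := model gd.
have AB n (gd : good n) : independent_mx P (a n) (b n) by have [] := model gd.
have rZ n (gd : good n) : random_mx (Z n) by have [] := model gd.
have iso : {ae P, forall w, forall n, good n -> (a n w)^T *m a n w = 1%:M /\ (b n w)^T *m b n w = 1%:M}.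
  apply: ae_foralln => n; case gd : (good n); last exact: aeW.
  have [_ hA _] := uA n gd; have [_ hB _] := uB n gd.
  by apply: filterS2 hA hB.
have id_ge n : 1 * n%:R <= n%:R :> R by rewrite mul1r.
have qA := quad_ae xs_neq0 xs_sqr_inj ltr01 good_gt0 id_ge uA uB rZ ZX.
have cr := cross_ae xs_neq0 xs_sqr_inj ltr01 good_gt0 id_ge uA uB AB rZ ZX.
have qB := quad_ae (Z := fun n w => (Z n w)^T) xs_neq0 xs_sqr_inj gamma_gt0 good_gt0
  (ncols_ge gamma_gt0) uB uA (fun n gd => random_mx_tr (rZ n gd)).
have BZX n (gd : good n) :
    independent_mx P (fun w => (Z n w)^T) (fun w => b n w *m diag_mx (\row_i xs i) *m (a n w)^T).
  have := independent_mx_tr (ZX gd).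
  by under [X in independent_mx _ _ X]eq_fun do rewrite !trmx_mul trmxK tr_diag_mx mulmxA.
have {BZX}qB := qB BZX.
near=> w.
have cdfw : forall t : R, {for t, continuous F} -> empirical_cdf (z n w) t @[n --> \oo] --> F t.
  by near: w.
have neg := limit_cdf_neg (z_sv^~ w) cdfw.
split=> //; apply: (sample_spiked gamma_gt0 cmp zp0 neg (z_sv^~ w) cdfw).
- by near: w.
- by near: w.
- by near: w.
- near: w; apply: filterS qB => w h k K m i j; apply: filterS (h k K m i j) => n.
  by rewrite trmxK.
- by near: w.
Unshelve. all: by end_near.
Qed.

End Model.

Theorem theorem1 (R : realType) (d : measure_display) (T : measurableType d)
    (P : probability T R)
    (gamma : R) (gamma_gt0 : 0 < gamma) (gamma_le1 : gamma <= 1)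
    (r : nat) (x : r.-tuple R) (x_signal : is_signal x)
    (a : forall n : nat, T -> 'M[R]_(n, r))
    (b : forall n : nat, T -> 'M[R]_(ncols gamma n, r))
    (Z : forall n : nat, T -> 'M[R]_(n, ncols gamma n))
    (model : signal_plus_noise P x a b Z)
    (F : cumulativeBounded (0 : R) (1 : R))
    (z : forall n : nat, T -> seq R)
    (z_sv : forall (n : nat) (w : T), singular_values (Z n w) (z n w))
    (noise : noise_limits P F z)
    (u : forall n : nat, T -> 'M[R]_(n, ncols gamma n))
    (y : forall n : nat, T -> seq R)
    (v : forall n : nat, T -> 'M[R]_(ncols gamma n))
    (Y_svd : forall (n : nat) (w : T),
       is_svd (signal_mx x (a n w) (b n w) + Z n w) (u n w) (y n w) (v n w)) :
  {ae P, forall w,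
     oracle_SE (signal_mx x (a n w) (b n w)) (u n w) (y n w) (v n w)
       @[n --> \oo] --> ASE gamma F x} /\
  (forall (theta : R) (theta_ : forall n : nat, T -> R),
     (Theta_lower gamma F x < theta%:E)%E ->
     (theta%:E < Theta_upper gamma F x)%E ->
     {ae P, forall w, theta_ n w @[n --> \oo] --> theta} ->
     {ae P, forall w,
        SE (signal_mx x (a n w) (b n w)) (u n w) (y n w) (v n w) (theta_ n w)
          @[n --> \oo] --> ASE gamma F x}).
Proof.
have [cmp zp0 _ _ div] := noise.
have sample := model_spiked gamma_gt0 gamma_le1 x_signal model z_sv noise.
split=> [|theta theta_ low up].
  apply: filterS sample => w [sp neg cdf].
  exact: (sample_oracle gamma_gt0 gamma_le1 cmp zp0 neg div x_signal (z_sv^~ w) cdf sp (Y_svd^~ w)).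
apply: filterS2 sample => w [sp neg cdf] th.
exact: (sample_threshold gamma_gt0 gamma_le1 cmp zp0 neg div x_signal (z_sv^~ w) cdf sp (Y_svd^~ w)
  th low up).
Qed.
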